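(* Let $G\in H^2(\mathbb D)$ and let $A$ be the operator $f\mapsto Gf'$ on $H^2(\mathbb D)$, defined on the domain $D(A)=\{f\in H^2(\mathbb D): Gf'\in H^2(\mathbb D)\}$, which is dense in $H^2(\mathbb D)$. Then the following conditions are equivalent: (i) $A$ generates a $C_0$-semigroup of composition operators on $H^2(\mathbb D)$; (ii) $2\,\mathrm{Re}(\overline z G(z)) + (1-|z|^2)\,\mathrm{Re}(G'(z))\le 0$ for all $z\in\mathbb D$; (iii) $A$ generates a quasicontractive $C_0$-semigroup on $H^2(\mathbb D)$; (iv) $\operatorname{ess\,sup}_{z\in\mathbb T}\mathrm{Re}(\overline z G(z))\le 0$.
   Context: $\mathbb D$ is the open unit disc, $\mathbb T$ the unit circle, and $H^2(\mathbb D)$ is the Hardy space of analytic functions $f(z)=\sum_{n\ge0}c_nz^n$ on $\mathbb D$ with $\|f\|^2=\sum_{n\ge 0}|c_n|^2<\infty$. On $\mathbb T$, $G$ denotes the (almost everywhere defined) radial boundary values of $G$. A $C_0$-semigroup on a Banach space $X$ is a strongly continuous family $(T(t))_{t\ge0}$ of bounded linear operators with $T(0)=\mathrm{Id}$ and $T(t+s)=T(t)T(s)$. Its generator is $Ax=\lim_{t\downarrow0}(T(t)x-x)/t$, with domain $D(A)$ the set of $x\in X$ for which this limit exists. It is quasicontractive if there is $w\ge0$ with $\|T(t)\|\le e^{wt}$ for all $t\ge0$. A semigroup of analytic functions on $\mathbb D$ is a family $(\varphi_t)_{t\ge0}$ of analytic self-maps of $\mathbb D$ such that $\varphi_0(z)=z$,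 $\varphi_{t+s}=\varphi_t\circ\varphi_s$ for all $s,t\ge0$, and $(t,z)\mapsto\varphi_t(z)$ is continuous on $[0,\infty)\times\mathbb D$. ''$A$ generates a $C_0$-semigroup of composition operators'' means that $A$ (with its domain $D(A)$) is the generator of a $C_0$-semigroup of the form $T(t)=C_{\varphi_t}$, $C_{\varphi_t}f=f\circ\varphi_t$, for some semigroup $(\varphi_t)_{t\ge0}$ of analytic functions on $\mathbb D$. *)

(* Defs.v *)
From HB Require Import structures.
From mathcomp Require Import all_boot all_order all_algebra.
From mathcomp Require Import all_classical all_reals all_analysis ess_sup_inf.
From mathcomp Require Import complex ring lra.

Set Implicit Arguments.
Unset Strict Implicit.
Unset Printing Implicit Defensive.

Import Order.TTheory GRing.Theory Num.Theory numFieldNormedType.Exports.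
Import Normc.

Local Open Scope classical_set_scope.
Local Open Scope ring_scope.
Local Open Scope complex_scope.

(* R[i] as a normed space over itself, so that [derivable f z 1] is complex
   differentiability and [derive1 f] is the complex derivative. *)
HB.instance Definition _ (R : realType) := NormedModule.copy R[i] (R[i])^o.

Section unit_disc.
Variable R : realType.

Definition disc : set R[i] := [set z | `|z| < 1].

Definition cis (theta : R) : R[i] := cos theta +i* sin theta.

(* Lebesgue measure on [0, 2 pi[, which parametrizes the unit circle by
   [cis]; null sets correspond to arc-length null sets. *)
Definition circle_measure : {measure set measurableTypeR R -> \bar R} :=
  mrestr (@lebesgue_measure R) (measurable_itv `[0%R, (pi *+ 2)%R[).

Definition radial_limit (f : R[i] -> R[i]) (z : R[i]) : R[i] :=
  lim (f (r%:C * z) @[r --> (1 : R)^'-]).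

End unit_disc.

Section power_series.
Variable R : realType.
Local Notation C := R[i].
Implicit Types (c d : nat -> C) (f g : C -> C).

Definition square_summable c : Prop :=
  cvgn (series (fun n => normc (c n) ^+ 2)).

Definition l2norm c : R :=
  Num.sqrt (limn (series (fun n => normc (c n) ^+ 2))).

Definition has_power_series f c : Prop := forall z, disc z ->
  series (fun n => c n * z ^+ n) @ \oo --> f z.

(* Functions on the disc are represented by total functions vanishing off the
   disc, so that equality of functions on the disc is Leibniz equality. *)
Definition hardy : {pred C -> C} := mem [set f |
  (forall z, ~ disc z -> f z = 0) /\
  (exists2 c, has_power_series f c & square_summable c)].

Definition taylor_coef f : nat -> C :=
  xget (fun=> 0) [set c | has_power_series f c /\ square_summable c].

Let normc_ge0 (z : C) : 0 <= normc z.
Proof. by case: z => a b; exact: sqrtr_ge0. Qed.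

Let sqn_ge0 c n : 0 <= normc (c n) ^+ 2. Proof. exact: sqr_ge0. Qed.

Let series_nd c : nondecreasing_seq (series (fun n => normc (c n) ^+ 2)).
Proof. by apply/nondecreasing_series => n _ _; exact: sqn_ge0. Qed.

Lemma square_summable_le c n : square_summable c ->
  normc (c n) ^+ 2 <= limn (series (fun n => normc (c n) ^+ 2)).
Proof.
move=> sc; apply: le_trans (nondecreasing_cvgn_le (series_nd c) sc n.+1).
rewrite /series /= big_nat_recr//= lerDr.
by apply: sumr_ge0 => i _; exact: sqn_ge0.
Qed.

Lemma l2norm_ge0 c : 0 <= l2norm c. Proof. exact: sqrtr_ge0. Qed.

Lemma l2norm_sqr c : square_summable c ->
  l2norm c ^+ 2 = limn (series (fun n => normc (c n) ^+ 2)).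
Proof.
by move=> sc; rewrite sqr_sqrtr// (le_trans _ (square_summable_le 0 sc)).
Qed.

Lemma l2norm_eq0 c : square_summable c -> l2norm c = 0 -> c = fun=> 0.
Proof.
move=> sc c0; apply/funext => n; apply: eq0_normc; apply/eqP.
have := square_summable_le n sc; rewrite -l2norm_sqr// c0 expr0n/= => le0.
by rewrite -sqrf_eq0 eq_le le0 sqn_ge0.
Qed.

Let l2_le (a b : R) c d e : 0 <= a -> 0 <= b ->
  square_summable c -> square_summable d ->
  (forall n, normc (e n) ^+ 2 <= a * normc (c n) ^+ 2 + b * normc (d n) ^+ 2) ->
  square_summable e /\ l2norm e ^+ 2 <= a * l2norm c ^+ 2 + b * l2norm d ^+ 2.
Proof.
move=> a0 b0 sc sd eab.
pose u : R^nat := fun n => normc (c n) ^+ 2.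
pose v : R^nat := fun n => normc (d n) ^+ 2.
have cu : cvgn (series (a *: u)) by apply: is_cvg_seriesZ.
have cv : cvgn (series (b *: v)) by apply: is_cvg_seriesZ.
have cuv : cvgn (series (a *: u + b *: v)) by apply: is_cvg_seriesD.
have uv n : normc (e n) ^+ 2 <= (a *: u + b *: v) n by exact: eab.
have se : square_summable e.
  apply: (series_le_cvg _ _ _ cuv) => // n.
  exact: le_trans (sqn_ge0 e n) (uv n).
split=> //; rewrite !l2norm_sqr//.
have -> : a * limn (series u) + b * limn (series v) =
          limn (series (a *: u + b *: v)).
  by rewrite lim_seriesD// !lim_seriesZ.
exact: lim_series_le.
Qed.

Let l2D (t : R) c d : 0 < t -> square_summable c -> square_summable d ->
  square_summable (fun n => c n + d n) /\
  l2norm (fun n => c n + d n) ^+ 2 <=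
    (1 + t) * l2norm c ^+ 2 + (1 + t^-1) * l2norm d ^+ 2.
Proof.
move=> t0 sc sd; have ti0 : 0 < t^-1 by rewrite invr_gt0.
apply: l2_le => //; [by lra|by lra|move=> n].
apply: (@le_trans _ _ ((normc (c n) + normc (d n)) ^+ 2)).
  by rewrite lerXn2r// ?nnegrE ?addr_ge0//; exact: le_normcD.
set x := normc (c n); set y := normc (d n).
rewrite -subr_ge0.
have -> : (1 + t) * x ^+ 2 + (1 + t^-1) * y ^+ 2 - (x + y) ^+ 2 =
          t^-1 * (t * x - y) ^+ 2.
  by field; rewrite gt_eqF.
by rewrite mulr_ge0 ?sqr_ge0 ?ltW.
Qed.

Lemma square_summableD c d : square_summable c -> square_summable d ->
  square_summable (fun n => c n + d n).
Proof. by move=> sc sd; have [] := l2D ltr01 sc sd. Qed.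

Lemma l2normD c d : square_summable c -> square_summable d ->
  l2norm (fun n => c n + d n) <= l2norm c + l2norm d.
Proof.
move=> sc sd.
have [c0|cn0] := eqVneq (l2norm c) 0.
  rewrite c0 add0r le_eqVlt; apply/orP; left; apply/eqP; congr l2norm.
  by apply/funext => n; rewrite (l2norm_eq0 sc c0) add0r.
have [d0|dn0] := eqVneq (l2norm d) 0.
  rewrite d0 addr0 le_eqVlt; apply/orP; left; apply/eqP; congr l2norm.
  by apply/funext => n; rewrite (l2norm_eq0 sd d0) addr0.
have cp : 0 < l2norm c by rewrite lt_def cn0 l2norm_ge0.
have dp : 0 < l2norm d by rewrite lt_def dn0 l2norm_ge0.
have [_] := l2D (divr_gt0 dp cp) sc sd.
set x := l2norm c in cn0 cp *; set y := l2norm d in dn0 dp *.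
have -> : (1 + y / x) * x ^+ 2 + (1 + (y / x)^-1) * y ^+ 2 = (x + y) ^+ 2.
  by field; rewrite dn0 cn0.
by rewrite ler_pXn2r// ?nnegrE ?l2norm_ge0// addr_ge0 ?ltW.
Qed.

Lemma square_summable0 : square_summable (fun=> 0).
Proof.
rewrite /square_summable.
have -> : series (fun n => normc ((fun=> 0 : C) n) ^+ 2) = cst 0.
  by apply/funext => n; apply: big1 => i _; rewrite [normc _](normc0 R) expr0n.
exact: is_cvg_cst.
Qed.

Let sqnZ (a : C) c : (fun n => normc (a * c n) ^+ 2) =
  (normc a ^+ 2) *: ((fun n => normc (c n) ^+ 2) : R^nat).
Proof. by apply/funext => n; rewrite normcM exprMn. Qed.

Lemma square_summableZ (a : C) c : square_summable c ->
  square_summable (fun n => a * c n).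
Proof. by move=> sc; rewrite /square_summable sqnZ; exact: is_cvg_seriesZ. Qed.

Lemma l2normZ (a : C) c : square_summable c ->
  l2norm (fun n => a * c n) = normc a * l2norm c.
Proof.
move=> sc; rewrite /l2norm sqnZ lim_seriesZ//.
by rewrite [_ *: _]/(_ * _) sqrtrM ?sqr_ge0// sqrtr_sqr ger0_norm.
Qed.

Lemma has_power_seriesD f g c d : has_power_series f c ->
  has_power_series g d -> has_power_series (f + g) (fun n => c n + d n).
Proof.
move=> fc gd z zD.
have -> : (fun n => (c n + d n) * z ^+ n) =
    (fun n => c n * z ^+ n) + (fun n => d n * z ^+ n).
  by apply/funext => n; rewrite mulrDl.
by rewrite seriesD; apply: cvgD; [exact: fc|exact: gd].
Qed.

Lemma has_power_seriesZ f c (a : C) : has_power_series f c ->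
  has_power_series (a *: f) (fun n => a * c n).
Proof.
move=> fc z zD.
have -> : (fun n => a * c n * z ^+ n) = a *: ((fun n => c n * z ^+ n) : C^nat).
  by apply/funext => n; rewrite -mulrA.
by rewrite seriesZ; apply: cvgZl_tmp; exact: fc.
Qed.

Let pow_sum_le (r : R) n : 0 <= r -> r <= 2^-1 ->
  \sum_(0 <= i < n) r ^+ i <= 2.
Proof.
move=> r0 r2; rewrite -(ler_pM2l (_ : 0 < 1 - r)); last by lra.
rewrite big_mkord -opprB mulNr -subrX1 opprB.
by have := exprn_ge0 n r0; lra.
Qed.

Let normc_sum n (F : nat -> C) :
  normc (\sum_(0 <= i < n) F i) <= \sum_(0 <= i < n) normc (F i).
Proof.
elim: n => [|n IH]; first by rewrite !big_nil normc0.
rewrite !big_nat_recr//=; apply: le_trans (le_normcD _ _) _.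
by rewrite lerD2r.
Qed.

Let normcX (z : C) n : normc (z ^+ n) = normc z ^+ n.
Proof. by elim: n => [|n IH]; rewrite ?expr0 ?normc1// !exprS normcM IH. Qed.

Let vanish_on_punctured_disc c := forall z : C, z != 0 -> disc z ->
  series (fun n => c n * z ^+ n) @ \oo --> (0 : C).

Let coef0_eq0 (M : R) c : (forall n, normc (c n) <= M) ->
  vanish_on_punctured_disc c -> c 0%N = 0.
Proof.
move=> cM c0; apply: eq0_normc; apply/eqP.
have := normc_ge0 (c 0%N); rewrite le_eqVlt => /orP[/eqP <-//|a0].
set a := normc _ in a0 *; have aM : a <= M by exact: cM.
have M0 : 0 < M by exact: lt_le_trans aM.
pose r : R := a / (4 * M).
have M40 : 0 < 4 * M by lra.
have r0 : 0 < r by exact: divr_gt0.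
have rM : r * M = a / 4 by rewrite /r; field; rewrite gt_eqF.
have r4 : r <= 4^-1 by rewrite ler_pdivrMr//; lra.
have nr : normc (r%:C : C) = r by rewrite /= expr0n addr0 sqrtr_sqr gtr0_norm.
have rn0 : (r%:C : C) != 0.
  by apply/eqP => /(congr1 (@complex.Re R))/= r00; rewrite r00 ltxx in r0.
have rD : disc (r%:C : C).
  by rewrite /disc/= -[`|_|]/((normc (r%:C : C))%:C) nr ltcR; lra.
have e0 : 0 < ((a / 4)%:C : C) by rewrite ltcR divr_gt0.
have /cvgr0_norm_lt/(_ _ e0) := c0 _ rn0 rD.
case=> N _ /(_ N.+1 (leqnSn N)).
rewrite -[`|_|]/((normc _)%:C) ltcR => SN.
pose T := \sum_(0 <= i < N) c i.+1 * (r%:C : C) ^+ i.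
have ST : series (fun n => c n * (r%:C : C) ^+ n) N.+1 = c 0%N + r%:C * T.
  rewrite /series/= big_nat_recl//= expr0 mulr1; congr (_ + _).
  by rewrite /T big_distrr/=; apply: eq_bigr => i _; rewrite exprS; ring.
have TM : normc T <= 2 * M.
  apply: le_trans (normc_sum _ _) _.
  apply: (@le_trans _ _ (\sum_(0 <= i < N) M * r ^+ i)).
    apply: ler_sum => i _; rewrite normcM normcX nr.
    by apply: ler_wpM2r => //; rewrite exprn_ge0// ltW.
  rewrite -big_distrr/= mulrC; apply: ler_wpM2r; first exact: ltW.
  by apply: pow_sum_le; lra.
have : a <= normc (c 0%N + r%:C * T) + r * normc T.
  rewrite -{2}nr -normcM -(normcN (_ * T)).
  by apply: le_trans (le_normcD _ _); rewrite addrK.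
rewrite -ST.
have : r * normc T <= r * (2 * M) by rewrite ler_wpM2l// ltW.
by lra.
Qed.

Let vanish_shift c : c 0%N = 0 -> vanish_on_punctured_disc c ->
  vanish_on_punctured_disc (fun n => c n.+1).
Proof.
move=> c0 cv z z0 zD.
have := cv z z0 zD; rewrite -cvg_shiftS => /(@cvgZl_tmp _ _ _ _ _ z^-1).
rewrite scaler0; apply: cvg_trans; apply: near_eq_cvg; near=> n.
rewrite /= /series/= big_nat_recl//= c0 mul0r add0r scaler_sumr.
apply: eq_bigr => i _; rewrite -[LHS]/(z^-1 * (c i.+1 * z ^+ i.+1)).
by rewrite exprS mulrCA mulKf.
Unshelve. all: by end_near. Qed.

Lemma has_power_series_inj f c d : square_summable c -> square_summable d ->
  has_power_series f c -> has_power_series f d -> c = d.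
Proof.
move=> sc sd fc fd; pose e n := c n + (-1) * d n.
have se : square_summable e.
  by apply: square_summableD => //; exact: square_summableZ.
pose L := limn (series (fun n => normc (e n) ^+ 2)).
have eM n : normc (e n) <= 1 + L.
  by have := square_summable_le n se; rewrite -/L => ?; nra.
have ev : vanish_on_punctured_disc e.
  move=> z _ zD.
  have := has_power_seriesD fc (has_power_seriesZ (a := -1) fd) zD.
  by rewrite scaleN1r subrr.
have evn n : vanish_on_punctured_disc (fun m => e (n + m)%N).
  elim: n => // n IH.
  have := vanish_shift (coef0_eq0 (fun m => eM (n + m)%N) IH) IH.
  by congr vanish_on_punctured_disc; apply/funext => m; rewrite addnS addSn.
apply/funext => n.
have := coef0_eq0 (fun m => eM (n + m)%N) (evn n).
by rewrite addn0 /e mulN1r => /eqP; rewrite subr_eq0 => /eqP.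
Qed.

Lemma taylor_coefE f c : has_power_series f c -> square_summable c ->
  taylor_coef f = c.
Proof.
move=> fc sc; rewrite /taylor_coef; case: xgetP => [d _ [fd sd]|/(_ c)[]//].
exact: has_power_series_inj fd fc.
Qed.

Lemma taylor_coefP f : f \in hardy ->
  has_power_series f (taylor_coef f) /\ square_summable (taylor_coef f).
Proof. by move=> /set_mem[_ [c fc sc]]; rewrite (taylor_coefE fc sc). Qed.

Lemma hardy_submod_closed : submod_closed hardy.
Proof.
split.
  apply/mem_set; split=> //; exists (fun=> 0); last exact: square_summable0.
  move=> z _; have -> : (fun n => 0 * z ^+ n) = (fun=> 0 : C).
    by apply/funext => n; rewrite mul0r.
  have -> : series (fun=> 0 : C) = cst 0.
    by apply/funext => n; rewrite /series/= big1.
  exact: cvg_cst.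
move=> a f g /set_mem[f0 [c fc sc]] /set_mem[g0 [d gd sd]].
apply/mem_set; split=> [z zD|].
  by rewrite -[LHS]/(a * f z + g z) f0// g0// mulr0 addr0.
exists (fun n => a * c n + d n).
  exact (has_power_seriesD (has_power_seriesZ (a := a) fc) gd).
exact (square_summableD (square_summableZ (a := a) sc) sd).
Qed.

HB.instance Definition _ :=
  GRing.isSubmodClosed.Build _ _ hardy hardy_submod_closed.

End power_series.

Record H2 (R : realType) := MkH2 {
  H2_fun :> R[i] -> R[i];
  H2_funP : H2_fun \in @hardy R }.

Section hardy_space.
Variable R : realType.

HB.instance Definition _ := [isSub for @H2_fun R].
HB.instance Definition _ := [Choice of H2 R by <:].
HB.instance Definition _ := [SubChoice_isSubLmodule of H2 R by <:].

Definition H2_norm (f : H2 R) : R[i] := (l2norm (taylor_coef f))%:C.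

Let H2_normD f g : H2_norm (f + g) <= H2_norm f + H2_norm g.
Proof.
have [fc sc] := taylor_coefP (H2_funP f).
have [gd sd] := taylor_coefP (H2_funP g).
rewrite /H2_norm -rmorphD lecR.
rewrite (taylor_coefE (has_power_seriesD fc gd) (square_summableD sc sd)).
exact: l2normD.
Qed.

Let H2_normZ (a : R[i]) f : H2_norm (a *: f) = `|a| * H2_norm f.
Proof.
have [fc sc] := taylor_coefP (H2_funP f).
rewrite /H2_norm.
rewrite (taylor_coefE (has_power_seriesZ (a := a) fc) (square_summableZ (a := a) sc)).
by rewrite l2normZ// rmorphM.
Qed.

Let H2_norm_eq0 f : H2_norm f = 0 -> f = 0.
Proof.
have [fc sc] := taylor_coefP (H2_funP f).
move=> /complexI /(l2norm_eq0 sc) c0; apply/val_inj/funext => z /=.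
have [zD|zD] := pselect (disc z); last first.
  by have /set_mem[/(_ z zD)] := H2_funP f.
have := fc z zD; rewrite c0.
have -> : series (fun n => (fun=> 0) n * z ^+ n) = cst (0 : R[i]).
  by apply/funext => n; rewrite /series/= big1// => i _; rewrite mul0r.
by move=> /cvg_lim <-//; rewrite lim_cst.
Qed.

HB.instance Definition _ :=
  Lmodule_isNormed.Build R[i] (H2 R) H2_normD H2_normZ H2_norm_eq0.

End hardy_space.

Section semigroups.
Variables (R : realType) (X : normedModType R[i]).
Implicit Types (T : R -> {linear X -> X}) (D : set X) (A : X -> X).

(* Only the operators [T t] with [0 <= t] are constrained; a linear operator is
   bounded if and only if it is continuous. *)
Definition C0_semigroup T : Prop :=
  [/\ forall t, 0 <= t -> continuous (T t),
      forall x, T 0 x = x,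
      forall t s, 0 <= t -> 0 <= s -> forall x, T (t + s) x = T t (T s x) &
      forall x, {within `[0, +oo[, continuous (fun t => T t x)}].

Definition quasicontractive T : Prop := exists2 w : R, 0 <= w &
  forall t, 0 <= t -> forall x, `|T t x| <= (expR (w * t))%:C * `|x|.

Definition diff_quotient T (x : X) (t : R) : X := (t^-1)%:C *: (T t x - x).

(* The operator [A], considered on its domain [D] only, is the generator. *)
Definition is_generator T D A : Prop :=
  D = [set x | cvg (diff_quotient T x t @[t --> 0^'+])] /\
  forall x, D x -> diff_quotient T x t @[t --> 0^'+] --> A x.

Definition generates_quasicontractive D A : Prop :=
  exists T, [/\ C0_semigroup T, quasicontractive T & is_generator T D A].

End semigroups.

Section composition_semigroups.
Variable R : realType.

Definition analytic_semigroup (phi : R -> R[i] -> R[i]) : Prop :=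
  [/\ forall t, 0 <= t -> forall z, disc z ->
        disc (phi t z) /\ derivable (phi t) z 1,
      forall z, disc z -> phi 0 z = z,
      forall t s, 0 <= t -> 0 <= s ->
        forall z, disc z -> phi (t + s) z = phi t (phi s z) &
      {within `[0, +oo[ `*` @disc R,
        continuous (fun tz : R * R[i] => phi tz.1 tz.2)}].

Definition composition_semigroup (T : R -> {linear H2 R -> H2 R}) : Prop :=
  exists2 phi, analytic_semigroup phi &
    forall t, 0 <= t -> forall (f : H2 R) z, disc z -> T t f z = f (phi t z).

Definition generates_composition (D : set (H2 R)) (A : H2 R -> H2 R) : Prop :=
  exists T, [/\ C0_semigroup T, composition_semigroup T & is_generator T D A].

(* [G] vanishes off the disc, hence so does [z |-> G z * f'(z)]. *)
Definition opA_dom (G : H2 R) : set (H2 R) :=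
  [set f : H2 R | (G : R[i] -> R[i]) \* derive1 f \in @hardy R].

(* [insubd] returns its default value 0 off [opA_dom G]. *)
Definition opA (G f : H2 R) : H2 R :=
  insubd 0 ((G : R[i] -> R[i]) \* derive1 f).

End composition_semigroups.

(* Main.v *)
(* Write g for the Taylor coefficients of G. The four conditions meet in one
   quadratic-form condition: Re <G q, z q> <= 0 for every polynomial q, which on the
   circle says that Re (conj z G(z)) <= 0 in a weak sense.

   Applied to the square of the Szego kernel at z it gives (ii). Integrating (ii)
   along a radius gives Re (conj z G(z)) <= |G(0)| (1 - |z|^2) on the disc, and the
   quadratic-form condition comes back by taking circle means of Re (conj z G(rz)) |q(z)|^2
   as r -> 1. The same bound makes the disc invariant under the flow of z' = G(z).
   The operators C_phi_t are bounded because their adjoints move Szego kernels along the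
   flow, and the squared norm of a moving kernel combination h has derivative
   2 Re <G h', h> <= 2 |G(0)| |h|^2: the derivative h' is a sum of backward shifts, to
   each of which the quadratic-form condition applies. So Gronwall's lemma gives
   |C_phi_t| <= exp(|G(0)| t), hence (i) and (iii).

   Conversely, (i) gives the condition by differentiating at t = 0 the contraction
   inequality mean of Re (conj z phi_t(z)) |q(z)|^2 <= |q|^2; (iii) by applying
   Re <A f, f> <= w |f|^2 to f = z^n q, where the left side is n times the form plus a
   bounded term; (iv) by Fatou's theorem (from the Hardy-Littlewood maximal inequality)
   and the boundedness of G(r .) in L^2 of the circle. *)
Require Import Defs.
From HB Require Import structures.
From mathcomp Require Import all_boot all_order all_algebra.
From mathcomp Require Import all_classical all_reals all_analysis ess_sup_inf measurable_realfun.
From mathcomp Require Import complex ring lra zify.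
Set Implicit Arguments.
Unset Strict Implicit.
Unset Printing Implicit Defensive.
Import Order.TTheory GRing.Theory Num.Theory numFieldNormedType.Exports.
Import Normc.
Local Open Scope classical_set_scope.
Local Open Scope complex_scope.
Local Open Scope ring_scope.

(** * Modulus, conjugation and limits in the complex field *)

Section complex_basics.
Variable R : realType.
Local Notation C := R[i].
Implicit Types (z w : C) (a b c d : nat -> C).

(** G is only in H2: multiplication by G may be unbounded and boundary values exist only almost
    everywhere. Testing on polynomials q makes the form a finite sum in finitely many coefficients
    of G, so it survives limits that are merely coefficientwise: dilations G(r .) as r -> 1 and
    difference quotients of a semigroup. Norms are read off on finite combinations of kernels: their
    Gram sums are rational in the moving points and can be differentiated in t, and Riesz
    representation turns an estimate on all such combinations into an element of H2. The same
    duality replaces vector-valued integrals when the generator is identified. The constant |G(0)|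
    is the price of one coefficient. In Re <G h', h> the m-th shift falls under the form except for
    the term G(0) h_(m+1) conj h_m, and these terms sum to at most |G(0)| |h|^2 by the
    arithmetic-geometric mean inequality. The domain of A is maximal, so it is identified by
    evaluation: if a difference quotient converges in H2, its limit must agree with G f' at each
    point of the disc. *)

Lemma normc_ge0 z : 0 <= normc z.
Proof. by case: z => x y; exact: sqrtr_ge0. Qed.

Lemma normcX z n : normc (z ^+ n) = normc z ^+ n.
Proof. by elim: n => [|n IH]; rewrite ?expr0 ?normc1// !exprS normcM IH. Qed.

Lemma normc_real (x : R) : normc (x%:C : C) = `|x|.
Proof. by rewrite /normc /= expr0n addr0 sqrtr_sqr. Qed.

Lemma conjE z : z^* = conjc z. Proof. by []. Qed.

Lemma normc_conj z : normc z^* = normc z.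
Proof. by rewrite conjE; case: z => x y /=; rewrite sqrrN. Qed.

Lemma sqr_normcE z : normc z ^+ 2 = complex.Re z ^+ 2 + complex.Im z ^+ 2.
Proof. by case: z => x y /=; rewrite sqr_sqrtr// addr_ge0// sqr_ge0. Qed.

Lemma sqr_normc_Re z : normc z ^+ 2 = complex.Re (z * z^*).
Proof. by rewrite sqr_normcE conjE; case: z => x y /=; ring. Qed.

Lemma abs_Re_le z : `|complex.Re z| <= normc z.
Proof.
rewrite -(@ler_pXn2r _ 2)// ?nnegrE ?normc_ge0// sqr_normcE -normrX ger0_norm ?sqr_ge0//.
by rewrite lerDl sqr_ge0.
Qed.

Lemma abs_Im_le z : `|complex.Im z| <= normc z.
Proof.
rewrite -(@ler_pXn2r _ 2)// ?nnegrE ?normc_ge0// sqr_normcE -normrX ger0_norm ?sqr_ge0//.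
by rewrite lerDr sqr_ge0.
Qed.

Lemma Re_le z : complex.Re z <= normc z.
Proof. exact: le_trans (ler_norm _) (abs_Re_le z). Qed.

Lemma normc_le_ReIm z : normc z <= `|complex.Re z| + `|complex.Im z|.
Proof.
rewrite -(@ler_pXn2r _ 2)// ?nnegrE ?normc_ge0 ?addr_ge0// sqr_normcE.
have : 0 <= `|complex.Re z| * `|complex.Im z| by rewrite mulr_ge0.
by rewrite sqrrD !real_normK ?num_real//; nra.
Qed.

Lemma distcC z w : normc (z - w) = normc (w - z).
Proof. by rewrite -normcN opprB. Qed.

Lemma le_distcB z w : normc z - normc w <= normc (z - w).
Proof. by rewrite lerBlDr -{1}(subrK w z) le_normcD. Qed.

Lemma normc_sum (I : Type) (r : seq I) (P : pred I) (F : I -> C) :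
  normc (\sum_(i <- r | P i) F i) <= \sum_(i <- r | P i) normc (F i).
Proof.
elim/big_rec2: _ => [|i x y Pi h]; first by rewrite normc0.
by apply: le_trans (le_normcD _ _) _; rewrite lerD2l.
Qed.

Lemma disc_normc z : disc z <-> normc z < 1.
Proof.
by rewrite /disc /= -[`|_|]/((normc z)%:C) (_ : 1 = (1 : R)%:C)// ltcR.
Qed.

Lemma ReM_real (x : R) z : complex.Re (x%:C * z) = x * complex.Re z.
Proof. by case: z => u v /=; rewrite mul0r subr0. Qed.

Lemma ImM_real (x : R) z : complex.Im (x%:C * z) = x * complex.Im z.
Proof. by case: z => u v /=; rewrite mul0r addr0. Qed.

Lemma Re_conj z : complex.Re z^* = complex.Re z. Proof. by rewrite conjE; case: z. Qed.

Lemma conjM z w : (z * w)^* = z^* * w^*.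
Proof. exact: rmorphM. Qed.

Lemma conjX z n : (z ^+ n)^* = z^* ^+ n.
Proof. exact: rmorphXn. Qed.

Lemma conjD z w : (z + w)^* = z^* + w^*.
Proof. exact: raddfD. Qed.

Lemma conj_sum (I : Type) (r : seq I) (P : pred I) (F : I -> C) :
  (\sum_(i <- r | P i) F i)^* = \sum_(i <- r | P i) (F i)^*.
Proof. exact: raddf_sum. Qed.

Lemma conj_real (x : R) : (x%:C : C)^* = x%:C.
Proof. by rewrite conjE /= oppr0. Qed.

Lemma conj_nat n : (n%:R : C)^* = n%:R.
Proof. exact: rmorph_nat. Qed.

Lemma conjB z w : (z - w)^* = z^* - w^*.
Proof. exact: rmorphB. Qed.

Lemma conjV z : (z^-1)^* = (z^*)^-1.
Proof. exact: fmorphV. Qed.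

Lemma conj1 : (1 : C)^* = 1.
Proof. exact: rmorph1. Qed.

Lemma conj0 : (0 : C)^* = 0.
Proof. exact: rmorph0. Qed.

Lemma ReMconjC z w : complex.Re (z * w^*) = complex.Re (w * z^*).
Proof. by rewrite -Re_conj conjM conjCK mulrC. Qed.

(** A rotation turns bounds on real parts into bounds on moduli; [dot], [evs] and the mean value
    theorem only see real parts. *)
Lemma unimodular_Re z : exists2 u : C, normc u = 1 & complex.Re (u * z) = normc z.
Proof.
have [->|z0] := eqVneq z 0; first by exists 1; rewrite ?normc1// mulr0 normc0.
have n0 : normc z != 0 by apply/eqP => /eq0_normc/eqP; apply/negP.
exists (z^* / (normc z)%:C).
  rewrite normcM normcV normc_conj normc_real ger0_norm ?normc_ge0// mulfV//.
rewrite -mulrA -[_^-1](rmorphV (real_complex R)) ?unitfE// mulrCA ReM_real mulrC [_^* * _]mulrC -sqr_normc_Re.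
by rewrite expr2 mulfK.
Qed.

Lemma ReD z w : complex.Re (z + w) = complex.Re z + complex.Re w.
Proof. by case: z; case: w. Qed.

Lemma ReN z : complex.Re (- z) = - complex.Re z. Proof. by case: z. Qed.

Lemma ReB z w : complex.Re (z - w) = complex.Re z - complex.Re w.
Proof. by rewrite ReD ReN. Qed.

Lemma ImB z w : complex.Im (z - w) = complex.Im z - complex.Im w.
Proof. by case: z; case: w. Qed.

Lemma Re_sum (I : Type) (r : seq I) (P : pred I) (F : I -> C) :
  complex.Re (\sum_(i <- r | P i) F i) = \sum_(i <- r | P i) complex.Re (F i).
Proof. by elim/big_rec2: _ => // i x y _ <-; rewrite ReD. Qed.

Lemma Im_sum (I : Type) (r : seq I) (P : pred I) (F : I -> C) :
  complex.Im (\sum_(i <- r | P i) F i) = \sum_(i <- r | P i) complex.Im (F i).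
Proof. by elim/big_rec2: _ => // i x y _ <-; case: (F i); case: y. Qed.

Lemma cvg_conv (T : Type) (F : set_system T) (V : nbhsType) (f g : T -> V) (l m : V) :
  f x @[x --> F] --> l -> f = g -> l = m -> g x @[x --> F] --> m.
Proof. by move=> h <- <-. Qed.

Section limits.
Context {T : Type} {F : set_system T} {FF : Filter F}.

(** The norm on [R[i]] takes its values in [R[i]] itself; through [normc], limits are estimated in
    [R]. *)
Lemma cvg_normcP (u : T -> C) (l : C) :
  (u x @[x --> F] --> l) <-> (normc (u x - l) @[x --> F] --> (0 : R)).
Proof.
split=> h.
  apply/cvgrPdist_lt => e e0.
  have e0' : 0 < (e%:C : C) by rewrite ltcR.
  move/cvgrPdist_lt : h => /(_ _ e0'); apply: filterS => x.
  by rewrite -[`|_|]/((normc _)%:C) ltcR sub0r normrN distcC ger0_norm ?normc_ge0.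
apply/cvgrPdist_lt => e e0.
(* A positive element of [R[i]] is real, so the complex radius equals its real part. *)
have eE : e = (complex.Re e)%:C.
  by case: e e0 => a b; rewrite ltcE/= => /andP[/eqP -> _].
have e0' : 0 < complex.Re e by move: e0; rewrite ltcE/= => /andP[].
move/cvgrPdist_lt : h => /(_ _ e0'); apply: filterS => x.
by rewrite eE -[`|l - _|]/((normc _)%:C) ltcR sub0r normrN distcC ger0_norm ?normc_ge0.
Qed.

Lemma cvg_normc0_le (u : T -> C) (l : C) (v : T -> R) :
  (\near F, normc (u F - l) <= v F) -> v x @[x --> F] --> (0 : R) -> u x @[x --> F] --> l.
Proof.
move=> uv v0; apply/cvg_normcP; apply: (@squeeze_cvgr _ _ _ _ (fun=> 0) v) => //.
  by apply: filterS uv => x; rewrite normc_ge0.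
exact: cvg_cst.
Qed.

Lemma cvg_Re (u : T -> C) (l : C) : u x @[x --> F] --> l ->
  complex.Re (u x) @[x --> F] --> complex.Re l.
Proof.
move=> /cvg_normcP h; apply/cvgrPdist_le => e e0.
move/cvgrPdist_le : h => /(_ _ e0); apply: filterS => x; apply: le_trans.
by rewrite sub0r normrN distcC (ger0_norm (normc_ge0 _)) -ReB; exact: abs_Re_le.
Qed.

Lemma cvg_Im (u : T -> C) (l : C) : u x @[x --> F] --> l ->
  complex.Im (u x) @[x --> F] --> complex.Im l.
Proof.
move=> /cvg_normcP h; apply/cvgrPdist_le => e e0.
move/cvgrPdist_le : h => /(_ _ e0); apply: filterS => x; apply: le_trans.
by rewrite sub0r normrN distcC (ger0_norm (normc_ge0 _)) -ImB; exact: abs_Im_le.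
Qed.

Lemma cvg_ReIm (u : T -> C) (l : C) :
  complex.Re (u x) @[x --> F] --> complex.Re l ->
  complex.Im (u x) @[x --> F] --> complex.Im l -> u x @[x --> F] --> l.
Proof.
move=> hr hi.
apply: (cvg_normc0_le (v := fun x => `|complex.Re (u x) - complex.Re l| + `|complex.Im (u x) - complex.Im l|)).
  apply: nearW => x; apply: le_trans (normc_le_ReIm _) _.
  by rewrite ReB ImB.
rewrite -[0]addr0; apply: cvgD.
  rewrite -[X in _ --> X](@normr0 _ R); apply: cvg_norm.
  by rewrite -[X in _ --> X](subrr (complex.Re l)); apply: cvgB => //; exact: cvg_cst.
rewrite -[X in _ --> X](@normr0 _ R); apply: cvg_norm.
by rewrite -[X in _ --> X](subrr (complex.Im l)); apply: cvgB => //; exact: cvg_cst.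
Qed.

Lemma cvg_normc (u : T -> C) (l : C) : u x @[x --> F] --> l ->
  normc (u x) @[x --> F] --> normc l.
Proof.
move=> /cvg_normcP h; apply/cvgrPdist_le => e e0.
move/cvgrPdist_le : h => /(_ _ e0); apply: filterS => x; apply: le_trans.
rewrite sub0r normrN (ger0_norm (normc_ge0 _)) ler_norml lerNl opprB le_distcB/=.
by rewrite distcC le_distcB.
Qed.

Lemma cvg_real_complex (u : T -> R) (l : R) : u x @[x --> F] --> l ->
  ((u x)%:C : C) @[x --> F] --> (l%:C : C).
Proof. by move=> h; apply: cvg_ReIm => //; exact: cvg_cst. Qed.

Lemma cvg_conj (u : T -> C) (l : C) : u x @[x --> F] --> l ->
  (u x)^* @[x --> F] --> l^*.
Proof.
move=> /cvg_normcP h; apply/cvg_normcP.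
by under eq_fun do rewrite -rmorphB normc_conj.
Qed.

End limits.
Lemma continuous_normc : continuous (@normc R : C -> R).
Proof. by move=> z; exact: (cvg_normc (F := nbhs z) (@cvg_id _ _)). Qed.

Lemma normc_nat n : normc (n%:R : C) = n%:R.
Proof. by rewrite -(rmorph_nat (real_complex R)) normc_real ger0_norm. Qed.

End complex_basics.

(** * Sequences of geometric decay *)

Section geometric_sequences.
Variable R : realType.
Local Notation C := R[i].
Implicit Types (z w : C) (a b c d : nat -> C).

(** Coefficients of functions analytic beyond the unit circle. The rate is existential, so the class
    is closed under sums, convolution, shifts and factors n + 1, and its members are absolutely
    summable. *)
Definition geo a := exists K s : R,
  [/\ 0 <= K, 0 <= s < 1 & forall n, normc (a n) <= K * s ^+ n].

Definition csum a : C := limn (series a).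

Definition conv a b n := \sum_(0 <= k < n.+1) a (n - k)%N * b k.

(** Bernoulli's inequality for t / s, multiplied out so that s = 0 is allowed; s <= 1 lets t - s
    stand for (t - s) / s. *)
Lemma linear_le_expr (s t : R) n : 0 <= s <= 1 -> s <= t ->
  (1 + n%:R * (t - s)) * s ^+ n <= t ^+ n.
Proof.
move=> /andP[s0 s1] st; elim: n => [|n IH]; first by rewrite !expr0 mul0r; lra.
rewrite !exprSr; apply: (@le_trans _ _ ((1 + n%:R * (t - s)) * s ^+ n * t)); last first.
  by apply: ler_wpM2r => //; lra.
rewrite -!mulrA [s ^+ n * t]mulrC [s ^+ n * s]mulrC !mulrA; apply: ler_wpM2r; first exact: exprn_ge0.
rewrite -natr1; have n0 : 0 <= n%:R :> R by [].
have : 0 <= n%:R * (t - s) * (t - s) by rewrite !mulr_ge0//; lra.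
have : 0 <= (1 - s) * (t - s) by rewrite mulr_ge0//; lra.
by nra.
Qed.

(** A linear factor is absorbed by moving the ratio halfway to 1; iterating handles higher
    powers. *)
Lemma poly_geo_bound (s : R) : 0 <= s < 1 -> exists K t : R,
  [/\ 0 <= K, 0 <= t < 1, s <= t & forall n, n.+1%:R * s ^+ n <= K * t ^+ n].
Proof.
move=> /andP[s0 s1]; pose t := (1 + s) / 2; exists (t - s)^-1, t.
have ts : 0 < t - s by rewrite /t; lra.
split; [by rewrite invr_ge0 ltW|by rewrite /t; lra|by rewrite /t; lra|].
move=> n; rewrite ler_pdivlMl//.
apply: le_trans (@linear_le_expr s t n _ _); [|by lra|by lra].
rewrite mulrA; apply: ler_wpM2r; first exact: exprn_ge0.
have : t - s <= 1 by rewrite /t; lra.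
by rewrite -natr1; set x := t - s; lra.
Qed.

Lemma cvg_geo_series (K s : R) : 0 <= s < 1 -> cvgn (series (fun n => K * s ^+ n)).
Proof. by move=> /andP[s0 s1]; apply: is_cvg_geometric_series; rewrite ger0_norm. Qed.

Lemma cvg_geo0 (K s : R) : 0 <= s < 1 -> K * s ^+ n @[n --> \oo] --> (0 : R).
Proof. by move=> /andP[s0 s1]; apply: cvg_geometric; rewrite ger0_norm. Qed.

Lemma geo_asum a : geo a -> cvgn (series (fun n => normc (a n))).
Proof.
move=> [K [s [K0 s1 h]]]; apply: (series_le_cvg _ _ h); first by move=> n; exact: normc_ge0.
  by move=> n; rewrite mulr_ge0// exprn_ge0//; case/andP: s1.
exact: cvg_geo_series.
Qed.

Lemma csum_cvg a : cvgn (series (fun n => normc (a n))) -> series a @ \oo --> csum a.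
Proof.
move=> h.
have hr : cvgn (series (fun n => complex.Re (a n))).
  apply: normed_cvg; apply: (series_le_cvg _ _ _ h) => n.
  - exact: normr_ge0.
  - exact: normc_ge0.
  - exact: abs_Re_le.
have hi : cvgn (series (fun n => complex.Im (a n))).
  apply: normed_cvg; apply: (series_le_cvg _ _ _ h) => n.
  - exact: normr_ge0.
  - exact: normc_ge0.
  - exact: abs_Im_le.
apply/cvg_ex; exists (limn (series (fun n => complex.Re (a n))) +i* limn (series (fun n => complex.Im (a n)))).
apply: cvg_ReIm => /=.
  under eq_fun do rewrite /series/= Re_sum; exact: hr.
under eq_fun do rewrite /series/= Im_sum; exact: hi.
Qed.

Lemma geo_cvg a : geo a -> series a @ \oo --> csum a.
Proof. by move=> h; apply/csum_cvg/geo_asum. Qed.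

Lemma csum_unique a l : series a @ \oo --> l -> csum a = l.
Proof. by move=> h; apply: cvg_lim. Qed.

Lemma csum_le a (b : nat -> R) : (forall n, normc (a n) <= b n) -> cvgn (series b) ->
  normc (csum a) <= limn (series b).
Proof.
move=> ab cb.
have b0 n : 0 <= b n by exact: le_trans (normc_ge0 _) (ab n).
have ca : cvgn (series (fun n => normc (a n))).
  by apply: (series_le_cvg _ _ ab) => // n; exact: normc_ge0.
have h : normc (series a n) @[n --> \oo] --> normc (csum a) by apply: cvg_normc; exact: csum_cvg.
rewrite -(cvg_lim _ h)//; apply: ler_lim => //; first by apply/cvg_ex; eexists; exact: h.
near=> n; rewrite /series/=; apply: le_trans (normc_sum _ _ _) _.
by apply: ler_sum => i _.
Unshelve. all: by end_near. Qed.

Lemma geo_le a b (K : R) : geo b -> (forall n, normc (a n) <= K * normc (b n)) -> geo a.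
Proof.
move=> [L [s [L0 s1 h]]] ab; exists (`|K| * L), s; split => //; first by rewrite mulr_ge0.
move=> n; rewrite -mulrA; apply: (le_trans (ab n)).
apply: (@le_trans _ _ (`|K| * normc (b n))); last exact: ler_wpM2l.
by apply: ler_wpM2r (normc_ge0 _) _ _ _; exact: ler_norm.
Qed.

Lemma geoZ (k : C) a : geo a -> geo (fun n => k * a n).
Proof. by move=> h; apply: (geo_le (K := normc k) h) => n; rewrite normcM. Qed.

Lemma geo_conj a : geo a -> geo (fun n => (a n)^*).
Proof. by move=> h; apply: (geo_le (K := 1) h) => n; rewrite normc_conj mul1r. Qed.

Lemma geo0 : geo (fun=> 0).
Proof. by exists 0, 0; split; rewrite ?ltr01 ?lexx// => n; rewrite normc0 mul0r. Qed.

Lemma geoD a b : geo a -> geo b -> geo (fun n => a n + b n).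
Proof.
move=> [K [s [K0 /andP[s0 s1] ha]]] [L [t [L0 /andP[t0 t1] hb]]].
exists (K + L), (Num.max s t); split; first exact: addr_ge0.
  by rewrite le_max s0/= gt_max s1.
move=> n; apply: le_trans (le_normcD _ _) _; rewrite mulrDl; apply: lerD.
  apply: (le_trans (ha n)); apply: ler_wpM2l => //; apply: lerXn2r; rewrite ?nnegrE// ?le_max ?s0 ?lexx//.
apply: (le_trans (hb n)); apply: ler_wpM2l => //; apply: lerXn2r; rewrite ?nnegrE// ?le_max ?t0 ?lexx ?orbT//.
Qed.

Lemma geo_nat a : geo a -> geo (fun n => n.+1%:R * a n).
Proof.
move=> [K [s [K0 s1 ha]]]; have [L [t [L0 t1 st h]]] := poly_geo_bound s1.
exists (K * L), t; split => //; first exact: mulr_ge0.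
move=> n; rewrite normcM normc_nat.
apply: (@le_trans _ _ (n.+1%:R * (K * s ^+ n))); first exact: ler_wpM2l.
by rewrite mulrCA -mulrA; apply: ler_wpM2l.
Qed.

Lemma geoS a : geo a -> geo (fun n => a n.+1).
Proof.
move=> [K [s [K0 /andP[s0 s1] ha]]]; exists (K * s), s; split; rewrite ?s0 ?mulr_ge0//.
by move=> n; rewrite -mulrA -exprS.
Qed.

Lemma geo_shift a : geo (fun n => a n.+1) -> geo a.
Proof.
(* The new ratio must be positive even when s = 0, since the shifted bound is divided by it. *)
move=> [K [s [K0 /andP[s0 s1] h]]]; pose t := Num.max s 2^-1.
have t0 : 0 < t by rewrite lt_max invr_gt0 ltr0n orbT.
have t1 : t < 1 by rewrite gt_max s1; lra.
exists (normc (a 0%N) + K / t), t; have Kt : 0 <= K / t by rewrite divr_ge0// ltW.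
split; rewrite ?(ltW t0) ?addr_ge0 ?normc_ge0// => -[|n].
  by rewrite expr0 mulr1 lerDl.
rewrite mulrDl ler_wpDl ?mulr_ge0 ?normc_ge0 ?exprn_ge0 ?(ltW t0)//.
apply: (le_trans (h n)); rewrite exprS mulrA divfK ?gt_eqF//; apply: ler_wpM2l => //.
by apply: lerXn2r; rewrite ?nnegrE ?(ltW t0)// le_max lexx.
Qed.

Lemma geo_cvg0 a : geo a -> a n @[n --> \oo] --> (0 : C).
Proof.
move=> [K [s [K0 s1 ha]]]; apply: (cvg_normc0_le _ (cvg_geo0 K s1)).
by apply: nearW => n; rewrite subr0.
Qed.

Lemma geoM a b : geo a -> geo b -> geo (fun n => a n * b n).
Proof.
move=> [K [s [K0 /andP[s0 s1] ha]]] hb; apply: (geo_le (K := K) hb) => n.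
rewrite normcM; apply: ler_wpM2r (normc_ge0 _) _ _ _; apply: (le_trans (ha n)).
by rewrite ler_piMr// exprn_ile1// ltW.
Qed.

Lemma csumD a b : geo a -> geo b -> csum (fun n => a n + b n) = csum a + csum b.
Proof.
move=> /geo_cvg ha /geo_cvg hb; apply: csum_unique.
have -> : series (fun n => a n + b n) = (fun n => series a n + series b n).
  by apply/funext => n; rewrite /series/= big_split.
exact: (cvgD ha hb).
Qed.

Lemma csumZ (k : C) a : geo a -> csum (fun n => k * a n) = k * csum a.
Proof.
move=> /geo_cvg ha; apply: csum_unique.
have -> : series (fun n => k * a n) = (fun n => k * series a n).
  by apply/funext => n; rewrite /series/= big_distrr.
exact: (cvgM (cvg_cst k) ha).
Qed.

Lemma csumB a b : geo a -> geo b -> csum (fun n => a n - b n) = csum a - csum b.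
Proof.
move=> ha hb; rewrite -[- csum b]mulN1r -csumZ// -csumD//; last exact: geoZ.
by congr csum; apply/funext => n; rewrite mulN1r.
Qed.

Lemma csumS a : geo a -> csum a = a 0%N + csum (fun n => a n.+1).
Proof.
move=> ha; apply: csum_unique; rewrite -cvg_shiftS.
have -> : (fun n => series a n.+1) = (fun n => a 0%N + series (fun k => a k.+1) n).
  by apply/funext => n; rewrite /series/= big_nat_recl.
exact: (cvgD (cvg_cst _) (geo_cvg (geoS ha))).
Qed.

Lemma sum_antidiagonal (V : zmodType) (F : nat -> nat -> V) N :
  \sum_(0 <= n < N) \sum_(0 <= k < n.+1) F (n - k)%N k =
  \sum_(0 <= k < N) \sum_(0 <= i < N - k) F i k.
Proof.
elim: N => [|N IH]; first by rewrite !big_nil.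
rewrite big_nat_recr//= IH [in LHS]big_nat_recr//= subnn [RHS]big_nat_recr//= subSnn big_nat1.
rewrite addrA; congr (_ + _); rewrite -big_split/=; apply: eq_big_nat => k /andP[_ kN].
by rewrite subSn ?(ltnW kN)// big_nat_recr.
Qed.

Lemma geo_common a b : geo a -> geo b -> exists K s : R, [/\ 0 <= K, 0 <= s < 1,
  forall n, normc (a n) <= K * s ^+ n & forall n, normc (b n) <= K * s ^+ n].
Proof.
move=> [K [s [K0 /andP[s0 s1] ha]]] [L [t [L0 /andP[t0 t1] hb]]].
exists (Num.max K L), (Num.max s t); split.
- by rewrite le_max K0.
- by rewrite le_max s0/= gt_max s1.
- move=> n; apply: (le_trans (ha n)); apply: ler_pM; rewrite ?exprn_ge0 ?le_max ?lexx//.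
  by apply: lerXn2r; rewrite ?nnegrE// ?le_max ?s0 ?lexx.
- move=> n; apply: (le_trans (hb n)); apply: ler_pM; rewrite ?exprn_ge0 ?le_max ?lexx ?orbT//.
  by apply: lerXn2r; rewrite ?nnegrE// ?le_max ?t0 ?lexx ?orbT.
Qed.

Lemma geo_conv a b : geo a -> geo b -> geo (conv a b).
Proof.
move=> ha hb; have [K [s [K0 s1 Ha Hb]]] := geo_common ha hb.
have [L [t [L0 t1 st h]]] := poly_geo_bound s1.
have s0 : 0 <= s by case/andP: s1.
exists (K * K * L), t; split; rewrite ?mulr_ge0// => n.
apply: le_trans (normc_sum _ _ _) _.
apply: (@le_trans _ _ (\sum_(0 <= k < n.+1) K * K * s ^+ n)).
  rewrite !big_nat; apply: ler_sum => k /andP[_ kn]; rewrite normcM.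
  rewrite -{2}(subnK (kn : (k <= n)%N)) exprD mulrACA.
  by apply: ler_pM; rewrite ?normc_ge0.
rewrite big_const_nat subn0 iter_addr_0 -mulr_natl mulrCA -[_ * L * _]mulrA.
by apply: ler_wpM2l (h n); rewrite mulr_ge0.
Qed.

(** The defect is the sum over the corner n <= i + k with i, k < n: at most n^2 terms, each at most
    K^2 s^n. Hence [poly_geo_bound] is used twice. *)
Lemma series_conv a b : geo a -> geo b ->
  series a n * series b n - series (conv a b) n @[n --> \oo] --> (0 : C).
Proof.
move=> ha hb; have [K [s [K0 s1 Ha Hb]]] := geo_common ha hb.
have [L [t [L0 t1 st h]]] := poly_geo_bound s1.
have [M [u [M0 u1 tu h']]] := poly_geo_bound t1.
have s0 : 0 <= s by case/andP: s1.
apply: (cvg_normc0_le _ (cvg_geo0 (K * K * (L * M)) u1)); apply: nearW => n.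
have -> : series a n * series b n - series (conv a b) n - 0 =
    \sum_(0 <= k < n) \sum_(n - k <= i < n) a i * b k.
  rewrite subr0 /series/= /conv (sum_antidiagonal (fun i k => a i * b k)) big_distrr/= -sumrB.
  apply: eq_big_nat => k /andP[_ kn]; rewrite big_distrl/=.
  by rewrite [X in X - _ = _](big_cat_nat (n := (n - k)%N))//= ?leq_subr// addrAC subrr add0r.
apply: (@le_trans _ _ (\sum_(0 <= k < n) \sum_(0 <= i < n) K * K * s ^+ n)).
  apply: le_trans (normc_sum _ _ _) _; apply: ler_sum => k _.
  apply: le_trans (normc_sum _ _ _) _.
  apply: (@le_trans _ _ (\sum_(n - k <= i < n) K * K * s ^+ n)).
    rewrite !big_nat; apply: ler_sum => i /andP[ki _]; rewrite normcM.
    apply: (@le_trans _ _ (K * s ^+ i * (K * s ^+ k))).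
      by apply: ler_pM; rewrite ?normc_ge0.
    rewrite mulrACA -exprD; apply: ler_wpM2l; first exact: mulr_ge0.
    by apply: ler_wiXn2l => //; [case/andP: s1 => _ /ltW|rewrite addnC -leq_subLR].
  rewrite [leRHS](big_cat_nat (n := (n - k)%N))//= ?leq_subr//= lerDr; apply: sumr_ge0 => i _.
  by rewrite !mulr_ge0// exprn_ge0.
rewrite !sumr_const_nat !subn0 -mulrnA -mulr_natl natrM.
rewrite [leLHS](_ : _ = K * K * (n%:R * (n%:R * s ^+ n))); last by ring.
rewrite -!(mulrA (K * K)); apply: ler_wpM2l; first exact: mulr_ge0.
have nS : n%:R <= n.+1%:R :> R by rewrite ler_nat.
apply: (@le_trans _ _ (n.+1%:R * (n.+1%:R * s ^+ n))).
  by apply: ler_pM => //; rewrite ?mulr_ge0 ?exprn_ge0//; apply: ler_wpM2r => //; exact: exprn_ge0.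
apply: (@le_trans _ _ (n.+1%:R * (L * t ^+ n))); first exact: ler_wpM2l.
by rewrite mulrCA -mulrA; apply: ler_wpM2l.
Qed.

Lemma csum_conv a b : geo a -> geo b -> csum (conv a b) = csum a * csum b.
Proof.
move=> ha hb; apply: csum_unique.
have -> : series (conv a b) = (fun n => series a n * series b n -
  (series a n * series b n - series (conv a b) n)).
  by apply/funext => n; rewrite opprB addrC subrK.
rewrite -[csum a * csum b]subr0.
exact: (cvgB (cvgM (geo_cvg ha) (geo_cvg hb)) (series_conv ha hb)).
Qed.

End geometric_sequences.

(** * Power series on the unit disc *)

Section power_series_on_disc.
Variable R : realType.
Local Notation C := R[i].
Implicit Types (z w : C) (a b c d : nat -> C).

(** Radius of convergence at least 1, stated as geometric decay on every smaller circle so that the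
    calculus of [geo] applies. *)
Definition conv_disc c := forall r : R, 0 <= r < 1 -> geo (fun n => c n * r%:C ^+ n).

Definition pser c z : C := csum (fun n => c n * z ^+ n).

Definition deriv c n : C := n.+1%:R * c n.+1.

Lemma normc_disc z : disc z -> 0 <= normc z < 1.
Proof. by move=> /disc_normc; rewrite normc_ge0. Qed.

Lemma conv_disc_geo c z : conv_disc c -> disc z -> geo (fun n => c n * z ^+ n).
Proof.
move=> h /normc_disc /h hz; apply: (geo_le (K := 1) hz) => n.
by rewrite mul1r !normcM !normcX normc_real ger0_norm ?normc_ge0.
Qed.

Lemma pser_cvg c : conv_disc c -> has_power_series (pser c) c.
Proof. by move=> h z zD; exact: geo_cvg (conv_disc_geo h zD). Qed.

Lemma has_power_series_pser f c z : has_power_series f c -> disc z -> f z = pser c z.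
Proof. by move=> h zD; rewrite /pser (csum_unique (h z zD)). Qed.

Lemma bounded_conv_disc c (M : R) : (forall n, normc (c n) <= M) -> conv_disc c.
Proof.
move=> h r /andP[r0 r1]; exists M, r; split; rewrite ?r0 ?r1//.
  exact: le_trans (normc_ge0 _) (h 0%N).
move=> n; rewrite normcM normcX normc_real ger0_norm//.
by apply: ler_wpM2r => //; rewrite exprn_ge0.
Qed.

Lemma geo_conv_disc c : geo c -> conv_disc c.
Proof.
move=> [K [s [K0 /andP[s0 s1] h]]]; apply: (bounded_conv_disc (M := K)) => n.
by apply: (le_trans (h n)); rewrite ler_piMr// exprn_ile1// ltW.
Qed.

Lemma square_summable_conv_disc c : square_summable c -> conv_disc c.
Proof.
move=> sc; pose L := limn (series (fun n => normc (c n) ^+ 2)).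
apply: (bounded_conv_disc (M := 1 + L)) => n.
by have := square_summable_le n sc; rewrite -/L => ?; nra.
Qed.

Lemma conv_disc_conv c d : conv_disc c -> conv_disc d -> conv_disc (conv c d).
Proof.
move=> hc hd r r01; apply: (geo_le (K := 1) (geo_conv (hc r r01) (hd r r01))) => n.
rewrite mul1r le_eqVlt; apply/orP; left; apply/eqP; congr normc.
rewrite /conv big_distrl/= !big_nat; apply: eq_bigr => k /andP[_ kn].
rewrite -[in LHS](subnK (kn : (k <= n)%N)) exprD addnK; ring.
Qed.

Lemma pser_conv c d z : conv_disc c -> conv_disc d -> disc z ->
  pser (conv c d) z = pser c z * pser d z.
Proof.
move=> hc hd zD; rewrite /pser -csum_conv; [|exact: conv_disc_geo..].
congr csum; apply/funext => n.
rewrite /conv big_distrl/= !big_nat; apply: eq_bigr => k /andP[_ kn].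
rewrite -[in LHS](subnK (kn : (k <= n)%N)) exprD addnK; ring.
Qed.

Lemma conv_disc_deriv c : conv_disc c -> conv_disc (deriv c).
Proof.
(* A positive radius not below r: comparing c_(n+1) r^n with c_(n+1) s^(n+1) divides by s. *)
move=> hc r /andP[r0 r1]; pose s := Num.max r 2^-1.
have s0 : 0 < s by rewrite lt_max invr_gt0 ltr0n orbT.
have s1 : s < 1 by rewrite gt_max r1; lra.
have /geo_nat/geoS h : geo (fun n => c n * s%:C ^+ n) by apply: hc; rewrite ltW.
apply: (geo_le (K := s^-1) h) => n; rewrite /deriv !normcM !normcX !normc_real.
rewrite (ger0_norm r0) (gtr0_norm s0) !normc_nat.
rewrite [leRHS](_ : _ = n.+2%:R * (normc (c n.+1) * s ^+ n)); last first.
  by rewrite exprS; field; rewrite gt_eqF.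
rewrite -mulrA; apply: ler_pM; rewrite ?ler0n ?mulr_ge0 ?normc_ge0 ?exprn_ge0 ?ler_nat//.
apply: ler_wpM2l; first exact: normc_ge0.
by apply: lerXn2r; rewrite ?nnegrE ?(ltW s0)// le_max lexx.
Qed.

Lemma conv_discZ (k : C) c : conv_disc c -> conv_disc (fun n => k * c n).
Proof.
move=> hc r r01; have := geoZ k (hc r r01).
by congr geo; apply/funext => n; rewrite mulrA.
Qed.

Lemma pserD c d z : conv_disc c -> conv_disc d -> disc z ->
  pser (fun n => c n + d n) z = pser c z + pser d z.
Proof.
move=> hc hd zD; rewrite /pser -csumD; [|exact: conv_disc_geo..].
by congr csum; apply/funext => n; rewrite mulrDl.
Qed.

Lemma pserZ (k : C) c z : conv_disc c -> disc z ->
  pser (fun n => k * c n) z = k * pser c z.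
Proof.
move=> hc zD; rewrite /pser -csumZ; last exact: conv_disc_geo.
by congr csum; apply/funext => n; rewrite mulrA.
Qed.

Lemma pser0 c : pser c 0 = c 0%N.
Proof.
apply: csum_unique; rewrite -cvg_shiftS.
apply: (cvg_normc0_le (v := fun=> 0)); last exact: cvg_cst.
apply: nearW => n; rewrite /series/= big_nat_recl//= expr0 mulr1 big1 ?addr0 ?subrr ?normc0//.
by move=> i _; rewrite expr0n mulr0.
Qed.

Lemma expr_diff_le z w (r : R) n : 0 < r -> normc z <= r -> normc w <= r ->
  normc (z ^+ n - w ^+ n) <= n%:R * r ^+ n * (normc (z - w) / r).
Proof.
move=> r0 zr wr; elim: n => [|n IH]; first by rewrite !expr0 subrr normc0 !mul0r.
have -> : z ^+ n.+1 - w ^+ n.+1 = z * (z ^+ n - w ^+ n) + w ^+ n * (z - w).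
  by rewrite !exprS; ring.
apply: le_trans (le_normcD _ _) _; rewrite !normcM normcX.
apply: (@le_trans _ _ (r * (n%:R * r ^+ n * (normc (z - w) / r)) + r ^+ n * normc (z - w))).
  apply: lerD; first by apply: ler_pM; rewrite ?normc_ge0.
  apply: ler_wpM2r; first exact: normc_ge0.
  by apply: lerXn2r; rewrite ?nnegrE ?normc_ge0// ltW.
rewrite -natr1 exprS le_eqVlt; apply/orP; left; apply/eqP; field; by rewrite gt_eqF.
Qed.

Lemma expr_diff2_le z w (r : R) n : 0 < r -> normc z <= r -> normc w <= r ->
  normc (z ^+ n - w ^+ n - n%:R * w ^+ n.-1 * (z - w)) <=
  n%:R ^+ 2 * r ^+ n * (normc (z - w) / r) ^+ 2.
Proof.
move=> r0 zr wr; elim: n => [|n IH].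
  by rewrite !expr0 subrr sub0r !mul0r oppr0 normc0 expr0n !mul0r.
have -> : z ^+ n.+1 - w ^+ n.+1 - n.+1%:R * w ^+ n * (z - w) =
    z * (z ^+ n - w ^+ n - n%:R * w ^+ n.-1 * (z - w)) + n%:R * w ^+ n.-1 * (z - w) ^+ 2.
  case: n {IH} => [|n]; first by rewrite /= !expr1 !expr0; ring.
  by rewrite /= -!natr1 !exprS; ring.
apply: le_trans (le_normcD _ _) _.
set d := normc (z - w); have d0 : 0 <= d by exact: normc_ge0.
apply: (@le_trans _ _ (r * (n%:R ^+ 2 * r ^+ n * (d / r) ^+ 2) + n%:R * r ^+ n.-1 * d ^+ 2)).
  apply: lerD; first by rewrite normcM; apply: ler_pM; rewrite ?normc_ge0.
  rewrite !normcM !normcX normc_nat.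
  apply: ler_wpM2r; first exact: sqr_ge0.
  by apply: ler_wpM2l => //; apply: lerXn2r; rewrite ?nnegrE ?normc_ge0// ltW.
have -> : n%:R * r ^+ n.-1 * d ^+ 2 = n%:R * r ^+ n.+1 * (d / r) ^+ 2.
  case: n {IH} => [|n]; first by rewrite !mul0r.
  by rewrite /= !exprS; field; rewrite gt_eqF.
have -> : r * (n%:R ^+ 2 * r ^+ n * (d / r) ^+ 2) + n%:R * r ^+ n.+1 * (d / r) ^+ 2 =
    (n%:R ^+ 2 + n%:R) * (r ^+ n.+1 * (d / r) ^+ 2) by rewrite [r ^+ n.+1]exprS; ring.
rewrite -[leRHS]mulrA; apply: ler_wpM2r.
  by rewrite mulr_ge0 ?sqr_ge0 ?exprn_ge0// ltW.
by rewrite -natr1; have : 0 <= n%:R :> R by []; nra.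
Qed.

Lemma mul_pser_deriv c z w : conv_disc c -> disc w ->
  (z - w) * pser (deriv c) w = csum (fun n => c n * (n%:R * w ^+ n.-1 * (z - w))).
Proof.
move=> hc wD; have h := conv_disc_geo (conv_disc_deriv hc) wD.
rewrite /pser -csumZ//; apply/esym/csum_unique; rewrite -cvg_shiftS.
have -> : (fun n => series (fun n => c n * (n%:R * w ^+ n.-1 * (z - w))) n.+1) =
    series (fun n => (z - w) * (deriv c n * w ^+ n)).
  apply/funext => n; rewrite /series/= big_nat_recl//= !mul0r mulr0 add0r.
  by apply: eq_bigr => i _; rewrite /deriv; ring.
exact/geo_cvg/geoZ.
Qed.

(** These remainder estimates, uniform on a smaller disc, give the Lipschitz bound of the vector
    field, the complex derivative and the chain rule along real paths. *)
Lemma pser_diff c (r : R) : conv_disc c -> 0 < r < 1 -> exists2 L : R, 0 <= L &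
  forall z w, normc z <= r -> normc w <= r ->
    normc (pser c z - pser c w) <= L * normc (z - w) /\
    normc (pser c z - pser c w - (z - w) * pser (deriv c) w) <= L * normc (z - w) ^+ 2.
Proof.
move=> hc /andP[r0 r1].
have inD z : normc z <= r -> disc z by move=> h; apply/disc_normc; exact: le_lt_trans h _.
have g : geo (fun n => c n * r%:C ^+ n) by apply: hc; rewrite ltW.
(* The weight (n + 1)^2 dominates both the factor n of the first-order estimate and the n^2 of the
   second-order one. *)
pose b n : R := n.+1%:R ^+ 2 * (normc (c n) * r ^+ n).
have cb : cvgn (series b).
  suff <- : (fun n => normc (n.+1%:R * (n.+1%:R * (c n * r%:C ^+ n)))) = b.
    exact: geo_asum (geo_nat (geo_nat g)).
  apply/funext => n.
  rewrite !normcM normcX normc_real (gtr0_norm r0) /b.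
  by rewrite normc_nat; ring.
have b0 n : 0 <= b n by rewrite mulr_ge0 ?sqr_ge0// mulr_ge0 ?normc_ge0// exprn_ge0// ltW.
have S0 : 0 <= limn (series b).
  by have := nondecreasing_cvgn_le ((nondecreasing_series (fun n _ _ => b0 n))) cb 0%N; rewrite /series/= big_nil.
(* The summand 1/r serves the first estimate, 1/r^2 the second. *)
exists (limn (series b) * (r^-1 + r^-1 ^+ 2)).
  by rewrite mulr_ge0// addr_ge0 ?sqr_ge0// invr_ge0 ltW.
have key (K : R) z w : 0 <= K -> K * limn (series b) = limn (series (fun n => K * b n)) /\ cvgn (series (fun n => K * b n)).
  move=> K0; rewrite (_ : (fun n => K * b n) = K *: (b : R^nat))//.
  by split; [rewrite lim_seriesZ|exact: is_cvg_seriesZ].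
move=> z w zr wr; set d := normc (z - w); have d0 : 0 <= d by exact: normc_ge0.
have gz := conv_disc_geo hc (inD z zr); have gw := conv_disc_geo hc (inD w wr).
have rV : 0 < r^-1 by rewrite invr_gt0.
split.
  have [e cv] := key (d / r) z w (mulr_ge0 d0 (ltW rV)).
  apply: (@le_trans _ _ (d / r * limn (series b))); last first.
    rewrite mulrC -!mulrA; apply: ler_wpM2l => //; rewrite [leRHS]mulrC; apply: ler_wpM2l => //.
    by rewrite lerDl sqr_ge0.
  rewrite e /pser -csumB//; apply: csum_le cv => n.
  rewrite -mulrBr normcM; apply: (@le_trans _ _ (normc (c n) * (n%:R * r ^+ n * (d / r)))).
    by apply: ler_wpM2l; rewrite ?normc_ge0//; exact: expr_diff_le.
  rewrite [leLHS](_ : _ = d / r * (n%:R * (normc (c n) * r ^+ n))); last by ring.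
  apply: ler_wpM2l; first by rewrite mulr_ge0// ltW.
  apply: ler_wpM2r; first by rewrite mulr_ge0 ?normc_ge0// exprn_ge0// ltW.
  by rewrite -natr1; have : 0 <= n%:R :> R by []; nra.
have [e cv] := key ((d / r) ^+ 2) z w (sqr_ge0 _).
apply: (@le_trans _ _ ((d / r) ^+ 2 * limn (series b))); last first.
  rewrite mulrC -!mulrA; apply: ler_wpM2l => //; rewrite [leRHS]mulrC exprMn; apply: ler_wpM2l => //.
    exact: sqr_ge0.
  by rewrite lerDr ltW.
rewrite e mul_pser_deriv//; last exact: inD.
have g3 : geo (fun n => c n * (n%:R * w ^+ n.-1 * (z - w))).
  apply: geo_shift; have := geoZ (z - w) (conv_disc_geo (conv_disc_deriv hc) (inD w wr)).
  by congr geo; apply/funext => n; rewrite /deriv/=; ring.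
rewrite /pser -csumB// -csumB//; last first.
  by have := geoD gz (geoZ (-1) gw); congr geo; apply/funext => n; rewrite mulN1r.
apply: csum_le cv => n.
rewrite -!mulrBr normcM; apply: (@le_trans _ _ (normc (c n) * (n%:R ^+ 2 * r ^+ n * (d / r) ^+ 2))).
  by apply: ler_wpM2l; rewrite ?normc_ge0//; exact: expr_diff2_le.
rewrite [leLHS](_ : _ = (d / r) ^+ 2 * (n%:R ^+ 2 * (normc (c n) * r ^+ n))); last by ring.
apply: ler_wpM2l; first exact: sqr_ge0.
apply: ler_wpM2r; first by rewrite mulr_ge0 ?normc_ge0// exprn_ge0// ltW.
by rewrite -natr1; have : 0 <= n%:R :> R by []; nra.
Qed.

Lemma derive_of_quadratic (f : C -> C) z l (L : R) : disc z ->
  (\forall w \near z, normc (f w - f z - (w - z) * l) <= L * normc (w - z) ^+ 2) ->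
  is_derive z 1 f l.
Proof.
move=> zD h.
have hc : h^-1 *: (f (h *: 1 + z) - f z) @[h --> (0 : C)^'] --> l.
  apply: (cvg_normc0_le (F := (0 : C)^') (v := fun h : C => L * normc h)).
    have h0 : \forall x \near (0 : C), normc (f (x + z) - f z - x * l) <= L * normc x ^+ 2.
      have : (fun x : C => x + z) @ (0 : C) --> 0 + z by exact: (cvgD (@cvg_id _ _) (cvg_cst z)).
      by rewrite add0r => /(_ _ h) hh; apply: (@filterS _ (nbhs (0 : C)) _ _ _ _ hh) => x; rewrite /= addrK.
    near=> x.
    have x0 : x != 0 by near: x; exact: nbhs_dnbhs_neq.
    have : normc (f (x + z) - f z - x * l) <= L * normc x ^+ 2.
      by near: x; exact: nbhs_dnbhs.
    rewrite [_ *: 1]mulr1 => hx.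
    have nx : 0 < normc x.
      by rewrite lt_neqAle normc_ge0 andbT eq_sym; apply/eqP => /eq0_normc/eqP; apply/negP.
    rewrite [_ *: _](_ : _ = x^-1 * (f (x + z) - f z))//.
    have -> : x^-1 * (f (x + z) - f z) - l = x^-1 * (f (x + z) - f z - x * l).
      by rewrite [RHS]mulrBr mulKf.
    by rewrite normcM normcV ler_pdivrMl// mulrCA -expr2.
  rewrite -[X in _ --> X](mulr0 L) -(normc0 R); apply: cvgM; first exact: cvg_cst.
  apply: cvg_within_filter; exact: continuous_normc.
apply: DeriveDef; first by apply/cvg_ex; exists l.
exact: cvg_lim hc.
Unshelve. all: by end_near. Qed.

Lemma near_disc z : disc z -> exists2 r : R, 0 < r < 1 & normc z < r /\
  \forall w \near z, normc w <= r.
Proof.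
move=> /disc_normc z1; pose r := (1 + normc z) / 2; have z0 := normc_ge0 z.
exists r; first by rewrite /r; lra.
split; first by rewrite /r; lra.
have e0 : (0 : R) < r - normc z by rewrite /r; lra.
have /cvgrPdist_lt/(_ _ e0) : normc w @[w --> z] --> normc z by exact: continuous_normc.
by apply: filterS => w /ltW; rewrite ler_norml => /andP[]; lra.
Qed.

Lemma is_derive_power_series (f : C -> C) c z : conv_disc c -> has_power_series f c ->
  disc z -> is_derive z 1 f (pser (deriv c) z).
Proof.
move=> hc hf zD; have [r r01 [zr nr]] := near_disc zD.
have [L L0 hL] := pser_diff hc r01.
apply: (derive_of_quadratic (L := L)) => //; apply: filterS nr => w wr.
have wD : disc w by apply/disc_normc; apply: le_lt_trans wr _; case/andP: r01.
rewrite !(has_power_series_pser hf)//.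
by have [_] := hL w z wr (ltW zr).
Qed.

Lemma derive1_power_series (f : C -> C) c z : conv_disc c -> has_power_series f c ->
  disc z -> derive1 f z = pser (deriv c) z.
Proof. by move=> hc hf zD; rewrite derive1E; have [] := is_derive_power_series hc hf zD. Qed.

Lemma continuous_pser c z : conv_disc c -> disc z -> {for z, continuous (pser c)}.
Proof.
move=> hc zD; have [r r01 [zr nr]] := near_disc zD.
have [L L0 hL] := pser_diff hc r01.
apply: (cvg_normc0_le (F := nbhs z) (v := fun w => L * normc (w - z))).
  by apply: filterS nr => w wr; have [] := hL w z wr (ltW zr).
rewrite -[X in _ --> X](mulr0 L) -(normc0 R) -(subrr z); apply: cvgM; first exact: cvg_cst.
exact: (cvg_normc (F := nbhs z) (cvgB (@cvg_id _ _) (cvg_cst z))).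
Qed.

End power_series_on_disc.

(** * The space of square-summable sequences *)

Section complex_cauchy.
Variable R : realType.
Local Notation C := R[i].

Lemma real_cauchy_cvg {T : Type} {F : set_system T} {FF : ProperFilter F} (u : T -> R) :
  (forall e : R, 0 < e -> exists x : R, \forall t \near F, `|u t - x| < e) -> cvg (u @ F).
Proof.
move=> h; apply: cauchy_cvg; apply: cauchy_exP => e e0.
have [x hx] := h e e0; exists x; apply: filterS hx => t.
by rewrite /= -ball_normE /ball_/= distrC.
Qed.

Lemma complex_cauchy_cvg {T : Type} {F : set_system T} {FF : ProperFilter F} (u : T -> C) :
  (forall e : R, 0 < e -> exists x : C, \forall t \near F, normc (u t - x) < e) ->
  exists l : C, u @ F --> l.
Proof.
move=> h.
have /cvg_ex[/= a ha] : cvg ((fun t => complex.Re (u t)) @ F).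
  apply: real_cauchy_cvg => e e0; have [x hx] := h e e0; exists (complex.Re x).
  by apply: filterS hx => t; apply: le_lt_trans; rewrite -ReB abs_Re_le.
have /cvg_ex[/= b hb] : cvg ((fun t => complex.Im (u t)) @ F).
  apply: real_cauchy_cvg => e e0; have [x hx] := h e e0; exists (complex.Im x).
  by apply: filterS hx => t; apply: le_lt_trans; rewrite -ImB abs_Im_le.
by exists (a +i* b); apply: cvg_ReIm.
Qed.

End complex_cauchy.

Section l2.
Variable R : realType.
Local Notation C := R[i].
Implicit Types (z w : C) (c d e : nat -> C).
Local Notation ss := square_summable.

(** Real part of the inner product: a symmetric real bilinear form, enough for norms and
    dissipativity. Complex values are recovered by rotating one argument. *)
Definition dot c d : R := limn (series (fun n => complex.Re (c n * (d n)^*))).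

Lemma ss_partial_le c (M : R) : (forall N, \sum_(0 <= n < N) normc (c n) ^+ 2 <= M ^+ 2) ->
  0 <= M -> ss c /\ l2norm c <= M.
Proof.
move=> h M0.
have nd : nondecreasing_seq (series (fun n => normc (c n) ^+ 2)).
  by apply/nondecreasing_series => n _ _; exact: sqr_ge0.
have cc : ss c.
  by apply: nondecreasing_is_cvgn => //; exists (M ^+ 2) => _ [N _ <-]; exact: h.
split => //; rewrite -(@ler_pXn2r _ 2)// ?nnegrE ?l2norm_ge0//.
by rewrite l2norm_sqr//; apply: limr_le => //; apply: nearW => N; exact: h.
Qed.

Lemma ss_partial c N : ss c -> \sum_(0 <= n < N) normc (c n) ^+ 2 <= l2norm c ^+ 2.
Proof.
move=> sc; rewrite l2norm_sqr//; apply: (nondecreasing_cvgn_le _ sc).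
by apply/nondecreasing_series => n _ _; exact: sqr_ge0.
Qed.

Lemma ss_coef_le c n : ss c -> normc (c n) <= l2norm c.
Proof.
move=> sc; rewrite -(@ler_pXn2r _ 2)// ?nnegrE ?l2norm_ge0 ?normc_ge0//.
by apply: le_trans (square_summable_le n sc) _; rewrite l2norm_sqr.
Qed.

Lemma geo_ss c : geo c -> ss c.
Proof.
move=> h; have g := geo_asum (geoM h (geo_conj h)).
rewrite /square_summable; have <- : (fun n => normc (c n * (c n)^*)) = (fun n => normc (c n) ^+ 2); last exact: g.
by apply/funext => n; rewrite normcM normc_conj expr2.
Qed.

Lemma dot_abs_cvg c d : ss c -> ss d -> cvgn (series (fun n => `|complex.Re (c n * (d n)^*)|)).
Proof.
move=> sc sd; have scd := is_cvg_seriesD sc sd.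
apply: (series_le_cvg _ _ _ scd) => n; first exact: normr_ge0.
  by apply: addr_ge0; exact: sqr_ge0.
apply: le_trans (abs_Re_le _) _; rewrite normcM normc_conj.
rewrite [leRHS]/(normc (c n) ^+ 2 + normc (d n) ^+ 2).
rewrite [leRHS](_ : _ = normc (c n) * normc (c n) + normc (d n) * normc (d n))//.
by have := normc_ge0 (c n); have := normc_ge0 (d n); nra.
Qed.

Lemma dot_cvg c d : ss c -> ss d ->
  series (fun n => complex.Re (c n * (d n)^*)) @ \oo --> dot c d.
Proof. by move=> sc sd; apply: normed_cvg; exact: dot_abs_cvg. Qed.

Lemma dot_unique c d (l : R) : series (fun n => complex.Re (c n * (d n)^*)) @ \oo --> l -> dot c d = l.
Proof. by move=> h; apply: cvg_lim. Qed.

Lemma dotC c d : dot c d = dot d c.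
Proof. by congr (limn (series _)); apply/funext => n; rewrite ReMconjC. Qed.

Lemma dotDl c d e : ss c -> ss d -> ss e -> dot (fun n => c n + d n) e = dot c e + dot d e.
Proof.
move=> sc sd se; apply: dot_unique.
have -> : series (fun n => complex.Re ((c n + d n) * (e n)^*)) =
    (fun N => series (fun n => complex.Re (c n * (e n)^*)) N + series (fun n => complex.Re (d n * (e n)^*)) N).
  by apply/funext => N; rewrite /series/= -big_split; apply: eq_bigr => n _; rewrite mulrDl ReD.
exact: (cvgD (dot_cvg sc se) (dot_cvg sd se)).
Qed.

Lemma dotZl (t : R) c d : ss c -> ss d -> dot (fun n => t%:C * c n) d = t * dot c d.
Proof.
move=> sc sd; apply: dot_unique.
have -> : series (fun n => complex.Re (t%:C * c n * (d n)^*)) =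
    (fun N => t * series (fun n => complex.Re (c n * (d n)^*)) N).
  by apply/funext => N; rewrite /series/= big_distrr/=; apply: eq_bigr => n _; rewrite -mulrA ReM_real.
exact: (cvgM (cvg_cst t) (dot_cvg sc sd)).
Qed.

Lemma dotDr c d e : ss c -> ss d -> ss e -> dot e (fun n => c n + d n) = dot e c + dot e d.
Proof. by move=> sc sd se; rewrite dotC dotDl// !(dotC e). Qed.

Lemma dotZr (t : R) c d : ss c -> ss d -> dot c (fun n => t%:C * d n) = t * dot c d.
Proof. by move=> sc sd; rewrite dotC dotZl// dotC. Qed.

Lemma dot_sqr c : ss c -> dot c c = l2norm c ^+ 2.
Proof.
move=> sc; rewrite l2norm_sqr//; congr (limn (series _)); apply/funext => n.
by rewrite sqr_normc_Re.
Qed.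

Lemma l2norm_line (t : R) c d : ss c -> ss d ->
  l2norm (fun n => c n + t%:C * d n) ^+ 2 =
  l2norm c ^+ 2 + 2 * t * dot c d + t ^+ 2 * l2norm d ^+ 2.
Proof.
move=> sc sd; have std := square_summableZ (a := t%:C) sd.
have s := square_summableD sc std.
rewrite -!dot_sqr// dotDl// !dotDr// !dotZl// dotZr// dotZr// (dotC d c); ring.
Qed.

Lemma dot_le c d : ss c -> ss d -> dot c d <= l2norm c * l2norm d.
Proof.
move=> sc sd.
have [c0|cn0] := eqVneq (l2norm c) 0.
  rewrite c0 mul0r (l2norm_eq0 sc c0) (_ : dot _ _ = 0)//; apply: dot_unique.
  rewrite (_ : series _ = cst 0); first exact: cvg_cst.
  by apply/funext => N; rewrite /series/= big1// => n _; rewrite mul0r.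
have [d0|dn0] := eqVneq (l2norm d) 0.
  rewrite d0 mulr0 (l2norm_eq0 sd d0) (_ : dot _ _ = 0)//; apply: dot_unique.
  rewrite (_ : series _ = cst 0); first exact: cvg_cst.
  by apply/funext => N; rewrite /series/= big1// => n _; rewrite conj0 mulr0.
have x0 : 0 < l2norm c by rewrite lt_def cn0 l2norm_ge0.
have y0 : 0 < l2norm d by rewrite lt_def dn0 l2norm_ge0.
(* With x = |c| and y = |d|, the squared norm at parameter - x / y is 2 (x / y) (x y - dot c d). *)
have := sqr_ge0 (l2norm (fun n => c n + (- (l2norm c / l2norm d))%:C * d n)).
rewrite l2norm_line//; set x := l2norm c in x0 cn0 *; set y := l2norm d in y0 dn0 *.
rewrite (_ : x ^+ 2 + _ + _ = 2 * x / y * (x * y - dot c d)); last by field.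
by rewrite pmulr_rge0 ?subr_ge0// !mulr_gt0// invr_gt0.
Qed.

Lemma dotNl c d : ss c -> ss d -> dot (fun n => - c n) d = - dot c d.
Proof.
move=> sc sd; have <- : dot (fun n => (-1)%:C * c n) d = dot (fun n => - c n) d.
  by congr (dot _ d); apply/funext => n; rewrite (_ : (-1)%:C = -1) ?mulN1r// rmorphN rmorph1.
by rewrite (dotZl (-1) sc sd) mulN1r.
Qed.

Lemma dotBl c d e : ss c -> ss d -> ss e -> dot (fun n => c n - d n) e = dot c e - dot d e.
Proof.
move=> sc sd se; rewrite -dotNl// -dotDl//.
have := square_summableZ (a := -1) sd; congr ss; apply/funext => n; by rewrite mulN1r.
Qed.

Lemma ssB c d : ss c -> ss d -> ss (fun n => c n - d n).
Proof.
move=> sc sd; have := square_summableD sc (square_summableZ (a := -1) sd).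
by congr ss; apply/funext => n; rewrite mulN1r.
Qed.

Lemma l2normN c : l2norm (fun n => - c n) = l2norm c.
Proof.
by rewrite /l2norm; congr (Num.sqrt (limn (series _))); apply/funext => n; rewrite normcN.
Qed.

Lemma l2normBC c d : l2norm (fun n => c n - d n) = l2norm (fun n => d n - c n).
Proof. by rewrite -l2normN; congr l2norm; apply/funext => n; rewrite opprB. Qed.

Lemma l2normB c d : ss c -> ss d -> l2norm c - l2norm d <= l2norm (fun n => c n - d n).
Proof.
move=> sc sd; rewrite lerBlDr; have := l2normD (ssB sc sd) sd.
by congr (l2norm _ <= _); apply/funext => n; rewrite subrK.
Qed.

Lemma dot_abs_le c d : ss c -> ss d -> `|dot c d| <= l2norm c * l2norm d.
Proof.
move=> sc sd; rewrite ler_norml dot_le// andbT lerNl -dotNl//.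
have sNc : ss (fun n => - c n) by have := square_summableZ (a := -1) sc; congr ss; apply/funext => n; rewrite mulN1r.
by apply: le_trans (dot_le sNc sd) _; rewrite l2normN.
Qed.

Lemma l2_complete (x : nat -> nat -> C) : (forall j, ss (x j)) ->
  (forall e : R, 0 < e -> exists N, forall i j, (N <= i)%N -> (N <= j)%N ->
     l2norm (fun n => x i n - x j n) <= e) ->
  exists2 c, ss c & l2norm (fun n => x j n - c n) @[j --> \oo] --> (0 : R).
Proof.
move=> sx h.
have hc n : exists l : C, x j n @[j --> \oo] --> l.
  apply: complex_cauchy_cvg => e e0.
  have e2 : 0 < e / 2 by rewrite divr_gt0.
  have [N hN] := h _ e2; exists (x N n); near=> j.
  have := ss_coef_le n (ssB (sx j) (sx N)) => /=.
  have : l2norm (fun n => x j n - x N n) <= e / 2 by apply: hN => //; near: j; exact: nbhs_infty_ge.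
  by lra.
have [c cP] := choice hc.
(* The Cauchy bound passes to the limit on each finite partial sum, where convergence of
   coefficients suffices; only then does the number of terms grow. *)
have key (e : R) : 0 < e -> exists N, forall i, (N <= i)%N -> ss (fun n => x i n - c n) /\ l2norm (fun n => x i n - c n) <= e.
  move=> e0; have [N hN] := h e e0; exists N => i Ni; apply: ss_partial_le; last exact: ltW.
  move=> K; have lim : \sum_(0 <= n < K) normc (x i n - x j n) ^+ 2 @[j --> \oo] -->
      \sum_(0 <= n < K) normc (x i n - c n) ^+ 2.
    elim: K => [|K IH]; first by rewrite big_nil; under eq_fun do rewrite big_nil; exact: cvg_cst.
    rewrite big_nat_recr//=; under eq_fun do rewrite big_nat_recr//=.
    have hh : normc (x i K - x j K) @[j --> \oo] --> normc (x i K - c K).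
      exact: (cvg_normc (cvgB (cvg_cst (x i K)) (cP K))).
    exact: (cvgD IH (cvgM hh hh)).
  rewrite -(cvg_lim _ lim)//; apply: limr_le; first by apply/cvg_ex; eexists; exact: lim.
  near=> j.
  apply: le_trans (ss_partial K (ssB (sx i) (sx j))) _.
  apply: lerXn2r; rewrite ?nnegrE ?l2norm_ge0 ?(ltW e0)//.
  by apply: hN => //; near: j; exact: nbhs_infty_ge.
exists c.
  have [N hN] := key 1 ltr01; have [s1 _] := hN N (leqnn N).
  by have := ssB (sx N) s1; congr ss; apply/funext => n; rewrite opprB addrC subrK.
apply/cvgrPdist_le => e e0; have [N hN] := key e e0; near=> j.
rewrite sub0r normrN ger0_norm ?l2norm_ge0//.
have [] := hN j _ => //; near: j; exact: nbhs_infty_ge.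
Unshelve. all: by end_near. Qed.

End l2.
#[local] Opaque dot l2norm square_summable.

(** * Szego kernels and Riesz representation *)

Section kernels.
Variable R : realType.
Local Notation C := R[i].
Implicit Types (z w : C) (c d : nat -> C) (s : seq (C * C)).
Local Notation ss := square_summable.

(* Coefficients of the combination of Szego kernels [sum a k_z], over the pairs (a, z) of s. *)
Definition kv s n : C := \sum_(p <- s) p.1 * p.2^* ^+ n.

(* Pairing of F with that combination, by the reproducing property. *)
Definition evs (F : C -> C) s : R := \sum_(p <- s) complex.Re (p.1^* * F p.2).

Definition in_disc s := forall p, p \in s -> disc p.2.

Lemma in_disc_cons p s : in_disc (p :: s) <-> disc p.2 /\ in_disc s.
Proof.
split=> [h|[hp hs] q]; last by rewrite inE => /predU1P[->//|/hs].
by split=> [|q qs]; apply: h; rewrite inE ?eqxx// qs orbT.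
Qed.

Lemma geo_kernel (a : C) z : disc z -> geo (fun n => a * z^* ^+ n).
Proof.
move=> /normc_disc z1; exists (normc a), (normc z); split; [exact: normc_ge0|exact: z1|] => n.
by rewrite normcM normcX normc_conj.
Qed.

Lemma geo_kv s : in_disc s -> geo (kv s).
Proof.
elim: s => [_|p s IH /in_disc_cons[hp /IH hs]].
  by rewrite (_ : kv [::] = fun=> 0)//; [exact: geo0|apply/funext => n; rewrite /kv big_nil].
have := geoD (geo_kernel p.1 hp) hs; congr geo; apply/funext => n.
by rewrite /kv big_cons.
Qed.

Lemma ss_kv s : in_disc s -> ss (kv s).
Proof. by move=> /geo_kv/geo_ss. Qed.

Lemma dot_kernel c (a : C) z : ss c -> disc z ->
  dot c (fun n => a * z^* ^+ n) = complex.Re (a^* * pser c z).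
Proof.
move=> sc zD; apply: dot_unique.
have h := geo_cvg (geoZ a^* (conv_disc_geo (square_summable_conv_disc sc) zD)).
rewrite csumZ in h; last exact: conv_disc_geo (square_summable_conv_disc sc) zD.
have -> : series (fun n => complex.Re (c n * (a * z^* ^+ n)^*)) =
    (fun N => complex.Re (series (fun n => a^* * (c n * z ^+ n)) N)).
  apply/funext => N; rewrite /series/= Re_sum.
  by apply: eq_bigr => n _; rewrite conjM conjX conjCK; congr complex.Re; ring.
exact: (cvg_Re h).
Qed.

Lemma dot_kv c s : ss c -> in_disc s -> dot c (kv s) = evs (pser c) s.
Proof.
move=> sc; elim: s => [_|p s IH /in_disc_cons[hp hs]].
  rewrite /evs big_nil; apply: dot_unique; rewrite (_ : series _ = cst 0); first exact: cvg_cst.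
  by apply/funext => N; rewrite /series/= big1// => n _; rewrite /kv big_nil conj0 mulr0.
rewrite /evs big_cons -/(evs _ s) -IH// -dot_kernel// -dotDr//; last exact: ss_kv.
  by congr dot; apply/funext => n; rewrite /kv big_cons.
exact/geo_ss/geo_kernel.
Qed.

Lemma evs_kv s t : in_disc s -> in_disc t -> dot (kv s) (kv t) = evs (pser (kv s)) t.
Proof. by move=> /ss_kv hs ht; rewrite dot_kv. Qed.

Lemma kv_cat s t n : kv (s ++ t) n = kv s n + kv t n.
Proof. by rewrite /kv big_cat. Qed.

Definition kscale (k : R) s : seq (C * C) := [seq (k%:C * p.1, p.2) | p <- s].

Lemma kv_scale k s n : kv (kscale k s) n = k%:C * kv s n.
Proof. by rewrite /kv big_map big_distrr/=; apply: eq_bigr => p _; rewrite mulrA. Qed.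

Lemma evs_cat F s t : evs F (s ++ t) = evs F s + evs F t.
Proof. by rewrite /evs big_cat. Qed.

Lemma evs_scale F k s : evs F (kscale k s) = k * evs F s.
Proof.
rewrite /evs big_map big_distrr/=; apply: eq_bigr => p _.
by rewrite conjM conj_real -mulrA ReM_real.
Qed.

Lemma in_disc_cat s t : in_disc s -> in_disc t -> in_disc (s ++ t).
Proof. by move=> hs ht p; rewrite mem_cat => /orP[/hs|/ht]. Qed.

Lemma in_disc_scale k s : in_disc s -> in_disc (kscale k s).
Proof. by move=> hs p /mapP[q qs ->]; exact: (hs _ qs). Qed.

(* Riesz representation: the representing vector is the limit of a sequence of kernel
   combinations minimizing |h|^2 - 2 evs F h. *)
Lemma rkhs_criterion (F : C -> C) (M : R) : 0 <= M ->
  (forall s, in_disc s -> evs F s <= M * l2norm (kv s)) ->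
  exists c, [/\ ss c, l2norm c <= M & forall z, disc z -> F z = pser c z].
Proof.
move=> M0 hM.
pose J s := l2norm (kv s) ^+ 2 - 2 * evs F s.
pose E := [set x | exists2 s, in_disc s & x = J s].
have d0 : in_disc [::] by [].
have hE : has_inf E.
  split; first by exists (J [::]); exists [::].
  (* Completing the square: |h|^2 - 2 M |h| >= - M^2. *)
  exists (- M ^+ 2) => _ [s sD ->]; have := hM s sD; rewrite /J.
  by have := sqr_ge0 (l2norm (kv s) - M); nra.
set m := inf E.
have mJ s : in_disc s -> m <= J s by move=> sD; apply: (inf_lbound hE.2); exists s.
have hs j : exists s, in_disc s /\ J s < m + j.+1%:R^-1.
  have [|_ [s sD ->] h] := @inf_adherent _ E j.+1%:R^-1 _ hE; first by rewrite invr_gt0.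
  by exists s.
have [s sP] := choice hs.
have sD j : in_disc (s j) by have [] := sP j.
have Jm j : J (s j) < m + j.+1%:R^-1 by have [] := sP j.
have line t u (k : R) : in_disc t -> in_disc u ->
    J (t ++ kscale k u) = J t + 2 * k * (dot (kv t) (kv u) - evs F u) + k ^+ 2 * l2norm (kv u) ^+ 2.
  move=> tD uD; rewrite /J evs_cat evs_scale.
  rewrite (_ : kv (t ++ _) = fun n => kv t n + k%:C * kv u n); last first.
    by apply/funext => n; rewrite kv_cat kv_scale.
  rewrite l2norm_line; [ring|exact: ss_kv..].
have inDl t u k : in_disc t -> in_disc u -> in_disc (t ++ kscale k u).
  by move=> tD uD; apply: in_disc_cat => //; exact: in_disc_scale.
have cau (e : R) : 0 < e -> exists N, forall i j, (N <= i)%N -> (N <= j)%N ->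
    l2norm (fun n => kv (s i) n - kv (s j) n) <= e.
  move=> e0; have e4 : 0 < e ^+ 2 / 4 by rewrite divr_gt0// exprn_gt0.
  have [N hN] : exists N : nat, (N.+1)%:R^-1 < e ^+ 2 / 4.
    by have [N _ /(_ N (leqnn _))] := near_infty_natSinv_lt (PosNum e4); exists N.
  exists N => i j Ni Nj; rewrite -(@ler_pXn2r _ 2)// ?nnegrE ?l2norm_ge0 ?(ltW e0)//.
  rewrite (_ : (fun n => _) = fun n => kv (s i) n + (-1)%:C * kv (s j) n); last first.
    by apply/funext => n; rewrite rmorphN rmorph1 mulN1r.
  have invN k : (N <= k)%N -> k.+1%:R^-1 <= N.+1%:R^-1 :> R.
    by move=> Nk; rewrite lef_pV2 ?posrE// ler_nat.
  have := Jm i; have := Jm j; have := invN _ Ni; have := invN _ Nj.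
  (* Parallelogram law: |a - b|^2 is 2 J a + 2 J b minus 4 times J at the midpoint, because the
     linear part of J cancels; the value at the midpoint is at least m. *)
  have mid := mJ _ (inDl _ _ 2^-1 (in_disc_scale (k := 2^-1) (sD i)) (sD j)).
  move: mid; rewrite line//; last exact: in_disc_scale.
  rewrite {1}/J evs_scale (_ : kv (kscale 2^-1 (s i)) = fun n => 2^-1%:C * kv (s i) n); last first.
    by apply/funext => n; rewrite kv_scale.
  have si := ss_kv (sD i); have sj := ss_kv (sD j).
  rewrite (l2norm_line (-1) si sj) (dotZl _ si sj) (l2normZ _ si) normc_real exprMn real_normK ?num_real// /J.
  move: (dot _ _) (l2norm (kv (s i)) ^+ 2) (l2norm (kv (s j)) ^+ 2) (evs F (s i)) (evs F (s j)) => x a b f g.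
  rewrite (_ : (2^-1 : R) ^+ 2 = 4^-1); last by field.
  rewrite sqrrN expr1n; move: hN; move: (N.+1%:R^-1) (i.+1%:R^-1) (j.+1%:R^-1) => N' i' j'.
  lra.
have [c sc cvc] := l2_complete (fun j => ss_kv (sD j)) cau.
have dotc u : in_disc u -> dot c (kv u) = evs F u.
  move=> uD; have su := ss_kv uD.
  have lim : dot (kv (s j)) (kv u) @[j --> \oo] --> dot c (kv u).
    apply/cvgrPdist_le => e e0.
    have h0 : l2norm (fun n => kv (s j) n - c n) * l2norm (kv u) @[j --> \oo] --> 0 * l2norm (kv u).
      by apply: cvgM => //; exact: cvg_cst.
    rewrite mul0r in h0; move/cvgrPdist_le : h0 => /(_ e e0); apply: filterS => j.
    rewrite sub0r normrN ger0_norm ?mulr_ge0 ?l2norm_ge0//; apply: le_trans.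
    rewrite -dotBl//; last exact: ss_kv.
    by apply: le_trans (dot_abs_le (ssB sc (ss_kv (sD j))) su) _; rewrite l2normBC.
  (* First-order condition: perturbing the minimizing sequence by k u and letting j grow leaves a
     nonnegative quadratic in k. *)
  have key (k : R) : 0 <= 2 * k * (dot c (kv u) - evs F u) + k ^+ 2 * l2norm (kv u) ^+ 2.
    have hl : j.+1%:R^-1 + 2 * k * (dot (kv (s j)) (kv u) - evs F u) + k ^+ 2 * l2norm (kv u) ^+ 2
        @[j --> \oo] --> 0 + 2 * k * (dot c (kv u) - evs F u) + k ^+ 2 * l2norm (kv u) ^+ 2.
      apply: cvgD; last exact: cvg_cst.
      apply: cvgD; first exact: cvg_harmonic.
      apply: cvgM; first exact: cvg_cst.
      apply: cvgB; [exact: lim|exact: cvg_cst].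
    rewrite add0r in hl; rewrite -(cvg_lim _ hl)//; apply: limr_ge; first by apply/cvg_ex; eexists; exact: hl.
    near=> j.
    have := mJ _ (inDl _ _ k (sD j) uD); rewrite line//; have := Jm j.
    by move: (j.+1%:R^-1) => j'; lra.
  set x := dot c (kv u) - evs F u in key *.
  set y := l2norm (kv u) ^+ 2 in key.
  apply/eqP; rewrite -subr_eq0 -/x -sqrf_eq0 eq_le sqr_ge0 andbT.
  have y0 : 0 <= y by exact: sqr_ge0.
  (* The minimizer - x / y is replaced by - x / (1 + y), since y = |u|^2 may vanish. *)
  have := key (- x / (1 + y)).
  rewrite (_ : _ + _ = - (x ^+ 2) * ((2 + y) / (1 + y) ^+ 2)); last by field; lra.
  rewrite mulNr oppr_ge0 pmulr_lle0// divr_gt0//; first by lra.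
  by rewrite exprn_gt0//; lra.
have Fc z : disc z -> F z = pser c z.
  move=> zD.
  have D1 (a : C) : in_disc [:: (a, z)] by move=> p; rewrite inE => /eqP ->.
  have h (a : C) : complex.Re (a^* * pser c z) = complex.Re (a^* * F z).
    by have := dotc _ (D1 a); rewrite dot_kv//; rewrite /evs !big_seq1.
  (* The coefficients 1 and i give the real and the imaginary part. *)
  have := h 1; have := h 'i; case: (F z) => x1 y1; case: (pser c z) => x2 y2 /=.
  by rewrite !mul0r !mul1r !mulN1r oppr0 !mul0r !subr0 !sub0r !opprK => -> ->.
exists c; split => //.
have lim1 : l2norm (kv (s j)) @[j --> \oo] --> l2norm c.
  apply/cvgrPdist_le => e e0; move/cvgrPdist_le : cvc => /(_ e e0); apply: filterS => j.
  rewrite sub0r normrN ger0_norm ?l2norm_ge0//; apply: le_trans.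
  have sj := ss_kv (sD j).
  by rewrite ler_norml l2normBC l2normB// andbT lerNl opprB l2normBC l2normB.
have lim2 : dot c (kv (s j)) @[j --> \oo] --> l2norm c ^+ 2.
  rewrite -dot_sqr//; apply/cvgrPdist_le => e e0.
  have h0 : l2norm c * l2norm (fun n => kv (s j) n - c n) @[j --> \oo] --> l2norm c * 0.
    by apply: cvgM => //; exact: cvg_cst.
  rewrite mulr0 in h0; move/cvgrPdist_le : h0 => /(_ e e0); apply: filterS => j.
  rewrite sub0r normrN ger0_norm ?mulr_ge0 ?l2norm_ge0//; apply: le_trans.
  have sj := ss_kv (sD j).
  rewrite [dot c (kv _)]dotC -(dotBl sc sj sc) mulrC l2normBC; exact: (dot_abs_le (ssB sc sj) sc).
(* The hypothesis is tested on the minimizing sequence itself, which converges to c. *)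
have : l2norm c ^+ 2 <= M * l2norm c.
  apply: (ler_cvg_to lim2 (cvgM (cvg_cst M) lim1)); apply: nearW => j.
  by rewrite dotc//; exact: hM.
have := l2norm_ge0 c; rewrite le_eqVlt => /predU1P[<- //|c0].
by rewrite expr2 ler_pM2r.
Unshelve. all: by end_near. Qed.

End kernels.

(** * Real differential inequalities *)

Section real_calculus.
Variable R : realType.
Implicit Types (f df : R -> R).

Lemma is_derive_ext (f g : R -> R) (t l m : R) : is_derive t 1 f l -> f = g -> l = m -> is_derive t 1 g m.
Proof. by move=> h <- <-. Qed.

Lemma is_derive_nonincr f df (a b : R) : a <= b ->
  (forall t, a <= t <= b -> is_derive t 1 f (df t)) ->
  (forall t, a <= t <= b -> df t <= 0) -> f b <= f a.
Proof.
move=> ab hd h.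
have [||c cab] := @MVT_segment R f df a b ab.
- by move=> t; rewrite in_itv/= => /andP[ta tb]; apply: hd; rewrite !ltW.
- apply: derivable_within_continuous => t; rewrite in_itv/= => tab.
  by have [] := hd t tab.
rewrite in_itv/= in cab; have := h c cab; move: (df c) => x hx hE.
have : x * (b - a) <= 0 by rewrite mulr_le0_ge0// subr_ge0.
by rewrite -hE subr_le0.
Qed.

Lemma is_derive_expRM (k t : R) : is_derive t 1 (fun s => expR (k * s)) (k * expR (k * t)).
Proof.
have h : is_derive t 1 (fun s : R => k * s) k.
  by apply: is_derive_ext (is_deriveZ k (is_derive_id t 1)) _ _ => //; rewrite [_ *: _]mulr1.
have hc := @is_derive1_comp R expR (fun s => k * s) t _ _ (is_derive_expR _) h.
by apply: (is_derive_ext hc) => //; rewrite mulrC.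
Qed.

Lemma gronwall f df (K T : R) : 0 <= T ->
  (forall t, 0 <= t <= T -> is_derive t 1 f (df t)) ->
  (forall t, 0 <= t <= T -> df t <= K * f t) -> f T <= expR (K * T) * f 0.
Proof.
move=> T0 hd h.
have key : f T * expR (- K * T) <= f 0 * expR (- K * 0).
  apply: (@is_derive_nonincr (fun t => f t * expR (- K * t)) (fun t => f t *: (- K * expR (- K * t)) + expR (- K * t) *: df t) 0 T) => //.
    by move=> t tT; exact: is_deriveM (hd t tT) (is_derive_expRM (- K) t).
  move=> t tT; rewrite [_ *: _ + _](_ : _ = expR (- K * t) * (df t - K * f t)); last by rewrite /GRing.scale/=; ring.
  by rewrite pmulr_rle0 ?expR_gt0// subr_le0 h.
move: key; rewrite mulr0 expR0 mulr1 => key.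
rewrite -(ler_pM2r (expR_gt0 (- K * T))); apply: (le_trans key).
by rewrite -mulrA mulrCA -expRD mulNr subrr expR0 mulr1.
Qed.

End real_calculus.

(** * Complex-valued paths of a real variable *)

Section paths.
Variable R : realType.
Local Notation C := R[i].
Implicit Types (u v : R -> C) (t : R).

(** A limit of two-sided quotients with real parameter and complex values, whereas [is_derive] keeps
    source and target over one field. *)
Definition cderiv u t (l : C) : Prop :=
  (h^-1)%:C * (u (h + t) - u t) @[h --> (0 : R)^'] --> l.

Lemma cderiv_ext u v t l m : cderiv u t l -> u = v -> l = m -> cderiv v t m.
Proof. by move=> h <- <-. Qed.

Lemma is_derive_quotient (f : R -> R) t (l : R) :
  is_derive t 1 f l <-> h^-1 * (f (h + t) - f t) @[h --> (0 : R)^'] --> l.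
Proof.
have E : (fun h : R => h^-1 *: (f (h *: 1 + t) - f t)) = (fun h => h^-1 * (f (h + t) - f t)).
  by apply/funext => h; rewrite [h *: 1]mulr1.
split=> [[d <-]|h].
  by rewrite -E; exact: d.
apply: DeriveDef; first by apply/cvg_ex; exists l; rewrite E.
by rewrite /derive E; exact: cvg_lim h.
Qed.

Lemma cderiv_Re u t l : cderiv u t l -> is_derive t 1 ((fun s => complex.Re (u s)) : R -> R) (complex.Re l : R).
Proof.
move=> h; apply/is_derive_quotient.
apply: (cvg_conv (cvg_Re h)) => //.
by apply/funext => x; rewrite ReM_real ReB.
Qed.

Lemma cderiv_ReIm u t l : is_derive t 1 ((fun s => complex.Re (u s)) : R -> R) (complex.Re l : R) ->
  is_derive t 1 ((fun s => complex.Im (u s)) : R -> R) (complex.Im l : R) -> cderiv u t l.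
Proof.
move=> /is_derive_quotient hr /is_derive_quotient hi; apply: cvg_ReIm.
  by apply: (cvg_conv hr) => //; apply/funext => x; rewrite ReM_real ReB.
by apply: (cvg_conv hi) => //; apply/funext => x; rewrite ImM_real ImB.
Qed.

Lemma cderiv_cst (k : C) t : cderiv (fun=> k) t 0.
Proof.
rewrite /cderiv; under eq_fun do rewrite subrr mulr0; exact: cvg_cst.
Qed.

Lemma cderivD u v t l m : cderiv u t l -> cderiv v t m -> cderiv (fun s => u s + v s) t (l + m).
Proof.
move=> hu hv; have h : (h^-1)%:C * (u (h + t) - u t) + (h^-1)%:C * (v (h + t) - v t) @[h --> (0 : R)^'] --> l + m.
  exact: (cvgD hu hv).
by apply: (cvg_conv h) => //; apply/funext => x; ring.
Qed.

Lemma cvg_real0 : (h%:C : C) @[h --> (0 : R)^'] --> (0 : C).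
Proof. by apply: cvg_real_complex; apply: cvg_within_filter; exact: cvg_id. Qed.

Lemma near_neq0 : \forall h \near (0 : R)^', h != 0.
Proof. exact: nbhs_dnbhs_neq. Qed.

Lemma realc_neq0 (h : R) : h != 0 -> (h%:C : C) != 0.
Proof. by apply: contra => /eqP/(congr1 (@complex.Re R))/= ->. Qed.

Lemma realcV (h : R) : (h^-1)%:C = (h%:C)^-1 :> C.
Proof. exact: fmorphV. Qed.

Lemma cderiv_cvg u t l : cderiv u t l -> u (h + t) @[h --> (0 : R)^'] --> u t.
Proof.
move=> hu.
have h : h%:C * ((h^-1)%:C * (u (h + t) - u t)) + u t @[h --> (0 : R)^'] --> 0 * l + u t.
  exact: (cvgD (cvgM cvg_real0 hu) (cvg_cst (u t))).
rewrite mul0r add0r in h; apply: cvg_trans h; apply: near_eq_cvg; near=> h.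
have h0 : h != 0 by near: h; exact: near_neq0.
rewrite mulrA realcV mulfV ?mul1r ?subrK//.
exact: realc_neq0.
Unshelve. all: by end_near. Qed.

Lemma cderivM u v t l m : cderiv u t l -> cderiv v t m ->
  cderiv (fun s => u s * v s) t (l * v t + u t * m).
Proof.
move=> hu hv.
have h : (h^-1)%:C * (u (h + t) - u t) * v t + u (h + t) * ((h^-1)%:C * (v (h + t) - v t))
    @[h --> (0 : R)^'] --> l * v t + u t * m.
  exact: (cvgD (cvgM hu (cvg_cst (v t))) (cvgM (cderiv_cvg hu) hv)).
by apply: (cvg_conv h) => //; apply/funext => x; ring.
Qed.

Lemma cderivZ (k : C) u t l : cderiv u t l -> cderiv (fun s => k * u s) t (k * l).
Proof. by move=> hu; have := cderivM (cderiv_cst k t) hu; rewrite mul0r add0r. Qed.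

Lemma cderiv_conj u t l : cderiv u t l -> cderiv (fun s => (u s)^*) t l^*.
Proof.
move=> hu; apply: (cvg_conv (cvg_conj hu)) => //; apply/funext => h.
by rewrite conjM conj_real rmorphB.
Qed.

Lemma cderivV u t l : u t != 0 -> cderiv u t l -> cderiv (fun s => (u s)^-1) t (- l / u t ^+ 2).
Proof.
move=> ut0 hu; have cu := cderiv_cvg hu.
have hh : - ((h^-1)%:C * (u (h + t) - u t) * (u (h + t) * u t)^-1) @[h --> (0 : R)^'] --> - (l * (u t * u t)^-1).
  exact: (cvgN (cvgM hu (cvgV (mulf_neq0 ut0 ut0) (cvgM cu (cvg_cst (u t)))))).
rewrite -expr2 -mulNr in hh; apply: cvg_trans hh; apply: near_eq_cvg; near=> h.
have uh : u (h + t) != 0.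
  near: h; have : normc (u (h + t)) @[h --> (0 : R)^'] --> normc (u t) by exact: (cvg_normc cu).
  move=> /cvgrPdist_lt h0.
  have n0 : 0 < normc (u t) by rewrite lt_neqAle normc_ge0 andbT eq_sym; apply/eqP => /eq0_normc/eqP; apply/negP.
  have := h0 _ n0; apply: filterS => h; apply: contraTneq => ->.
  by rewrite normc0 subr0 ger0_norm ?normc_ge0// ltxx.
by move: (h^-1)%:C => k; field; rewrite ut0 uh.
Unshelve. all: by end_near. Qed.

Lemma cderiv_id t (z : C) : cderiv (fun s => s%:C * z) t z.
Proof.
apply: (@cvg_normc0_le _ _ _ _ _ _ (fun=> 0)); last exact: cvg_cst.
near=> h; have h0 : h != 0 by near: h; exact: near_neq0.
rewrite -mulrBl -rmorphB addrK mulrA -rmorphM mulVf// mul1r subrr normc0//.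
Unshelve. all: by end_near. Qed.

Lemma cderiv_pser (c : nat -> C) u t l : conv_disc c -> disc (u t) -> cderiv u t l ->
  cderiv (fun s => pser c (u s)) t (l * pser (deriv c) (u t)).
Proof.
move=> hc uD hu; have [r r01 [ur nr]] := near_disc uD.
have [L L0 hL] := pser_diff hc r01; have cu := cderiv_cvg hu.
have nd : normc (u (h + t) - u t) @[h --> (0 : R)^'] --> normc (u t - u t).
  exact: (cvg_normc (cvgB cu (cvg_cst (u t)))).
have lim : normc ((h^-1)%:C * (u (h + t) - u t)) * (L * normc (u (h + t) - u t)) @[h --> (0 : R)^'] --> (0 : R).
  apply: (cvg_conv (cvgM (cvg_normc hu) (cvgM (cvg_cst L) nd))) => //.
  by rewrite subrr normc0 !mulr0.
have h2 : (h^-1)%:C * (pser c (u (h + t)) - pser c (u t) - (u (h + t) - u t) * pser (deriv c) (u t))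
    @[h --> (0 : R)^'] --> (0 : C).
  apply: (cvg_normc0_le _ lim); near=> h.
  have uh : normc (u (h + t)) <= r.
    near: h; move: nr => /cu; exact.
  have [_ h2] := hL _ _ uh (ltW ur).
  rewrite subr0 !normcM -mulrA; apply: ler_wpM2l; first exact: normc_ge0.
  by apply: (le_trans h2); rewrite expr2 mulrCA.
have h : (h^-1)%:C * (u (h + t) - u t) * pser (deriv c) (u t) +
    (h^-1)%:C * (pser c (u (h + t)) - pser c (u t) - (u (h + t) - u t) * pser (deriv c) (u t))
    @[h --> (0 : R)^'] --> l * pser (deriv c) (u t) + 0.
  exact: (cvgD (cvgM hu (cvg_cst (pser (deriv c) (u t)))) h2).
by apply: (cvg_conv h); [apply/funext => x; rewrite -mulrA -mulrDr [X in _ * X]addrC subrK|rewrite addr0].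
Unshelve. all: by end_near. Qed.

Lemma cderiv_sum (I : Type) (r : seq I) (u : I -> R -> C) (l : I -> C) t :
  (forall i, cderiv (u i) t (l i)) ->
  cderiv (fun s => \sum_(i <- r) u i s) t (\sum_(i <- r) l i).
Proof.
move=> h; elim: r => [|i r IH].
  by apply: (cderiv_ext (cderiv_cst 0 t)); rewrite ?big_nil//; apply/funext => s; rewrite big_nil.
by apply: (cderiv_ext (cderivD (h i) IH)); rewrite ?big_cons//; apply/funext => s; rewrite big_cons.
Qed.

(** The mean value inequality, reduced to monotonicity: with k unimodular making k (u b - u a) equal
    in real part to |u b - u a|, the function Re (k u) - v is nonincreasing. *)
Lemma cderiv_le u (u' : R -> C) (v v' : R -> R) (a b : R) : a <= b ->
  (forall t, a <= t <= b -> cderiv u t (u' t)) ->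
  (forall t, a <= t <= b -> is_derive t 1 v (v' t)) ->
  (forall t, a <= t <= b -> normc (u' t) <= v' t) ->
  normc (u b - u a) <= v b - v a.
Proof.
move=> ab hu hv h; have [k k1 kE] := unimodular_Re (u b - u a).
have : complex.Re (k * u b) - v b <= complex.Re (k * u a) - v a.
  apply: (@is_derive_nonincr R (fun t => complex.Re (k * u t) - v t) (fun t => complex.Re (k * u' t) - v' t) a b) => // t tab.
    have A : is_derive t 1 ((fun t0 => complex.Re (k * u t0)) : R -> R) (complex.Re (k * u' t) : R).
      exact: (cderiv_Re (cderivZ (k := k) (hu t tab))).
    have B := hv t tab; exact: (is_deriveB A B).
  rewrite subr_le0; apply: le_trans (h t tab); apply: le_trans (Re_le _) _.
  by rewrite normcM k1 mul1r.
rewrite -kE mulrBr ReB; lra.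
Qed.

End paths.

(** * The Toeplitz form of the symbol *)

Section toeplitz.
Variable R : realType.
Local Notation C := R[i].
Implicit Types (z w : C) (a b c g h q : nat -> C) (s : seq (C * C)).

(* [Re <G q, z q> <= 0] for every polynomial q, in terms of the coefficients g of G: on the
   circle this says that [Re (conj z G z)] is nonpositive. *)
Definition toeplitz_dissipative g := forall N q, (forall n, (N <= n)%N -> q n = 0) ->
  complex.Re (\sum_(0 <= j < N) conv g q j.+1 * (q j)^*) <= 0.

(** Cutting q after index N changes the sum only in its last term, where q_(N+1) enters through g_0
    alone. This extends the condition to infinite sequences at the price of one boundary term. *)
Lemma toeplitz_dissipative_truncated g q N : toeplitz_dissipative g ->
  complex.Re (\sum_(0 <= j < N.+1) conv g q j.+1 * (q j)^*) <=
  complex.Re (g 0%N * q N.+1 * (q N)^*).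
Proof.
move=> H; pose q' n := if (n < N.+1)%N then q n else 0.
have h0 n : (N.+1 <= n)%N -> q' n = 0 by move=> Nn; rewrite /q' ifN// -leqNgt.
have := H N.+1 q' h0; rewrite !big_nat_recr//=.
have qN : q' N = q N by rewrite /q' ltnSn.
have -> : \sum_(0 <= j < N) conv g q' j.+1 * (q' j)^* = \sum_(0 <= j < N) conv g q j.+1 * (q j)^*.
  apply: eq_big_nat => j /andP[_ jN]; rewrite {2}/q' ltnS (ltnW jN); congr (_ * _).
  apply: eq_big_nat => k /andP[_ kj]; rewrite /q' (_ : (k < N.+1)%N = true)//.
  by apply: leq_trans kj _; rewrite ltnS.
have -> : conv g q N.+1 = conv g q' N.+1 + g 0%N * q N.+1.
  rewrite /conv big_nat_recr//= [in RHS]big_nat_recr//= subnn h0// mulr0 addr0; congr (_ + _).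
  by apply: eq_big_nat => k /andP[_ kN]; rewrite /q' kN.
by rewrite qN mulrDl !ReD => ?; lra.
Qed.

Lemma deriv_conv a b n : deriv (conv a b) n = conv (deriv a) b n + conv a (deriv b) n.
Proof.
rewrite /deriv /conv.
have -> : n.+1%:R * \sum_(0 <= k < n.+2) a (n.+1 - k)%N * b k =
    \sum_(0 <= k < n.+2) (n.+1 - k)%:R * a (n.+1 - k)%N * b k +
    \sum_(0 <= k < n.+2) k%:R * a (n.+1 - k)%N * b k.
  rewrite big_distrr/= -big_split/=; apply: eq_big_nat => k /andP[_ kn].
  by rewrite -!mulrDl -natrD subnK// mulrA.
congr (_ + _).
  rewrite big_nat_recr//= subnn !mul0r addr0; apply: eq_big_nat => k /andP[_ kn].
  by rewrite subSn.
rewrite big_nat_recl//= !mul0r add0r; apply: eq_big_nat => k /andP[_ kn].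
by rewrite subSS; ring.
Qed.

Lemma geo_expr w : disc w -> geo (fun n => w^* ^+ n).
Proof. by move=> wD; have := geo_kernel 1 wD; congr geo; apply/funext => n; rewrite mul1r. Qed.

Lemma kernel_neq0 w z : disc w -> disc z -> 1 - w^* * z != 0.
Proof.
move=> /disc_normc w1 /disc_normc z1; rewrite subr_eq0 eq_sym; apply/eqP => /(congr1 (@normc R)).
rewrite normc1 normcM normc_conj => e.
by have := normc_ge0 w; have := normc_ge0 z; nra.
Qed.

Lemma pser_kernel w z : disc w -> disc z -> pser (fun n => w^* ^+ n) z = (1 - w^* * z)^-1.
Proof.
move=> wD zD; have g := conv_disc_geo (geo_conv_disc (geo_expr wD)) zD.
apply: (mulIf (kernel_neq0 wD zD)); rewrite mulVf ?kernel_neq0//.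
rewrite mulrBr mulr1 /pser {1}(csumS g) !expr0 mul1r mulrC -csumZ//.
have -> : (fun n => w^* * z * (w^* ^+ n * z ^+ n)) = (fun n => w^* ^+ n.+1 * z ^+ n.+1).
  by apply/funext => n; rewrite !exprS; ring.
by rewrite addrK.
Qed.

Lemma pser_kv s z : in_disc s -> disc z ->
  pser (kv s) z = \sum_(p <- s) p.1 * (1 - p.2^* * z)^-1.
Proof.
move=> + zD; elim: s => [_|p s IH /in_disc_cons[pD sD]].
  rewrite big_nil; apply: csum_unique; rewrite (_ : series _ = cst 0); first exact: cvg_cst.
  by apply/funext => N; rewrite /series/= big1// => n _; rewrite /kv big_nil mul0r.
have gk := geo_conv_disc (geo_expr pD).
rewrite big_cons -IH// -pser_kernel// -pserZ// -pserD//; last exact: geo_conv_disc (geo_kv sD).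
  by congr pser; apply/funext => n; rewrite /kv big_cons.
exact: conv_discZ.
Qed.

Lemma pser_deriv_conv a b z : conv_disc a -> conv_disc b -> disc z ->
  pser (deriv (conv a b)) z = pser (deriv a) z * pser b z + pser a z * pser (deriv b) z.
Proof.
move=> ha hb zD; have da := conv_disc_deriv ha; have db := conv_disc_deriv hb.
rewrite -!pser_conv// -pserD//; [|exact: conv_disc_conv..].
by congr pser; apply/funext => n; rewrite deriv_conv.
Qed.

Lemma deriv_kernel w : deriv (fun n => w^* ^+ n) =
  (fun n => w^* * conv (fun n => w^* ^+ n) (fun n => w^* ^+ n) n).
Proof.
apply/funext => n; rewrite /deriv /conv.
have -> : \sum_(0 <= k < n.+1) w^* ^+ (n - k) * w^* ^+ k = n.+1%:R * w^* ^+ n.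
  rewrite (eq_big_nat _ _ (F2 := fun=> w^* ^+ n)) ?sumr_const_nat ?subn0 ?mulr_natl//.
  by move=> k /andP[_ kn]; rewrite -exprD subnK.
by rewrite exprS; ring.
Qed.

Lemma pser_deriv_kernel w z : disc w -> disc z ->
  pser (deriv (fun n => w^* ^+ n)) z = w^* * (1 - w^* * z)^-1 ^+ 2.
Proof.
move=> wD zD; have gk := geo_conv_disc (geo_expr wD).
rewrite deriv_kernel pserZ//; last exact: conv_disc_conv.
by rewrite pser_conv// pser_kernel// expr2.
Qed.

(* Test function: the square of the Szego kernel at w. *)
Lemma toeplitz_dissipative_deriv g w : toeplitz_dissipative g -> conv_disc g -> disc w ->
  2 * complex.Re (w^* * pser g w) + (1 - normc w ^+ 2) * complex.Re (pser (deriv g) w) <= 0.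
Proof.
move=> Hg hg wD; pose k n := w^* ^+ n; pose q := conv k k.
have gk : geo k := geo_expr wD; have hk := geo_conv_disc gk.
have gq : geo q := geo_conv gk gk; have hq := geo_conv_disc gq.
have qE n : q n = n.+1%:R * w^* ^+ n.
  rewrite /q /conv (eq_big_nat _ _ (F2 := fun=> w^* ^+ n)) ?sumr_const_nat ?subn0 ?mulr_natl//.
  by move=> i /andP[_ kn]; rewrite -exprD subnK.
have hB : conv_disc (conv g q) := conv_disc_conv hg hq.
(* Because q_n = (n + 1) conj w ^ n, the form at q is a partial sum of the Taylor series of (G q)'
   at w. *)
have lim1 : series (fun n => deriv (conv g q) n * w ^+ n) @ \oo --> pser (deriv (conv g q)) w.
  exact: geo_cvg (conv_disc_geo (conv_disc_deriv hB) wD).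
have le0 : complex.Re (pser (deriv (conv g q)) w) <= 0.
  have l1 : complex.Re (series (fun n => deriv (conv g q) n * w ^+ n) N.+1) @[N --> \oo] -->
      complex.Re (pser (deriv (conv g q)) w).
    by apply: cvg_Re; rewrite cvg_shiftS.
  have l2 : complex.Re (g 0%N * (q N.+1 * (q N)^*)) @[N --> \oo] --> (0 : R).
    apply: (cvg_Re (l := 0)).
    exact: geo_cvg0 (geoZ (g 0%N) (geoM (geoS gq) (geo_conj gq))).
  apply: (ler_cvg_to l1 l2); apply: nearW => N; rewrite mulrA.
  apply: le_trans (toeplitz_dissipative_truncated q N Hg); rewrite /series/=.
  rewrite le_eqVlt; apply/orP; left; apply/eqP; congr complex.Re; apply: eq_bigr => j _.
  by rewrite qE conjM conj_nat conjX conjCK /deriv; ring.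
have qw : pser q w = (1 - w^* * w)^-1 ^+ 2 by rewrite pser_conv// pser_kernel// expr2.
have dqw : pser (deriv q) w = 2 * w^* * (1 - w^* * w)^-1 ^+ 3.
  by rewrite pser_deriv_conv// pser_deriv_kernel// pser_kernel//; ring.
move: le0; rewrite pser_deriv_conv// qw dqw.
set x := normc w ^+ 2; have x1 : x < 1.
  by have /disc_normc := wD; rewrite /x; have := normc_ge0 w; nra.
have -> : w^* * w = x%:C.
  by rewrite conjE /x sqr_normcE; case: (w) => u v; apply/eqP; rewrite eq_complex/=; apply/andP; split; apply/eqP; ring.
rewrite (_ : (1 - x%:C)^-1 = ((1 - x)^-1)%:C); last first.
  by rewrite realcV rmorphB rmorph1.
set y := (1 - x)^-1; have y0 : 0 < y by rewrite invr_gt0 subr_gt0.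
(* The common positive factor is (1 - |w|^2)^(-3), from the value and the derivative at w of the
   squared kernel. *)
rewrite (_ : _ + _ = (y ^+ 3)%:C * ((1 - x)%:C * pser (deriv g) w + 2%:R%:C * (w^* * pser g w))); last first.
  have -> : (2%:R%:C : C) = 2 by rewrite rmorph_nat.
  have -> : pser (deriv g) w * y%:C ^+ 2 = (y ^+ 3 * (1 - x))%:C * pser (deriv g) w.
    have yx : y * (1 - x) = 1 by rewrite mulVf// subr_eq0 gt_eqF.
    by rewrite [y ^+ 3]exprSr -mulrA yx mulr1 rmorphXn mulrC.
  have -> : (y ^+ 3 * (1 - x))%:C = y%:C ^+ 3 * (1 - x)%:C by rewrite -rmorphXn -rmorphM.
  have -> : (y ^+ 3)%:C = y%:C ^+ 3 by rewrite rmorphXn.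
  by ring.
rewrite !(ReM_real, ReD) pmulr_rle0 ?exprn_gt0//.
lra.
Qed.

Lemma sum_triangle (V : zmodType) (F : nat -> V) L :
  \sum_(0 <= k < L) F k *+ k.+1 = \sum_(0 <= m < L) \sum_(m <= k < L) F k.
Proof.
elim: L => [|L IH]; first by rewrite !big_nil.
rewrite big_nat_recr//= IH [RHS]big_nat_recr//= big_nat1.
have -> : \sum_(0 <= m < L) \sum_(m <= k < L.+1) F k = \sum_(0 <= m < L) (\sum_(m <= k < L) F k + F L).
  by apply: eq_big_nat => m /andP[_ mL]; rewrite big_nat_recr// ltnW.
by rewrite big_split/= sumr_const_nat subn0 -addrA -mulrSr.
Qed.

(** The factor k + 1 of [deriv] counts the indices m <= k, which splits the sum into one sum per
    tail. *)
Lemma sum_conv_deriv g h K :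
  \sum_(0 <= n < K) conv g (deriv h) n * (h n)^* =
  \sum_(0 <= m < K) \sum_(m <= n < K) \sum_(m <= k < n.+1) g (n - k)%N * h k.+1 * (h n)^*.
Proof.
elim: K => [|K IH]; first by rewrite !big_nil.
rewrite big_nat_recr//= IH [RHS]big_nat_recr//= big_nat1.
have -> : \sum_(0 <= m < K) \sum_(m <= n < K.+1) \sum_(m <= k < n.+1) g (n - k)%N * h k.+1 * (h n)^* =
    \sum_(0 <= m < K) (\sum_(m <= n < K) \sum_(m <= k < n.+1) g (n - k)%N * h k.+1 * (h n)^*
      + \sum_(m <= k < K.+1) g (K - k)%N * h k.+1 * (h K)^*).
  by apply: eq_big_nat => m /andP[_ mL]; rewrite big_nat_recr// ltnW.
rewrite big_split/= -addrA; congr (_ + _).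
rewrite -[RHS](big_nat_recr K _ (fun m => \sum_(m <= k < K.+1) g (K - k)%N * h k.+1 * (h K)^*))//=.
rewrite -sum_triangle /conv big_distrl/=; apply: eq_big_nat => k _.
by rewrite /deriv -mulr_natl; ring.
Qed.

(* The differentiation operator is the sum over m of the shifts [h |-> (sum_{k>=m} h_k z^k) / z];
   each of them is handled by the Toeplitz condition applied to the m-th tail of h. *)
Lemma toeplitz_dissipative_tail g h K m : toeplitz_dissipative g -> (m < K)%N ->
  complex.Re (\sum_(m <= n < K) \sum_(m <= k < n.+1) g (n - k)%N * h k.+1 * (h n)^*) <=
  complex.Re (g 0%N * h m.+1 * (h m)^*) + normc (g 0%N * h K * (h K.-1)^*).
Proof.
move=> Hg mK; pose q i := h (i + m).+1.
(* The term n = m is left over; with n = j + m + 1, the terms n > m are exactly the truncated form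
   of q. *)
rewrite big_ltn// ReD big_nat1 subnn; apply: lerD => //.
have [L KE] : exists L, K = (L + m).+1 by exists (K.-1 - m)%N; lia.
rewrite -{1}[m.+1]add0n big_addn (_ : (K - m.+1)%N = L); last by lia.
case: L KE => [|L] KE; first by rewrite big_geq// normc_ge0.
rewrite KE /=; apply: (le_trans _ (Re_le _)); apply: (le_trans _ (toeplitz_dissipative_truncated q L Hg)).
rewrite le_eqVlt; apply/orP; left; apply/eqP; congr complex.Re.
apply: eq_big_nat => j _; rewrite -big_distrl/= (_ : (j + m.+1)%N = (j + m).+1); last by lia.
congr (_ * _); rewrite -{1}[m]add0n big_addn (_ : ((j + m).+2 - m)%N = j.+2); last by lia.
rewrite /conv; apply: eq_big_nat => i /andP[_ ij]; rewrite /q; congr (g _ * _); lia.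
Qed.

(** Unlike [dot_kv] it asks only for convergence on the disc, so it applies to the coefficients of G
    h' when G is just analytic. *)
Lemma series_kv c s : conv_disc c -> in_disc s ->
  series (fun n => complex.Re (c n * (kv s n)^*)) @ \oo --> evs (pser c) s.
Proof.
move=> hc; elim: s => [_|p s IH /in_disc_cons[pD sD]].
  rewrite /evs big_nil (_ : series _ = cst 0); first exact: cvg_cst.
  by apply/funext => N; rewrite /series/= big1// => n _; rewrite /kv big_nil conj0 mulr0.
have h1 : complex.Re (p.1^* * series (fun n => c n * p.2 ^+ n) N) @[N --> \oo] --> complex.Re (p.1^* * pser c p.2).
  exact: (cvg_Re (cvgM (cvg_cst _) (geo_cvg (conv_disc_geo hc pD)))).
have h2 : complex.Re (p.1^* * series (fun n => c n * p.2 ^+ n) N) + series (fun n => complex.Re (c n * (kv s n)^*)) N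
    @[N --> \oo] --> complex.Re (p.1^* * pser c p.2) + evs (pser c) s.
  exact: (cvgD h1 (IH sD)).
rewrite /evs big_cons; apply: (cvg_conv h2) => //; apply/funext => N.
rewrite /series big_distrr Re_sum /= -big_split /=; apply: eq_bigr => n _.
rewrite /kv big_cons conjD mulrDr ReD conjM conjX conjCK; congr (complex.Re _ + _); ring.
Qed.

(** The leftover terms of the tails sum to at most |g_0| |h|^2; the boundary term occurs N + 1 times
    but decays geometrically, so it vanishes as N grows. *)
Lemma toeplitz_dissipative_evs g s : toeplitz_dissipative g -> conv_disc g -> in_disc s ->
  evs (fun z => pser g z * pser (deriv (kv s)) z) s <= normc (g 0%N) * l2norm (kv s) ^+ 2.
Proof.
move=> Hg hg sD; set h := kv s; have gh : geo h := geo_kv sD; have hh := geo_conv_disc gh.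
have sh : square_summable h := geo_ss gh.
have hd := conv_disc_deriv hh.
have -> : evs (fun z => pser g z * pser (deriv h) z) s = evs (pser (conv g (deriv h))) s.
  by rewrite /evs !big_seq; apply: eq_bigr => p ps; rewrite pser_conv//; exact: sD.
have l1 := series_kv (conv_disc_conv hg hd) sD; rewrite -/h in l1.
rewrite -cvg_shiftS in l1.
pose e N := N.+1%:R * (g 0%N * h N.+1 * (h N)^*).
have l2 : normc (g 0%N) * l2norm h ^+ 2 + normc (e N) @[N --> \oo] --> normc (g 0%N) * l2norm h ^+ 2 + 0.
  apply: cvgD; first exact: cvg_cst.
  rewrite -[X in _ --> X](normc0 R); apply: cvg_normc.
  have := geo_cvg0 (geo_nat (geoZ (g 0%N) (geoM (geoS gh) (geo_conj gh)))).
  by move=> h0; apply: (cvg_conv h0) => //; apply/funext => N; rewrite /e; congr (_ * _); rewrite mulrA.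
rewrite addr0 in l2; apply: (ler_cvg_to l1 l2); apply: nearW => N.
rewrite /series/= -Re_sum sum_conv_deriv Re_sum.
apply: (@le_trans _ _ (\sum_(0 <= m < N.+1) (complex.Re (g 0%N * h m.+1 * (h m)^*) + normc (g 0%N * h N.+1 * (h N)^*)))).
  by rewrite !big_nat; apply: ler_sum => m /andP[_ mN]; exact: toeplitz_dissipative_tail.
rewrite big_split/= sumr_const_nat subn0; apply: lerD; last by rewrite /e [normc (_%:R * _)]normcM normc_nat mulr_natl.
have s1 := ss_partial N.+1 sh.
have s2 : \sum_(0 <= n < N.+1) normc (h n.+1) ^+ 2 <= l2norm h ^+ 2.
  apply: le_trans (ss_partial N.+2 sh); rewrite [leRHS]big_nat_recl//=.
  by rewrite lerDr sqr_ge0.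
apply: (@le_trans _ _ (\sum_(0 <= m < N.+1) normc (g 0%N) * ((normc (h m.+1) ^+ 2 + normc (h m) ^+ 2) / 2))).
  apply: ler_sum => m _; apply: le_trans (Re_le _) _; rewrite !normcM normc_conj -mulrA.
  apply: ler_wpM2l; first exact: normc_ge0.
  by have := sqr_ge0 (normc (h m.+1) - normc (h m)); rewrite sqrrB; lra.
rewrite -big_distrr/=; apply: ler_wpM2l; first exact: normc_ge0.
by rewrite -big_distrl/= big_split/=; lra.
Qed.

(** The hypothesis at t z says that Re (conj z G(t z)) / (1 - t^2 |z|^2) has nonpositive derivative
    in t; compare t = 1 with t = 0. *)
Lemma radial_monotone_bound g z : conv_disc g -> disc z ->
  (forall w, disc w ->
    2 * complex.Re (w^* * pser g w) + (1 - normc w ^+ 2) * complex.Re (pser (deriv g) w) <= 0) ->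
  complex.Re (z^* * pser g z) <= (1 - normc z ^+ 2) * complex.Re (z^* * g 0%N).
Proof.
move=> hg zD H; set x := normc z ^+ 2.
have x1 : x < 1 by have /disc_normc := zD; rewrite /x; have := normc_ge0 z; nra.
have x0 : 0 <= x by exact: sqr_ge0.
pose v (t : R) := complex.Re (z^* * pser g (t%:C * z)).
have tD (t : R) : 0 <= t <= 1 -> disc (t%:C * z).
  move=> /andP[t0 t1]; apply/disc_normc; rewrite normcM normc_real ger0_norm//.
  by have /disc_normc := zD; have := normc_ge0 z; nra.
have dv (t : R) : 0 <= t <= 1 -> is_derive t 1 v (complex.Re (z^* * (z * pser (deriv g) (t%:C * z)))).
  move=> t01; exact: (cderiv_Re (cderivZ (k := z^*) (cderiv_pser hg (tD t t01) (@cderiv_id R t z)))).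
have d2 (t : R) : is_derive t 1 (fun s : R => 1 - x * s ^+ 2) (- (2 * x * t)).
  have := is_deriveB (is_derive_cst (1 : R) t 1) (is_deriveZ x (is_deriveM (is_derive_id t (1 : R)) (is_derive_id t (1 : R)))).
  move=> h; apply: (is_derive_ext h).
    by apply/funext => s; rewrite expr2.
  by rewrite /GRing.scale/=; ring.
have pos (t : R) : 0 <= t <= 1 -> 0 < 1 - x * t ^+ 2 by move=> /andP[t0 t1]; have := exprn_ile1 2 t0 t1; nra.
pose dw (t : R) : R := v t * (- (1 - x * t ^+ 2) ^- 2 * (- (2 * x * t))) +
   (1 - x * t ^+ 2)^-1 * complex.Re (z^* * (z * pser (deriv g) (t%:C * z))).
have := @is_derive_nonincr R (fun t : R => v t * (1 - x * t ^+ 2)^-1) dw 0 1 ler01.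
have h1 (t : R) : 0 <= t <= 1 -> is_derive t 1 (fun t : R => v t * (1 - x * t ^+ 2)^-1) (dw t).
  move=> t01; have p0 : 1 - x * t ^+ 2 != 0 by rewrite gt_eqF// pos.
  have dV := @is_deriveV R (fun s : R => 1 - x * s ^+ 2) t _ _ p0 (d2 t).
  by apply: (is_derive_ext (is_deriveM (dv t t01) dV)).
have h2 (t : R) : 0 <= t <= 1 -> dw t <= 0.
  move=> t01; have p := pos t t01; have [t0 t1] := andP t01.
  have := H _ (tD t t01); rewrite normcM normc_real ger0_norm// exprMn -/x.
  rewrite conjM conj_real -mulrA ReM_real -/(v t).
  have dE : complex.Re (z^* * (z * pser (deriv g) (t%:C * z))) = x * complex.Re (pser (deriv g) (t%:C * z)).
    rewrite mulrA (_ : z^* * z = x%:C) ?ReM_real//.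
    rewrite conjE /x sqr_normcE; case: (z) => a b; apply/eqP; rewrite eq_complex/=; apply/andP; split; apply/eqP; ring.
  rewrite /dw dE; set V := v t; set D := complex.Re (pser _ _) => hD.
  rewrite (_ : _ + _ = x / (1 - x * t ^+ 2) ^+ 2 * (2 * (t * V) + (1 - t ^+ 2 * x) * D)).
    by rewrite mulr_ge0_le0// divr_ge0// sqr_ge0.
  by rewrite /GRing.scale/=; field; rewrite gt_eqF.
have e1 : 1 - x * 1 ^+ 2 = 1 - x by rewrite expr1n mulr1.
have e0 : 1 - x * 0 ^+ 2 = 1 by rewrite expr0n mulr0 subr0.
move=> /(_ h1 h2); rewrite e1 e0 divr1 /v mul1r mul0r pser0 ler_pdivrMr ?subr_gt0//.
by move=> h; rewrite [leRHS]mulrC.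
Qed.

End toeplitz.

(** * Ordinary differential equations *)

Section ode.
Variable R : realType.
Local Notation C := R[i].
Local Notation mu := (@lebesgue_measure R).
Implicit Types (u v : R -> C) (r s t : R) (z w : C).

Lemma primitive (f : R -> R) : continuous f ->
  exists2 F : R -> R, F 0 = 0 & forall t, 0 <= t -> is_derive t 1 F (f t).
Proof.
(* Integration starts at -1, so that 0 is an interior point and the derivative there is
   two-sided. *)
move=> cf; pose I (x : R) := (\int[mu]_(t in [set` `[(-1 : R), x]]) f t)%R.
exists (fun x => I x - I 0) => [|t t0]; first by rewrite subrr.
have tu : t < t + 1 by rewrite ltrDl.
have int : mu.-integrable [set` `[(-1 : R), t + 1]] (EFin \o f).
  apply: continuous_compact_integrable; first exact: segment_compact.
  exact: continuous_subspaceT.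
have t1 : (-1 : R) < t by lra.
have [d e] := continuous_FTC1 (f := f) (a := BLeft (-1 : R)) tu int t1 (cf t).
have dI : is_derive t 1 I (f t) by apply: DeriveDef; [exact: d|rewrite -derive1E; exact: e].
have := is_deriveB dI (is_derive_cst (I 0) t 1); rewrite subr0 => h.
by apply: (is_derive_ext h).
Qed.

Lemma cprimitive (f : R -> C) : continuous f ->
  exists2 F : R -> C, F 0 = 0 & forall t, 0 <= t -> cderiv F t (f t).
Proof.
move=> cf.
have [|F1 F10 F1d] := @primitive (fun t => complex.Re (f t)).
  by move=> t; exact: (cvg_Re (F := nbhs t) (cf t)).
have [|F2 F20 F2d] := @primitive (fun t => complex.Im (f t)).
  by move=> t; exact: (cvg_Im (F := nbhs t) (cf t)).
exists (fun t => F1 t +i* F2 t) => [|t t0]; first by rewrite F10 F20.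
by apply: cderiv_ReIm; [exact: F1d|exact: F2d].
Qed.

(* Picard iteration on [0, +oo[, with errors weighted by exp (2 L t). *)
Lemma lipschitz_ode (F : C -> C) (B L : R) (z0 : C) : 1 <= L -> 0 <= B ->
  (forall z, normc (F z) <= B) ->
  (forall z w, normc (F z - F w) <= L * normc (z - w)) ->
  exists2 u, u 0 = z0 & forall t, 0 <= t -> cderiv u t (F (u t)).
Proof.
move=> L1 B0 FB FL.
(* Being B-Lipschitz on [0, +oo[ is preserved by the Picard step and by pointwise limits, and it
   makes the next integrand continuous. *)
pose P u := forall s t, 0 <= s <= t -> normc (u t - u s) <= B * (t - s).
have step u : exists v, P u -> [/\ P v, v 0 = z0 & forall t, 0 <= t -> cderiv v t (F (u t))].
  have [Pu|nPu] := pselect (P u); last by exists u.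
  (* Frozen at its initial value for negative times, the integrand is continuous on the whole
     line. *)
  pose f t := F (u (Num.max t 0)).
  have cf : continuous f.
    move=> t; apply: (cvg_normc0_le (F := nbhs t) (v := fun s => L * (B * `|s - t|))).
      apply: nearW => s; apply: (le_trans (FL _ _)); apply: ler_wpM2l; first lra.
      have key (a b : R) : a <= b -> normc (u (Num.max b 0) - u (Num.max a 0)) <= B * (b - a).
        move=> ab; apply: (le_trans (Pu (Num.max a 0) (Num.max b 0) _)).
          by rewrite le_max lexx orbT/= ge_max !le_max ab lexx orbT.
        by apply: ler_wpM2l => //; rewrite !maxEle; case: ifPn; case: ifPn; rewrite -?ltNge; lra.
      have [st|ts] := leP s t.
        by rewrite distcC ler0_norm ?subr_le0// opprB key.
      by rewrite gtr0_norm ?subr_gt0// key// ltW.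
    have c0 : `|s - t| @[s --> t] --> `|t - t|.
      by apply: cvg_norm; apply: cvgB; [exact: cvg_id|exact: cvg_cst].
    have h : L * (B * `|s - t|) @[s --> t] --> L * (B * `|t - t|).
      exact: (cvgM (cvg_cst L) (cvgM (cvg_cst B) c0)).
    by apply: (cvg_conv h) => //; rewrite subrr normr0 !mulr0.
  have [G G0 dG] := cprimitive cf.
  exists (fun t => z0 + G t) => _.
  have dv t : 0 <= t -> cderiv (fun t => z0 + G t) t (F (u t)).
    move=> t0; have := cderivD (cderiv_cst z0 t) (dG t t0); rewrite add0r /f.
    by rewrite (max_idPl t0).
  split => //; last by rewrite G0 addr0.
  move=> s t /andP[s0 st]; rewrite mulrBr.
  apply: (@cderiv_le R (fun t => z0 + G t) (fun t => F (u t)) (fun t => B * t) (fun=> B) s t) => //.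
    by move=> r /andP[sr _]; apply: dv; exact: le_trans sr.
  move=> r _; apply: (is_derive_ext (is_deriveZ B (is_derive_id r (1 : R)))) => //.
  by rewrite [_ *: _]mulr1.
have [Phi PhiP] := choice step.
pose x n := iter n Phi (fun=> z0).
have Px n : P (x n).
  elim: n => [|n /PhiP[]//] s t /andP[_ st].
  by rewrite subrr normc0 mulr_ge0// subr_ge0.
have x0 n : x n 0 = z0 by case: n => // n; have [] := PhiP _ (Px n).
have xd n t : 0 <= t -> cderiv (x n.+1) t (F (x n t)) by have [_ _] := PhiP _ (Px n); exact.
pose E t := expR (2 * L * t).
have dE k t : is_derive t 1 (fun t => k * E t) (k * (2 * L * E t)).
  exact: (is_deriveZ k (is_derive_expRM (2 * L) t)).
have E0 t : 0 < E t by exact: expR_gt0.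
(* Each step gains a factor 1/2 because E' = 2 L E: integrating L times the previous error yields
   half of it. *)
have dist n t : 0 <= t -> normc (x n.+1 t - x n t) <= B * E t * 2^-1 ^+ n.
  elim: n t => [|n IH] t t0.
    have := Px 1%N 0 t; rewrite lexx t0 x0 subr0 expr0 mulr1 => /(_ isT) h.
    apply: (le_trans h); apply: ler_wpM2l => //; rewrite /E.
    have := expR_ge1Dx (2 * L * t); nra.
  have := @cderiv_le R (fun t => x n.+2 t - x n.+1 t) (fun t => F (x n.+1 t) - F (x n t))
    (fun t => (B * 2^-1 ^+ n.+1) * E t) (fun t => (B * 2^-1 ^+ n.+1) * (2 * L * E t)) 0 t t0.
  rewrite !x0 subrr subr0 => h.
  apply: (@le_trans _ _ ((B * 2^-1 ^+ n.+1) * E t - (B * 2^-1 ^+ n.+1) * E 0)).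
    apply: h => r /andP[r0 rt].
    - apply: (cderiv_ext (cderivD (xd n.+1 r r0) (cderivZ (k := -1) (xd n r r0)))).
        by apply/funext => s; rewrite mulN1r.
      by rewrite mulN1r.
    - apply: (le_trans (FL _ _)); apply: (@le_trans _ _ (L * (B * E r * 2^-1 ^+ n))).
        by apply: ler_wpM2l; [lra|exact: IH].
      by rewrite exprS le_eqVlt; apply/orP; left; apply/eqP; field.
  have : 0 <= B * 2^-1 ^+ n.+1 * E 0 by rewrite !mulr_ge0// ?exprn_ge0// ?ltW// invr_ge0.
  by move: (2^-1 ^+ n.+1) => k; lra.
have far n k t : 0 <= t -> normc (x (n + k)%N t - x n t) <= 2 * (B * E t) * (2^-1 ^+ n - 2^-1 ^+ (n + k)).
  move=> t0; elim: k => [|k IH]; first by rewrite addn0 !subrr normc0 mulr0.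
  rewrite addnS -(subrK (x (n + k)%N t) (x (n + k).+1 t)) -addrA.
  apply: le_trans (le_normcD _ _) _; have := dist (n + k)%N t t0.
  rewrite [2^-1 ^+ (n + k).+1]exprS; move: IH; move: (2^-1 ^+ n) (2^-1 ^+ (n + k)) => a b.
  move: (normc _) (normc _) (B * E t) => c d e; lra.
have half0 (k : R) : k * 2^-1 ^+ n @[n --> \oo] --> (0 : R).
  by apply: cvg_geo0; rewrite invr_ge0 ler0n invf_lt1// ltr1n.
have lim t : exists l : C, 0 <= t -> x n t @[n --> \oo] --> l.
  have [t0|_] := boolP (0 <= t); last by exists 0.
  suff [l hl] : exists l : C, x n t @[n --> \oo] --> l by exists l.
  apply: complex_cauchy_cvg => e e0.
  have /cvgrPdist_lt/(_ e e0)[N _ hN] := half0 (2 * (B * E t)).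
  exists (x N t); near=> n.
  have Nn : (N <= n)%N by near: n; exact: nbhs_infty_ge.
  have := far N (n - N)%N t t0; rewrite subnKC// => h; apply: (le_lt_trans h).
  have := hN N (leqnn N); rewrite sub0r normrN ger0_norm; last first.
    by rewrite !mulr_ge0// ?exprn_ge0// ?ltW// invr_ge0.
  apply: le_lt_trans; apply: ler_wpM2l; first by rewrite !mulr_ge0// ltW.
  by rewrite gerBl exprn_ge0// invr_ge0.
have [u uP] := choice lim.
have udist n t : 0 <= t -> normc (x n t - u t) <= 2 * (B * E t) * 2^-1 ^+ n.
  move=> t0; have h : normc (x n t - x m t) @[m --> \oo] --> normc (x n t - u t).
    exact: (cvg_normc (cvgB (cvg_cst _) (uP t t0))).
  rewrite -(cvg_lim _ h)//; apply: limr_le; first by apply/cvg_ex; eexists; exact: h.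
  near=> m; have nm : (n <= m)%N by near: m; exact: nbhs_infty_ge.
  rewrite distcC; have := far n (m - n)%N t t0; rewrite subnKC// => hh; apply: (le_trans hh).
  apply: ler_wpM2l; first by rewrite !mulr_ge0// ltW.
  by rewrite gerBl exprn_ge0// invr_ge0.
have Pu : P u.
  move=> s t /andP[s0 st]; have t0 := le_trans s0 st.
  have h : normc (x m t - x m s) @[m --> \oo] --> normc (u t - u s).
    exact: (cvg_normc (cvgB (uP t t0) (uP s s0))).
  rewrite -(cvg_lim _ h)//; apply: limr_le; first by apply/cvg_ex; eexists; exact: h.
  by apply: nearW => m; apply: Px; rewrite s0.
(* One more Picard step from the limit u gives a curve w with w' = F(u); then w = u on [0, +oo[,
   because x (n + 1) also tends to w. *)
have [_ w0 wd] := PhiP u Pu; set w := Phi u in w0 wd.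
have wu t : 0 <= t -> w t = u t.
  move=> t0; suff lw : x n.+1 t @[n --> \oo] --> w t.
    have lu := uP t t0; rewrite -cvg_shiftS in lu.
    by rewrite -(cvg_lim _ lw)// -(cvg_lim _ lu).
  apply: (cvg_normc0_le _ (half0 (B * E t))); apply: nearW => n.
  have := @cderiv_le R (fun t => x n.+1 t - w t) (fun t => F (x n t) - F (u t))
    (fun t => (B * 2^-1 ^+ n) * E t) (fun t => (B * 2^-1 ^+ n) * (2 * L * E t)) 0 t t0.
  rewrite x0 w0 subrr subr0 => h.
  apply: (@le_trans _ _ ((B * 2^-1 ^+ n) * E t - (B * 2^-1 ^+ n) * E 0)).
    apply: h => r /andP[r0 rt].
    - apply: (cderiv_ext (cderivD (xd n r r0) (cderivZ (k := -1) (wd r r0)))).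
        by apply/funext => s; rewrite mulN1r.
      by rewrite mulN1r.
    - apply: (le_trans (FL _ _)); apply: (@le_trans _ _ (L * (2 * (B * E r) * 2^-1 ^+ n))).
        by apply: ler_wpM2l; [lra|exact: udist].
      by rewrite le_eqVlt; apply/orP; left; apply/eqP; ring.
  have : 0 <= B * 2^-1 ^+ n * E 0 by rewrite !mulr_ge0// ?exprn_ge0// ?ltW// invr_ge0.
  by rewrite mulrAC; move: (2^-1 ^+ n) => k; lra.
exists w; first exact: w0.
by move=> t t0; rewrite (wu t t0); exact: (wd t t0).
Unshelve. all: by end_near. Qed.

(** The negative part has a corner at 0, its square is differentiable everywhere. *)
Lemma is_derive_sqr_min0 (x : R) :
  is_derive x 1 (fun y : R => Num.min y 0 ^+ 2) (2 * Num.min x 0).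
Proof.
apply/is_derive_quotient; apply/cvgrPdist_le => e e0; near=> h.
have h0 : h != 0 by near: h; exact: near_neq0.
have he : `|h| <= e.
  by near: h; exact: dnbhs0_le.
have key : `|Num.min (h + x) 0 ^+ 2 - Num.min x 0 ^+ 2 - h * (2 * Num.min x 0)| <= h ^+ 2.
  rewrite ler_norml /Num.min; case: ltP => hx; case: ltP => x0; apply/andP; split; nra.
rewrite distrC -[2 * _](mulKf h0) -mulrBr normrM normfV ler_pdivrMl ?normr_gt0//.
apply: (le_trans key); rewrite -real_normK ?num_real// expr2.
by apply: ler_wpM2l.
Unshelve. all: by end_near. Qed.

(** The square of the negative part of m starts at 0 and is nonincreasing, its derivative being 2
    min(m, 0) m'. This takes the place of a first exit time. *)
Lemma stays_nonneg (m m' : R -> R) (T : R) : 0 <= T -> 0 <= m 0 ->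
  (forall t, 0 <= t <= T -> is_derive t 1 m (m' t)) ->
  (forall t, 0 <= t <= T -> m t < 0 -> 0 <= m' t) -> 0 <= m T.
Proof.
move=> T0 m0 dm hm.
have := @is_derive_nonincr R (fun t => Num.min (m t) 0 ^+ 2) (fun t => 2 * Num.min (m t) 0 * m' t) 0 T T0.
have -> : Num.min (m 0) 0 = 0 by apply/min_idPr.
rewrite expr0n => h; have : Num.min (m T) 0 ^+ 2 <= 0.
  apply: h => t tT.
    have hc := @is_derive1_comp R (fun y => Num.min y 0 ^+ 2) m t _ _ (is_derive_sqr_min0 (m t)) (dm t tT).
    by apply: (is_derive_ext hc).
  have [mt|mt] := ltP (m t) 0; last by rewrite mulr0 mul0r.
  by rewrite mulr_le0_ge0 ?hm//; nra.
rewrite le_eqVlt ltNge sqr_ge0 orbF sqrf_eq0 => /eqP e.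
by have := ge_min (m T) (m T) 0; rewrite e lexx.
Qed.

End ode.

(** * The flow of the vector field *)

Section flow.
Variable R : realType.
Local Notation C := R[i].
Implicit Types (u v : R -> C) (r s t T : R) (z w : C) (g : nat -> C).

Lemma max_lipschitz (c a b : R) : `|Num.max c a - Num.max c b| <= `|a - b|.
Proof.
have := ler_norm (a - b); have := ler_norm (b - a); rewrite (distrC b a).
case: (leP c a) => ha; case: (leP c b) => hb; rewrite ler_norml; move: `|a - b| => y; lra.
Qed.

Lemma min_lipschitz (c a b : R) : `|Num.min c a - Num.min c b| <= `|a - b|.
Proof.
have := ler_norm (a - b); have := ler_norm (b - a); rewrite (distrC b a).
case: (leP c a) => ha; case: (leP c b) => hb; rewrite ler_norml; move: `|a - b| => y; lra.
Qed.

Lemma is_derive_sqr_normc u t (l : C) : cderiv u t l ->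
  is_derive t 1 (fun s => normc (u s) ^+ 2 : R) (2 * complex.Re ((u t)^* * l) : R).
Proof.
move=> hu; have := cderiv_Re (cderivM hu (cderiv_conj hu)) => h.
apply: (is_derive_ext h); first by apply/funext => s; rewrite sqr_normc_Re.
rewrite ReD [X in _ + X = _]ReMconjC mulrC; lra.
Qed.

Lemma cderivB u v t (l m : C) : cderiv u t l -> cderiv v t m -> cderiv (fun s => u s - v s) t (l - m).
Proof.
move=> hu hv; apply: (cderiv_ext (cderivD hu (cderivZ (k := -1) hv))); last by rewrite mulN1r.
by apply/funext => s; rewrite mulN1r.
Qed.

Lemma cderiv_shift u s t (l : C) : cderiv u (t + s) l -> cderiv (fun r => u (r + s)) t l.
Proof. by rewrite /cderiv; under eq_fun do rewrite addrA. Qed.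

Lemma cderiv_near u v t (l : C) : (\forall s \near t, u s = v s) -> cderiv u t l -> cderiv v t l.
Proof.
move=> uv hu; have uvt : u t = v t by exact: (nbhs_singleton uv).
apply: cvg_trans hu; apply: near_eq_cvg.
have sh : h + t @[h --> (0 : R)^'] --> t.
  have h0 : h @[h --> (0 : R)^'] --> (0 : R) by apply: cvg_within_filter; exact: cvg_id.
  have h1 : h + t @[h --> (0 : R)^'] --> 0 + t by exact: (cvgD h0 (cvg_cst t)).
  by rewrite add0r in h1.
near=> h; have e : u (h + t) = v (h + t) by near: h; exact: (sh _ uv).
by rewrite /= uvt e.
Unshelve. all: by end_near. Qed.

Definition flow_line g u T := forall t, 0 <= t <= T -> disc (u t) /\ cderiv u t (pser g (u t)).

Variables (g : nat -> C) (K : R).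
Hypotheses (hg : conv_disc g) (K0 : 0 <= K).
Hypothesis inward : forall z, disc z -> complex.Re (z^* * pser g z) <= K * (1 - normc z ^+ 2).

Let decay (q : R) t : is_derive t 1 (fun t => q * expR (- (2 * K) * t)) (q * (- (2 * K) * expR (- (2 * K) * t))).
Proof. exact: (is_deriveZ q (is_derive_expRM (- (2 * K)) t)). Qed.

(** Where 1 - |u|^2 lies below q exp (-2 K t), their difference has a nonnegative derivative, so it
    never becomes negative. The [Num.max] admits fields extended by 0 outside the disc. *)
Let escape (F : C -> C) u T : 0 <= T -> normc (u 0) <= 1 ->
  (forall z, complex.Re (z^* * F z) <= K * Num.max (1 - normc z ^+ 2) 0) ->
  (forall t, 0 <= t <= T -> cderiv u t (F (u t))) ->
  (1 - normc (u 0) ^+ 2) * expR (- (2 * K) * T) <= 1 - normc (u T) ^+ 2.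
Proof.
move=> T0 u0 hF hu; set q := 1 - normc (u 0) ^+ 2.
have q0 : 0 <= q by rewrite subr_ge0 exprn_ile1// normc_ge0.
have := @stays_nonneg R (fun t => (1 - normc (u t) ^+ 2) - q * expR (- (2 * K) * t))
  (fun t => (0 - 2 * complex.Re ((u t)^* * F (u t))) - q * (- (2 * K) * expR (- (2 * K) * t))) T T0.
rewrite mulr0 expR0 mulr1 subrr => h; rewrite -subr_ge0; apply: h => //.
  move=> t tT; exact: (is_deriveB (is_deriveB (is_derive_cst (1 : R) t 1) (is_derive_sqr_normc (hu t tT))) (decay q t)).
move=> t tT; set e := expR _; have e0 : 0 < e by exact: expR_gt0.
move=> hm; have := hF (u t).
have : Num.max (1 - normc (u t) ^+ 2) 0 <= q * e.
  by rewrite ge_max mulr_ge0 ?(ltW e0)// andbT; lra.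
move: (Num.max _ _) (complex.Re _) => a b ae bK; have := ler_wpM2l K0 ae; lra.
Qed.

Lemma flow_line_escape u T : 0 <= T -> flow_line g u T ->
  (1 - normc (u 0) ^+ 2) * expR (- (2 * K) * T) <= 1 - normc (u T) ^+ 2.
Proof.
move=> T0 hu; pose F z := if normc z < 1 then pser g z else 0.
apply: (@escape F) => //.
- by have [/disc_normc/ltW] := hu 0 (andb_true_intro (conj (lexx 0) T0)).
- move=> z; rewrite /F; case: ifPn => z1.
    apply: (le_trans (inward ((disc_normc z).2 z1))); apply: ler_wpM2l => //.
    by rewrite le_max lexx.
  by rewrite mulr0 mulr_ge0// le_max lexx orbT.
- by move=> t /hu[/disc_normc ut hut]; rewrite /F ut.
Qed.

(** Provides one Lipschitz constant of G for all flow lines from z up to time T. *)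
Lemma flow_line_radius (z : C) T : disc z -> 0 <= T -> exists2 r : R, 0 < r < 1 &
  forall u, flow_line g u T -> u 0 = z -> forall t, 0 <= t <= T -> normc (u t) <= r.
Proof.
move=> /disc_normc z1 T0; set q := (1 - normc z ^+ 2).
have q0 : 0 < q by have := normc_ge0 z; rewrite /q; nra.
have q1 : q <= 1 by rewrite /q gerBl sqr_ge0.
set d := q * expR (- (2 * K) * T).
have d0 : 0 < d by rewrite mulr_gt0// expR_gt0.
have d1 : d <= 1.
  rewrite -(mulr1 1); apply: ler_pM => //; rewrite ?(ltW q0) ?expR_ge0// -expR0 ler_expR mulNr oppr_le0.
  by rewrite !mulr_ge0.
(* The maximum keeps r positive when d = 1. *)
pose r := Num.max 2^-1 (Num.sqrt (1 - d)).
have s1 : Num.sqrt (1 - d) < 1.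
  by rewrite -[X in _ < X]sqrtr1 ltr_sqrt// ltrBlDr ltrDl.
exists r; first by rewrite lt_max invr_gt0 ltr0n/= gt_max s1 andbT; lra.
move=> u hu u0 t /andP[t0 tT].
have ht : flow_line g u t by move=> s /andP[s0 st]; apply: hu; rewrite s0 (le_trans st).
have := flow_line_escape t0 ht; rewrite u0 -/q => h.
rewrite le_max; apply/orP; right.
rewrite -(ger0_norm (normc_ge0 (u t))) -sqrtr_sqr ler_wsqrtr//.
have : d <= q * expR (- (2 * K) * t).
  apply: ler_wpM2l; first exact: ltW.
  by rewrite ler_expR !mulNr lerN2 ler_wpM2l// mulr_ge0.
lra.
Qed.

Lemma flow_line_unique u v T : 0 <= T -> flow_line g u T -> flow_line g v T -> u 0 = v 0 ->
  forall t, 0 <= t <= T -> u t = v t.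
Proof.
move=> T0 hu hv uv t /andP[t0 tT].
have [zD _] : disc (u 0) /\ cderiv u 0 (pser g (u 0)) by apply: hu; rewrite lexx.
have [r r01 hr] := flow_line_radius zD T0.
have [L L0 hL] := pser_diff hg r01.
have tT' s : 0 <= s <= t -> 0 <= s <= T by move=> /andP[-> st]; rewrite (le_trans st).
have := @gronwall R (fun s => normc (u s - v s) ^+ 2)
  (fun s => 2 * complex.Re ((u s - v s)^* * (pser g (u s) - pser g (v s)))) (2 * L) t t0.
rewrite uv subrr normc0 expr0n mulr0 => h.
have : normc (u t - v t) ^+ 2 <= 0.
  apply: h => s /tT' sT.
    have [_ us] := hu s sT; have [_ vs] := hv s sT.
    exact: (is_derive_sqr_normc (cderivB us vs)).
  have [h1 _] := hL (u s) (v s) (hr u hu erefl s sT) (hr v hv (esym uv) s sT).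
  apply: (@le_trans _ _ (2 * (normc (u s - v s) * normc (pser g (u s) - pser g (v s))))).
    by apply: ler_wpM2l => //; apply: le_trans (Re_le _) _; rewrite normcM normc_conj.
  by have := normc_ge0 (u s - v s); nra.
rewrite le_eqVlt ltNge sqr_ge0 orbF sqrf_eq0 => /eqP/eq0_normc/eqP.
by rewrite subr_eq0 => /eqP.
Qed.

(* The field is cut off near the unit circle, which makes it globally Lipschitz; the cutoff
   is nonnegative, so that the field still points inward. *)
Lemma flow_line_exists z T : disc z -> 0 <= T -> exists2 u, u 0 = z & flow_line g u T.
Proof.
move=> zD T0; have [/= zn z1] := (normc_ge0 z, (disc_normc z).1 zD).
set q := (1 - normc z ^+ 2).
have q0 : 0 < q by rewrite /q; nra.
have q1 : q <= 1 by rewrite /q gerBl sqr_ge0.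
set d := q * expR (- (2 * K) * T).
have d0 : 0 < d by rewrite mulr_gt0// expR_gt0.
pose r := Num.sqrt (1 - d).
have r1 : r < 1 by rewrite -[X in _ < X]sqrtr1 ltr_sqrt// ltrBlDr ltrDl.
have r0 : 0 <= r by exact: sqrtr_ge0.
(* The cutoff equals 1 for |w| <= r, which the solution does not leave before time T, and 0 for |w|
   >= s. *)
pose s := (1 + r) / 2.
have rs : r < s by rewrite /s; lra.
have s01 : 0 < s < 1 by rewrite /s; lra.
have [s0 s1] := andP s01.
have [L L0 hL] := pser_diff hg s01.
pose B := normc (g 0%N) + L * s.
have B0 : 0 <= B by rewrite addr_ge0 ?normc_ge0// mulr_ge0// ltW.
have hB w : normc w <= s -> normc (pser g w) <= B.
  move=> ws; have n0 : normc (0 : C) <= s by rewrite normc0 ltW.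
  have [h _] := hL w 0 ws n0; rewrite pser0 subr0 in h.
  have := le_distcB (pser g w) (g 0%N); have := ler_wpM2l L0 ws; rewrite /B; lra.
pose x w := (s - normc w) / (s - r).
pose chi w := Num.max 0 (Num.min 1 (x w)).
have chi01 w : 0 <= chi w <= 1.
  by rewrite /chi le_max lexx/= ge_max ler01 ge_min lexx.
have sr0 : 0 < s - r by rewrite subr_gt0.
have chi_lip w1 w2 : `|chi w1 - chi w2| <= (s - r)^-1 * normc (w1 - w2).
  have h1 : `|x w1 - x w2| <= (s - r)^-1 * normc (w1 - w2).
    rewrite /x -mulrBl normrM normfV (gtr0_norm sr0) mulrC; apply: ler_wpM2l.
      by rewrite invr_ge0 ltW.
    have := le_distcB w1 w2; have := le_distcB w2 w1; rewrite (distcC w2).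
    by rewrite ler_norml => ? ?; apply/andP; split; lra.
  by apply: le_trans h1; apply: le_trans (max_lipschitz _ _ _) _; exact: min_lipschitz.
have chi0 w : s <= normc w -> chi w = 0.
  move=> sw; rewrite /chi; apply/max_idPl; rewrite ge_min; apply/orP; right.
  by rewrite /x pmulr_lle0 ?invr_gt0// subr_le0.
have chi1 w : normc w <= r -> chi w = 1.
  move=> wr; have : 1 <= x w by rewrite /x ler_pdivlMr// mul1r lerD2l lerN2.
  by rewrite /chi => /min_idPl ->; apply/max_idPr.
pose F w := if normc w < s then (chi w)%:C * pser g w else 0.
have FB w : normc (F w) <= B.
  rewrite /F; case: ifPn => ws; last by rewrite normc0.
  rewrite normcM normc_real; have /andP[c0 c1] := chi01 w; rewrite (ger0_norm c0).
  by have := hB w (ltW ws); have := normc_ge0 (pser g w); nra.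
pose M := L + B / (s - r) + 1.
have BM : 0 <= B / (s - r) by rewrite divr_ge0// ltW.
have key w1 w2 : normc w1 < s -> normc (F w1 - F w2) <= M * normc (w1 - w2).
  move=> h1; have n12 := normc_ge0 (w1 - w2); have cl := chi_lip w1 w2.
  have b1 := hB w1 (ltW h1); have p0 := normc_ge0 (pser g w1).
  rewrite /F h1; case: ifPn => h2.
    have -> : (chi w1)%:C * pser g w1 - (chi w2)%:C * pser g w2 =
        (chi w1 - chi w2)%:C * pser g w1 + (chi w2)%:C * (pser g w1 - pser g w2).
      by rewrite rmorphB mulrBl mulrBr addrA subrK.
    apply: le_trans (le_normcD _ _) _; rewrite !normcM !normc_real.
    have [hl _] := hL w1 w2 (ltW h1) (ltW h2).
    have /andP[c0 c1] := chi01 w2; rewrite (ger0_norm c0).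
    apply: (@le_trans _ _ ((s - r)^-1 * normc (w1 - w2) * B + 1 * (L * normc (w1 - w2)))).
      by apply: lerD; apply: ler_pM => //; exact: normc_ge0.
    by rewrite /M; move: (s - r)^-1 => k; lra.
  rewrite subr0 normcM normc_real.
  rewrite -leNgt in h2; rewrite (chi0 w2 h2) subr0 in cl.
  apply: (@le_trans _ _ ((s - r)^-1 * normc (w1 - w2) * B)).
    by apply: ler_pM.
  by rewrite /M; have := mulr_ge0 L0 n12; move: (s - r)^-1 => k; lra.
have FL w1 w2 : normc (F w1 - F w2) <= M * normc (w1 - w2).
  have [h1|h1] := ltP (normc w1) s; first exact: key.
  have [h2|h2] := ltP (normc w2) s; first by rewrite (distcC (F w1)) (distcC w1); exact: key.
  have F0 w' : s <= normc w' -> F w' = 0 by move=> h; rewrite /F ifN// -leNgt.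
  rewrite (F0 _ h1) (F0 _ h2) subrr normc0 mulr_ge0 ?normc_ge0//.
  by rewrite /M; lra.
have M1 : 1 <= M by rewrite /M; lra.
have [u u0 hu] := lipschitz_ode z M1 B0 FB FL.
exists u => // t /andP[t0 tT].
have hF w : complex.Re (w^* * F w) <= K * Num.max (1 - normc w ^+ 2) 0.
  rewrite /F; case: ifPn => ws; last by rewrite mulr0 mulr_ge0// le_max lexx orbT.
  have wD : disc w by apply/disc_normc; exact: lt_trans s1.
  rewrite mulrCA ReM_real; have /andP[c0 c1] := chi01 w.
  have := inward wD; have : 1 - normc w ^+ 2 <= Num.max (1 - normc w ^+ 2) 0 by rewrite le_max lexx.
  have : 0 <= 1 - normc w ^+ 2.
    by have /disc_normc := wD; have := normc_ge0 w; nra.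
  move: (complex.Re _) (1 - normc w ^+ 2) => a e e0 eb ae; set b := Num.max e 0 in eb *.
  have : K * e <= K * b by apply: ler_wpM2l.
  have : 0 <= K * e by rewrite mulr_ge0.
  by nra.
have cu' r' : 0 <= r' <= t -> cderiv u r' (F (u r')) by move=> /andP[? _]; exact: hu.
have u01 : normc (u 0) <= 1 by rewrite u0 ltW.
have := escape t0 u01 hF cu'; rewrite u0 -/q => h.
have ur : normc (u t) <= r.
  rewrite -(ger0_norm (normc_ge0 (u t))) -sqrtr_sqr ler_wsqrtr//.
  have : d <= q * expR (- (2 * K) * t).
    apply: ler_wpM2l; first exact: ltW.
    by rewrite ler_expR !mulNr lerN2 ler_wpM2l// mulr_ge0.
  lra.
split; first by apply/disc_normc; exact: le_lt_trans r1.
by have := hu t t0; rewrite /F (le_lt_trans ur rs) (chi1 _ ur) mul1r.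
Qed.

Lemma flow_exists : exists phi : R -> C -> C, forall z, disc z ->
  phi 0 z = z /\ forall T, 0 <= T -> flow_line g (fun t => phi t z) T.
Proof.
have hU (n : nat) : exists U : C -> R -> C, forall z, disc z -> U z 0 = z /\ flow_line g (U z) n%:R.
  have h z : exists u, disc z -> u 0 = z /\ flow_line g u n%:R.
    have [zD|nD] := pselect (disc z); last by exists (fun=> 0).
    by have [u u0 hu] := flow_line_exists zD (ler0n R n); exists u.
  by have [U hU] := choice h; exists U.
have [U UP] := choice hU.
(* The absolute value makes N constant on ]-1, 1[, so the two-sided derivative at 0 is that of a
   single curve. *)
pose N t := (Num.trunc `|t|).+1.
exists (fun t z => U (N t) z t) => z zD; split; first by have [] := UP (N 0) z zD.
have tN t : `|t| < (N t)%:R.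
  by have /andP[] := truncn_itv (normr_ge0 t).
have agree t n : 0 <= t -> t <= n%:R -> U (N t) z t = U n z t.
  move=> t0 tn; have [e1 f1] := UP (N t) z zD; have [e2 f2] := UP n z zD.
  apply: (flow_line_unique t0); rewrite ?e1 ?e2 ?t0 ?lexx//.
    move=> s /andP[s0 st]; apply: f1; rewrite s0/=; apply: (le_trans st).
    by have := tN t; rewrite (ger0_norm t0) => /ltW.
  by move=> s /andP[s0 st]; apply: f2; rewrite s0/=; exact: le_trans tn.
move=> T T0 t /andP[t0 tT]; have [_ f] := UP (N t) z zD.
have [|tD ct] := f t; first by rewrite t0; have := tN t; rewrite (ger0_norm t0) => /ltW.
split => //; apply: cderiv_near ct.
have [t1|t1] := ltP t 1.
  have nt : \forall s \near t, -1 < s < 1.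
    have : t \in `]-1, 1[ by rewrite in_itv/= t1 andbT; lra.
    by move=> /near_in_itvoo; apply: filterS => s; rewrite in_itv.
  apply: filterS nt => s s1; have : (N s = N t)%N.
    have h (x : R) : -1 < x < 1 -> Num.trunc `|x| = 0%N.
      move=> /andP[x1 x2]; apply/eqP; rewrite -leqn0 -ltnS -(@ltr_nat R).
      have /andP[h _] := truncn_itv (normr_ge0 x); apply: le_lt_trans h _.
      by rewrite ltr_norml x1 x2.
    by rewrite /N !h// t1 andbT; lra.
  by move=> ->.
have nt : \forall s \near t, 0 < s < (N t)%:R.
  have : t \in `]0, (N t)%:R[ by rewrite in_itv/=; have := tN t; rewrite ger0_norm// => ->; lra.
  by move=> /near_in_itvoo; apply: filterS => s; rewrite in_itv.
by apply: filterS nt => s /andP[s0 s1]; rewrite (agree s (N t) (ltW s0) (ltW s1)).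
Qed.

(** Uniqueness: as functions of t, both sides are flow lines from the same point phi s z. *)
Lemma flow_semigroup (phi : R -> C -> C) : (forall z, disc z ->
    phi 0 z = z /\ forall T, 0 <= T -> flow_line g (fun t => phi t z) T) ->
  forall s t z, 0 <= s -> 0 <= t -> disc z -> phi (t + s) z = phi t (phi s z).
Proof.
move=> hphi s t z s0 t0 zD; have [p0 pf] := hphi z zD.
have [|sD _] := pf s s0 s; first by rewrite s0 lexx.
have [q0 qf] := hphi _ sD.
apply: (@flow_line_unique (fun r => phi (r + s) z) (fun r => phi r (phi s z)) t) => //.
- move=> r /andP[r0 rt].
  have [|rD cr] := pf (t + s) (addr_ge0 t0 s0) (r + s); first by rewrite addr_ge0//= lerD2r.
  by split => //; exact: (cderiv_shift (u := fun r => phi r z)).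
- exact: qf.
- by rewrite add0r q0.
- by rewrite t0 lexx.
Qed.

End flow.

(** * The Hardy space *)

Section hardy_coef.
Variable R : realType.
Local Notation C := R[i].
Local Notation ss := square_summable.
Implicit Types (f h : H2 R) (z w : C) (c d : nat -> C).

Definition coef f : nat -> C := taylor_coef f.

Definition nrm f : R := l2norm (coef f).

Lemma coef_series f : has_power_series f (coef f).
Proof. by have [] := taylor_coefP (H2_funP f). Qed.

Lemma ss_coef f : ss (coef f).
Proof. by have [] := taylor_coefP (H2_funP f). Qed.

Lemma conv_disc_coef f : conv_disc (coef f).
Proof. exact: (square_summable_conv_disc (@ss_coef f)). Qed.

End hardy_coef.
Arguments coef_series {R} f.
Arguments ss_coef {R} f.
Arguments conv_disc_coef {R} f.

Section hardy_bridge.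
Variable R : realType.
Local Notation C := R[i].
Local Notation ss := square_summable.
Implicit Types (f h : H2 R) (z w : C) (c d : nat -> C).

Lemma H2E f z : disc z -> f z = pser (coef f) z.
Proof. by move=> zD; rewrite (has_power_series_pser (coef_series f) zD). Qed.

Lemma H2_off f z : ~ disc z -> f z = 0.
Proof. by have /set_mem[h _] := H2_funP f; exact: h. Qed.

Lemma H2_ext f h : (forall z, disc z -> f z = h z) -> f = h.
Proof.
move=> e; apply/val_inj/funext => z /=.
by have [/e//|zD] := pselect (disc z); rewrite !H2_off.
Qed.

Lemma coef_unique f c : ss c -> has_power_series f c -> coef f = c.
Proof. by move=> sc fc; rewrite /coef (taylor_coefE fc sc). Qed.

Lemma H2_norm_val f : `|f| = (nrm f)%:C. Proof. by []. Qed.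

Lemma coefD f h n : coef (f + h) n = coef f n + coef h n.
Proof.
rewrite (coef_unique (square_summableD (ss_coef f) (ss_coef h)))//.
exact: (has_power_seriesD (coef_series f) (coef_series h)).
Qed.

Lemma coefZ (a : C) f n : coef (a *: f) n = a * coef f n.
Proof.
rewrite (coef_unique (square_summableZ (a := a) (ss_coef f)))//.
exact: (has_power_seriesZ (a := a) (coef_series f)).
Qed.

Lemma coefB f h n : coef (f - h) n = coef f n - coef h n.
Proof. by rewrite coefD -scaleN1r coefZ mulN1r. Qed.

Lemma nrm_ge0 f : 0 <= nrm f. Proof. exact: l2norm_ge0. Qed.

Lemma nrmD f h : nrm (f + h) <= nrm f + nrm h.
Proof.
have := l2normD (ss_coef f) (ss_coef h); rewrite /nrm.
by rewrite (_ : coef (f + h) = fun n => coef f n + coef h n)//; apply/funext => n; rewrite coefD.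
Qed.

Lemma nrmZ (a : C) f : nrm (a *: f) = normc a * nrm f.
Proof.
rewrite -(l2normZ a (ss_coef f)) /nrm; congr l2norm.
by apply/funext => n; rewrite coefZ.
Qed.

Lemma nrmN f : nrm (- f) = nrm f.
Proof. by rewrite -scaleN1r nrmZ normcN normc1 mul1r. Qed.

Lemma nrmB f h : nrm (f - h) = nrm (h - f).
Proof. by rewrite -nrmN opprB. Qed.

Lemma H2_of_coef c : ss c -> exists f : H2 R, coef f = c.
Proof.
move=> sc; pose F z := if normc z < 1 then pser c z else 0.
have Fc : has_power_series F c.
  move=> z zD; rewrite /F (disc_normc z).1//.
  exact: pser_cvg (square_summable_conv_disc sc) _ zD.
have hF : F \in @hardy R.
  apply/mem_set; split; last by exists c.
  by move=> z /disc_normc/negP; rewrite /F => /negbTE ->.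
by exists (MkH2 hF); apply: coef_unique.
Qed.

Lemma cvg_H2P (T : Type) (F : set_system T) (FF : Filter F) (u : T -> H2 R) (l : H2 R) :
  (u x @[x --> F] --> l) <-> (nrm (u x - l) @[x --> F] --> (0 : R)).
Proof.
split=> h.
  apply/cvgrPdist_lt => e e0.
  have e0' : 0 < (e%:C : C) by rewrite ltcR.
  move/cvgrPdist_lt : h => /(_ _ e0'); apply: filterS => x.
  by rewrite H2_norm_val ltcR sub0r normrN nrmB ger0_norm ?nrm_ge0.
apply/cvgrPdist_lt => e e0.
have eE : e = (complex.Re e)%:C.
  by case: e e0 => a b; rewrite ltcE/= => /andP[/eqP -> _].
have e0' : 0 < complex.Re e by move: e0; rewrite ltcE/= => /andP[].
move/cvgrPdist_lt : h => /(_ _ e0'); apply: filterS => x.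
by rewrite eE H2_norm_val ltcR sub0r normrN nrmB ger0_norm ?nrm_ge0.
Qed.

Lemma dot_H2_kv f s : in_disc s -> dot (coef f) (kv s) = evs f s.
Proof.
move=> sD; rewrite (dot_kv (ss_coef f) sD) /evs !big_seq; apply: eq_bigr => p ps.
by rewrite H2E//; exact: sD.
Qed.

Lemma evs_le f s : in_disc s -> evs f s <= nrm f * l2norm (kv s).
Proof. by move=> sD; rewrite -dot_H2_kv//; exact: (dot_le (ss_coef f) (ss_kv sD)). Qed.

(** The Riesz representative has norm at most M and the same values on the disc as f, hence the same
    coefficients. *)
Lemma dual_norm f (M : R) : 0 <= M ->
  (forall s, in_disc s -> evs f s <= M * l2norm (kv s)) -> nrm f <= M.
Proof.
move=> M0 h; have [c [sc cM hc]] := rkhs_criterion M0 h.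
rewrite /nrm (coef_unique sc)// => z zD; rewrite hc//.
exact: pser_cvg (square_summable_conv_disc sc) _ zD.
Qed.

Lemma l2norm_kernel z : disc z -> l2norm (fun n => z^* ^+ n) ^+ 2 = (1 - normc z ^+ 2)^-1.
Proof.
move=> zD; have gz := geo_expr zD; have sz := geo_ss gz.
have e : (fun n => z^* ^+ n) = (fun n => 1 * z^* ^+ n) by apply/funext => n; rewrite mul1r.
rewrite -dot_sqr// {2}e dot_kernel// (_ : (1 : C)^* = 1) ?rmorph1// mul1r pser_kernel//.
have -> : 1 - z^* * z = (1 - normc z ^+ 2)%:C.
  rewrite rmorphB rmorph1; congr (_ - _); rewrite conjE sqr_normcE; case: (z) => a b.
  by apply/eqP; rewrite eq_complex/=; apply/andP; split; apply/eqP; ring.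
by rewrite -realcV.
Qed.

Lemma normc_H2_le f z : disc z -> normc (f z) <= nrm f * l2norm (fun n => z^* ^+ n).
Proof.
move=> zD; rewrite H2E//; have [k k1 <-] := unimodular_Re (pser (coef f) z).
rewrite -[k]conjCK -dot_kernel//; last exact: ss_coef.
apply: (le_trans (dot_le (ss_coef f) (geo_ss (geo_kernel k^* zD)))).
by rewrite (l2normZ k^* (geo_ss (geo_expr zD))) normc_conj k1 mul1r.
Qed.

Lemma H2_cvg_eval (T : Type) (F : set_system T) (FF : Filter F) (u : T -> H2 R) (l : H2 R) z :
  disc z -> u x @[x --> F] --> l -> u x z @[x --> F] --> l z.
Proof.
move=> zD /cvg_H2P h.
have h0 : nrm (u x - l) * l2norm (fun n => z^* ^+ n) @[x --> F] --> 0 * l2norm (fun n => z^* ^+ n).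
  by apply: cvgM => //; exact: cvg_cst.
rewrite mul0r in h0; apply: (cvg_normc0_le _ h0); apply: nearW => x.
exact: (normc_H2_le (u x - l) zD).
Qed.

Lemma derive1_H2 f z : disc z -> derive1 f z = pser (deriv (coef f)) z.
Proof. by move=> zD; exact: (derive1_power_series (conv_disc_coef f) (coef_series f) zD). Qed.

Lemma opA_val (G f : H2 R) : opA_dom G f -> forall z, opA G f z = G z * derive1 f z.
Proof. by move=> fD z; rewrite /opA -[H2_fun _]/(val _) insubdK. Qed.

Lemma opA_dom_ex (G f h : H2 R) :
  (forall z, disc z -> G z * derive1 f z = h z) -> opA_dom G f /\ opA G f = h.
Proof.
move=> e; have E : (G : C -> C) \* derive1 f = h.
  apply/funext => z /=; have [/e//|zD] := pselect (disc z).
  by rewrite !H2_off// mul0r.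
have D : opA_dom G f by rewrite /opA_dom /= E H2_funP.
split => //; apply: H2_ext => z zD; by rewrite opA_val// e.
Qed.

End hardy_bridge.

(** * Kernel combinations moved by the flow *)

Section kernel_flow.
Variable R : realType.
Local Notation C := R[i].
Implicit Types (s : seq (C * C)) (z w : C).

Lemma pser_deriv_kv s z : in_disc s -> disc z ->
  pser (deriv (kv s)) z = \sum_(p <- s) p.1 * (p.2^* * (1 - p.2^* * z)^-1 ^+ 2).
Proof.
move=> + zD; elim: s => [_|p s IH /in_disc_cons[pD sD]].
  rewrite big_nil; apply: csum_unique; rewrite (_ : series _ = cst 0); first exact: cvg_cst.
  by apply/funext => N; rewrite /series/= big1// => n _; rewrite /deriv /kv big_nil mulr0 mul0r.
have gk := conv_disc_deriv (geo_conv_disc (geo_expr pD)).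
have gs := conv_disc_deriv (geo_conv_disc (geo_kv sD)).
rewrite big_cons -IH// -pser_deriv_kernel// -pserZ// -pserD//; last exact: conv_discZ.
congr pser; apply/funext => n; rewrite /deriv /kv big_cons; ring.
Qed.

Lemma cderiv_sum_seq (I : eqType) (r : seq I) (u : I -> R -> C) (l : I -> C) t :
  (forall i, i \in r -> cderiv (u i) t (l i)) ->
  cderiv (fun x : R => \sum_(i <- r) u i x) t (\sum_(i <- r) l i).
Proof.
elim: r => [_|i r IH h].
  by apply: (cderiv_ext (cderiv_cst 0 t)); rewrite ?big_nil//; apply/funext => x; rewrite big_nil.
have hi : cderiv (u i) t (l i) by apply: h; rewrite inE eqxx.
have hr : cderiv (fun x : R => \sum_(j <- r) u j x) t (\sum_(j <- r) l j).
  by apply: IH => j jr; apply: h; rewrite inE jr orbT.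
by apply: (cderiv_ext (cderivD hi hr)); rewrite ?big_cons//; apply/funext => x; rewrite big_cons.
Qed.

(** Only the points move: the adjoint of composition with phi sends k_z to k_(phi z) and is
    linear. *)
Definition push (phi : C -> C) s : seq (C * C) := [seq (p.1, phi p.2) | p <- s].

Lemma evs_push F phi s : evs F (push phi s) = evs (F \o phi) s.
Proof. by rewrite /evs big_map. Qed.

Lemma in_disc_push phi s : (forall z, disc z -> disc (phi z)) -> in_disc s -> in_disc (push phi s).
Proof. by move=> h sD p /mapP[q qs ->]; apply: h; exact: sD. Qed.

(** Expresses the squared norm as a finite sum of rational functions of the points and their
    conjugates, which can be differentiated along the flow. *)
Lemma gram_kv s : in_disc s ->
  l2norm (kv s) ^+ 2 = complex.Re (\sum_(q <- s) \sum_(p <- s) q.1^* * (p.1 * (1 - p.2^* * q.2)^-1)).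
Proof.
move=> sD; rewrite -(dot_sqr (ss_kv sD)) evs_kv// /evs Re_sum !big_seq; apply: eq_bigr => q qs.
by rewrite pser_kv//; [rewrite big_distrr|exact: sD].
Qed.

Variables (g : nat -> C) (phi : R -> C -> C).
Hypotheses (hg : conv_disc g) (Hg : toeplitz_dissipative g).
Hypothesis phi0 : forall z, disc z -> phi 0 z = z.
Hypothesis flow_phi : forall z, disc z -> forall T, 0 <= T -> flow_line g (fun t => phi t z) T.

Lemma flow_disc t z : 0 <= t -> disc z -> disc (phi t z).
Proof. by move=> t0 zD; have [|] := flow_phi zD t0 (t := t); rewrite ?t0 ?lexx. Qed.

Lemma flow_cderiv t z : 0 <= t -> disc z -> cderiv (fun r => phi r z) t (pser g (phi t z)).
Proof. by move=> t0 zD; have [|] := flow_phi zD t0 (t := t); rewrite ?t0 ?lexx. Qed.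

(* Gronwall: the time derivative of the squared norm of the moving kernel combination h is
   [2 Re <G h', h>]. *)
Lemma kernel_flow_le s t : in_disc s -> 0 <= t ->
  l2norm (kv (push (phi t) s)) <= expR (normc (g 0%N) * t) * l2norm (kv s).
Proof.
move=> sD t0; set K := normc (g 0%N).
have D r : 0 <= r -> in_disc (push (phi r) s).
  by move=> r0; apply: in_disc_push => // z zD; exact: flow_disc.
pose N r := l2norm (kv (push (phi r) s)) ^+ 2.
pose k r (p q : C * C) := (1 - (phi r p.2)^* * phi r q.2)^-1.
pose Gp r (p : C * C) := pser g (phi r p.2).
pose E r := \sum_(q <- s) \sum_(p <- s) q.1^* * (p.1 * k r p q).
pose E' r := \sum_(q <- s) \sum_(p <- s)
   q.1^* * (p.1 * (((Gp r p)^* * phi r q.2 + (phi r p.2)^* * Gp r q) * k r p q ^+ 2)).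
have NE r : 0 <= r -> N r = complex.Re (E r).
  move=> r0; rewrite /N gram_kv; last exact: D.
  by congr complex.Re; rewrite /push big_map; apply: eq_bigr => q _; rewrite big_map.
have dE r : 0 <= r -> cderiv E r (E' r).
  move=> r0; apply: cderiv_sum_seq => q qs; apply: cderiv_sum_seq => p ps.
  apply: cderivZ; apply: cderivZ.
  have pd := flow_cderiv r0 (sD p ps); have qd := flow_cderiv r0 (sD q qs).
  have n0 := kernel_neq0 (flow_disc r0 (sD p ps)) (flow_disc r0 (sD q qs)).
  have h := cderivV (u := fun r => 1 - (phi r p.2)^* * phi r q.2) n0
    (cderivB (cderiv_cst 1 r) (cderivM (cderiv_conj pd) qd)).
  apply: (cderiv_ext h) => //; rewrite sub0r opprK exprVn; congr (_ * _).
have E'E r : 0 <= r -> complex.Re (E' r) = 2 * evs (fun z => pser g z * pser (deriv (kv (push (phi r) s))) z) (push (phi r) s).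
  move=> r0; rewrite evs_push /evs.
  (* Differentiating a kernel gives two terms, one per moving point. Conjugation exchanges p and q,
     so both double sums have the same real part; hence the factor 2. *)
  pose A q p := complex.Re (q.1^* * (p.1 * ((phi r p.2)^* * Gp r q * k r p q ^+ 2))).
  have -> : complex.Re (E' r) = \sum_(q <- s) \sum_(p <- s) (A p q + A q p).
    rewrite /E' Re_sum; apply: eq_bigr => q _; rewrite Re_sum; apply: eq_bigr => p _.
    rewrite mulrDl !mulrDr ReD; congr (_ + _); rewrite /A -Re_conj; congr complex.Re.
    have -> : k r q p = (k r p q)^*.
      by rewrite /k conjV conjB conj1 conjM conjCK mulrC.
    rewrite !conjM !conjCK; ring.
  have -> : \sum_(q <- s) \sum_(p <- s) (A p q + A q p) = 2 * \sum_(q <- s) \sum_(p <- s) A q p.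
    under eq_bigr do rewrite big_split/=.
    rewrite big_split/= [X in X + _]exchange_big/=; lra.
  congr (2 * _); rewrite !big_seq; apply: eq_bigr => q qs /=.
  rewrite pser_deriv_kv; [|exact: D|exact: flow_disc (sD q qs)].
  rewrite /push big_map !big_distrr/= Re_sum; apply: eq_bigr => p _; rewrite /A /Gp /k/=.
  by congr complex.Re; ring.
have key : N t <= expR (2 * K * t) * N 0.
  have := @gronwall R (fun r => complex.Re (E r)) (fun r => complex.Re (E' r)) (2 * K) t t0.
  rewrite !NE//; apply.
    by move=> r /andP[r0 _]; exact: (cderiv_Re (dE r r0)).
  move=> r /andP[r0 _]; rewrite E'E// -NE// -mulrA; apply: ler_wpM2l => //.
  exact: (toeplitz_dissipative_evs Hg hg (D r r0)).
have N0 : N 0 = l2norm (kv s) ^+ 2.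
  congr (l2norm (kv _) ^+ 2); rewrite /push -[RHS]map_id; apply/eq_in_map => p ps.
  by rewrite phi0; [case: p ps|exact: sD].
rewrite -(@ler_pXn2r _ 2)// ?nnegrE ?l2norm_ge0 ?mulr_ge0 ?expR_ge0 ?l2norm_ge0//.
by rewrite exprMn -N0 [expR _ ^+ 2]expr2 -expRD (_ : K * t + K * t = 2 * K * t)//; ring.
Qed.

(** Duality: evaluating f o phi_t on a kernel combination is evaluating f on the pushed one, whose
    norm [kernel_flow_le] controls. *)
Lemma composition_bound (f : H2 R) t : 0 <= t -> exists h : H2 R,
  nrm h <= expR (normc (g 0%N) * t) * nrm f /\ forall z, disc z -> h z = f (phi t z).
Proof.
move=> t0.
have M0 : 0 <= expR (normc (g 0%N) * t) * nrm f by rewrite mulr_ge0 ?expR_ge0 ?nrm_ge0.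
have [|c [sc cM hc]] := @rkhs_criterion R (f \o phi t) _ M0.
  move=> s sD; have pD : in_disc (push (phi t) s).
    by apply: in_disc_push => // z zD; exact: flow_disc.
  rewrite -evs_push; apply: (le_trans (evs_le f pD)).
  rewrite [X in _ <= X * _]mulrC -mulrA; apply: ler_wpM2l; first exact: nrm_ge0.
  exact: kernel_flow_le.
have [h hE] := H2_of_coef sc; exists h; rewrite /nrm hE; split => // z zD.
by rewrite H2E// hE -hc.
Qed.

End kernel_flow.

(** * Truncations and polynomials *)

Section truncation.
Variable R : realType.
Local Notation C := R[i].
Local Notation ss := square_summable.
Implicit Types (c d g : nat -> C) (f G : H2 R).

Definition trunc c N n : C := if (n < N)%N then c n else 0.

Lemma trunc_partial c N M : ss c ->
  \sum_(0 <= n < M) normc (c n - trunc c N n) ^+ 2 <=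
  l2norm c ^+ 2 - \sum_(0 <= n < N) normc (c n) ^+ 2.
Proof.
move=> sc; rewrite lerBrDr; apply: le_trans (ss_partial (N + M) sc).
rewrite [leRHS](big_cat_nat (n := N))//= ?leq_addr// [leLHS]addrC lerD2l.
have [MN|NM] := leqP M N.
  rewrite big_nat big1; first by apply: sumr_ge0 => n _; exact: sqr_ge0.
  by move=> n /andP[_ nM]; rewrite /trunc (leq_trans nM MN) subrr normc0 expr0n.
rewrite (big_cat_nat (n := N))//= ?(ltnW NM)// big_nat big1 ?add0r; last first.
  by move=> n /andP[_ nN]; rewrite /trunc nN subrr normc0 expr0n.
rewrite [leRHS](big_cat_nat (n := M))//= ?(ltnW NM) ?leq_addl//.
rewrite -[leLHS]addr0; apply: lerD; last by apply: sumr_ge0 => n _; exact: sqr_ge0.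
rewrite !big_nat; apply: ler_sum => n /andP[Nn _].
by rewrite /trunc ltnNge Nn subr0.
Qed.

Lemma ss_partial_cvg c : ss c ->
  \sum_(0 <= n < N) normc (c n) ^+ 2 @[N --> \oo] --> l2norm c ^+ 2.
Proof. by move=> sc; rewrite l2norm_sqr//; exact: sc. Qed.

Lemma trunc_cvg c : ss c -> l2norm (fun n => c n - trunc c N n) @[N --> \oo] --> (0 : R).
Proof.
move=> sc; pose S N := l2norm c ^+ 2 - \sum_(0 <= n < N) normc (c n) ^+ 2.
have S0 : S N @[N --> \oo] --> (0 : R).
  have h : S N @[N --> \oo] --> l2norm c ^+ 2 - l2norm c ^+ 2.
    by exact: (cvgB (cvg_cst _) (ss_partial_cvg sc)).
  by apply: (cvg_conv h) => //; rewrite subrr.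
have l0 : Num.sqrt (S N) @[N --> \oo] --> (0 : R).
  have h : Num.sqrt (S N) @[N --> \oo] --> Num.sqrt (0 : R).
    by exact: (cvg_comp _ _ S0 (@sqrt_continuous R 0)).
  by apply: (cvg_conv h) => //; rewrite sqrtr0.
apply: (squeeze_cvgr _ (cvg_cst 0) l0); apply: nearW => N.
rewrite l2norm_ge0/=; have h0 : 0 <= S N by rewrite subr_ge0 ss_partial.
have [] := @ss_partial_le R (fun n => c n - trunc c N n) (Num.sqrt (S N)) _ (sqrtr_ge0 _); last by [].
by move=> M; rewrite sqr_sqrtr//; exact: trunc_partial.
Qed.

Lemma ss_fin c N : (forall n, (N <= n)%N -> c n = 0) -> ss c.
Proof.
move=> h; pose M := \sum_(0 <= n < N) normc (c n) ^+ 2.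
have M0 : 0 <= M by apply: sumr_ge0 => n _; exact: sqr_ge0.
apply: (proj1 (@ss_partial_le R c (Num.sqrt M) _ (sqrtr_ge0 _))) => K.
 rewrite sqr_sqrtr//; have [KN|NK] := leqP K N.
  rewrite /M [leRHS](big_cat_nat (n := K))//= lerDl; apply: sumr_ge0 => n _; exact: sqr_ge0.
have z : \sum_(N <= n < K) normc (c n) ^+ 2 = 0.
  by rewrite big_nat big1// => n /andP[Nn _]; rewrite h// normc0 expr0n.
by rewrite (big_cat_nat (n := N))//= ?(ltnW NK)// z addr0.
Qed.

Lemma ss_trunc c N : ss (trunc c N).
Proof. by apply: (ss_fin (N := N)) => n Nn; rewrite /trunc ltnNge Nn. Qed.

Lemma ss_shift1 c : ss c -> ss (fun n => if n is m.+1 then c m else 0).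
Proof.
move=> sc; apply: (proj1 (@ss_partial_le R (fun n => if n is m.+1 then c m else 0) (l2norm c) _ (l2norm_ge0 _))).
case=> [|K]; first by rewrite big_nil sqr_ge0.
have z : normc (0 : C) ^+ 2 = 0 by rewrite normc0 expr0n.
by rewrite big_nat_recl// z add0r; exact: ss_partial.
Qed.

Lemma ss_shift c k : ss c -> ss (fun n => if (k <= n)%N then c (n - k)%N else 0).
Proof.
move=> sc; elim: k => [|k IH].
  by move: sc; congr ss; apply/funext => n; rewrite subn0.
have := ss_shift1 IH; congr ss; apply/funext => -[|n] //=.
Qed.

Lemma ss_sum (I : Type) (r : seq I) (c : I -> nat -> C) :
  (forall i, ss (c i)) -> ss (fun n => \sum_(i <- r) c i n).
Proof.
move=> h; elim: r => [|i r IH].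
  rewrite (_ : (fun n => _) = fun=> 0); first exact: square_summable0.
  by apply/funext => n; rewrite big_nil.
have := square_summableD (h i) IH; congr ss; apply/funext => n.
by rewrite big_cons.
Qed.

(** Multiplying by a polynomial gives a finite combination of shifts of g. *)
Lemma ss_conv_fin g d N : ss g -> (forall n, (N <= n)%N -> d n = 0) -> ss (conv g d).
Proof.
move=> sg hd.
have := @ss_sum _ (index_iota 0 N) (fun k n => d k * (if (k <= n)%N then g (n - k)%N else 0))
  (fun k => square_summableZ (a := d k) (ss_shift (k := k) sg)).
congr ss; apply/funext => n; rewrite /conv.
have e1 : \sum_(0 <= k < N) d k * (if (k <= n)%N then g (n - k)%N else 0) =
    \sum_(0 <= k < N + n.+1) d k * (if (k <= n)%N then g (n - k)%N else 0).
  have z : \sum_(N <= k < N + n.+1) d k * (if (k <= n)%N then g (n - k)%N else 0) = 0.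
    by rewrite big_nat big1// => k /andP[Nk _]; rewrite hd// mul0r.
  by rewrite [RHS](big_cat_nat (n := N))//= ?leq_addr// z addr0.
have z : \sum_(n.+1 <= k < N + n.+1) d k * (if (k <= n)%N then g (n - k)%N else 0) = 0.
  by rewrite big_nat big1// => k /andP[nk _]; rewrite leqNgt nk mulr0.
rewrite e1 (big_cat_nat (n := n.+1))//= ?leq_addl// z addr0.
by apply: eq_big_nat => k /andP[_ kn]; rewrite -ltnS kn mulrC.
Qed.

(** This is where G in H2 enters: it puts all polynomials into the domain, which yields both its
    density and the test functions for the form. *)
Lemma fin_in_dom G f N : (forall n, (N <= n)%N -> coef f n = 0) ->
  opA_dom G f /\ coef (opA G f) = conv (coef G) (deriv (coef f)).
Proof.
move=> h; have sd : ss (conv (coef G) (deriv (coef f))).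
  apply: (ss_conv_fin (N := N) (ss_coef G)) => n Nn.
  by rewrite /deriv h ?mulr0// leqW.
have [a aE] := H2_of_coef sd.
have [|D e] := @opA_dom_ex R G f a; last by split; [exact: D|rewrite e].
move=> z zD; rewrite derive1_H2// !H2E// aE pser_conv//; first exact: conv_disc_coef.
exact: conv_disc_deriv (conv_disc_coef f).
Qed.

Lemma trunc_dense G f (e : R) : 0 < e -> exists2 h : H2 R, opA_dom G h & nrm (f - h) < e.
Proof.
move=> e0; have /cvgrPdist_lt/(_ e e0)[N _ hN] := trunc_cvg (ss_coef f).
have [h hE] := H2_of_coef (@ss_trunc (coef f) N).
exists h.
  by apply: proj1 (@fin_in_dom G h N _) => n Nn; rewrite hE /trunc ltnNge Nn.
have hh : `|0 - l2norm (fun n => coef f n - trunc (coef f) N n)| < e by exact: hN (leqnn N).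
rewrite sub0r normrN ger0_norm in hh; last exact: l2norm_ge0.
have e1 : coef (f - h) = fun n => coef f n - trunc (coef f) N n.
  by apply/funext => n; rewrite coefB hE.
rewrite /nrm e1; exact: hh.
Qed.

Lemma dense_opA_dom G : dense (opA_dom G).
Proof.
move=> O [f Of] oO.
have /nbhs_ballP[e /= e0 hO] : nbhs f O by exact: open_nbhs_nbhs.
have eE : e = (complex.Re e)%:C.
  by case: e e0 {hO} => a b; rewrite ltcE/= => /andP[/eqP -> _].
have e0' : 0 < complex.Re e by move: e0; rewrite ltcE/= => /andP[].
have [h hD hf] := trunc_dense G f e0'; exists h; split => //.
by apply: hO; rewrite -ball_normE /ball_/= H2_norm_val eE ltcR.
Qed.

End truncation.

Lemma H2_scale_val (R : realType) (a : R[i]) (f : H2 R) z : (a *: f) z = a * f z.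
Proof. reflexivity. Qed.

Lemma H2_sub_val (R : realType) (f h : H2 R) z : (f - h) z = f z - h z.
Proof. reflexivity. Qed.

Lemma diff_quotient_val (R : realType) (T : R -> {linear H2 R -> H2 R}) (f : H2 R) t z :
  diff_quotient T f t z = (t^-1)%:C * (T t f z - f z).
Proof. by rewrite /diff_quotient H2_scale_val H2_sub_val. Qed.

(** * The composition semigroup *)

Section composition_semigroup.
Variable R : realType.
Local Notation C := R[i].
Implicit Types (f x : H2 R) (t h : R) (z : C).
Variables (G : H2 R) (phi : R -> C -> C).
Hypothesis HG : toeplitz_dissipative (coef G).
Hypothesis phi0 : forall z, disc z -> phi 0 z = z.
Hypothesis phi_sg : forall s t z, 0 <= s -> 0 <= t -> disc z -> phi (t + s) z = phi t (phi s z).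
Hypothesis flow_phi : forall z, disc z -> forall T : R, 0 <= T -> flow_line (coef G) (fun t => phi t z) T.

Let K := normc (coef G 0%N).
Let K0 : 0 <= K. Proof. exact: normc_ge0. Qed.

Lemma composition_ops : exists T : R -> {linear H2 R -> H2 R},
  forall t f, 0 <= t -> nrm (T t f) <= expR (K * t) * nrm f /\
    forall z, disc z -> T t f z = f (phi t z).
Proof.
have hT t : exists F : {linear H2 R -> H2 R}, forall f, 0 <= t -> nrm (F f) <= expR (K * t) * nrm f /\
    forall z, disc z -> F f z = f (phi t z).
  have [t0|_] := boolP (0 <= t); last by exists idfun.
  have [F FP] := choice (fun f => composition_bound (conv_disc_coef G) HG phi0 flow_phi f t0).
  have lin : linear F.
    move=> a f1 f2; apply: H2_ext => z zD.
    have [_ e] := FP (a *: f1 + f2); have [_ e1] := FP f1; have [_ e2] := FP f2.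
    rewrite e// -[RHS]/(a * F f1 z + F f2 z) e1// e2//.
  pose L := GRing.isLinear.Build _ _ _ _ F lin.
  pose FL : {linear H2 R -> H2 R} := HB.pack F L.
  by exists FL => f _; exact: FP.
by have [T TP] := choice hT; exists T.
Qed.

Variable T : R -> {linear H2 R -> H2 R}.
Hypothesis T_nrm : forall t f, 0 <= t -> nrm (T t f) <= expR (K * t) * nrm f.
Hypothesis T_val : forall t f z, 0 <= t -> disc z -> T t f z = f (phi t z).

Let phiD t z : 0 <= t -> disc z -> disc (phi t z).
Proof. by move=> t0 zD; exact: (flow_disc flow_phi). Qed.

Let T0 f : T 0 f = f.
Proof. by apply: H2_ext => z zD; rewrite T_val// phi0. Qed.

Let Tsg t s f : 0 <= t -> 0 <= s -> T (t + s) f = T t (T s f).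
Proof.
move=> t0 s0; apply: H2_ext => z zD; rewrite T_val ?addr_ge0// T_val// T_val//; last exact: phiD.
by rewrite addrC phi_sg.
Qed.

Let T_cont t : 0 <= t -> continuous (T t).
Proof.
move=> t0 f; apply/(@cvg_H2P R (H2 R) (nbhs f) _ (T t) (T t f)).
have h : nrm (x - f) @[x --> f] --> (0 : R) by apply/(@cvg_H2P R (H2 R) (nbhs f) _ id f); exact: cvg_id.
have h2 : expR (K * t) * nrm (x - f) @[x --> f] --> (expR (K * t) * 0 : R) by exact: (cvgMr h).
rewrite mulr0 in h2.
apply: (squeeze_cvgr _ (cvg_cst 0) h2); apply: nearW => x.
by rewrite nrm_ge0/= -linearB T_nrm.
Qed.

Let sub_start (a x y k : C) : a - x - k * y = a - k * y - (x - (0 : R)%:C * y).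
Proof. by rewrite rmorph0 mul0r subr0 addrAC. Qed.

(** The estimate behind T_t f - f - t b = integral over [0, t] of T_r A f - b. Pairing with kernel
    combinations makes everything a scalar function of r, and [dual_norm] returns to the norm. It
    serves with b = 0 for strong continuity and with b = A f for the generator. *)
Lemma duhamel f b t M : opA_dom G f -> 0 <= t ->
  (forall r, 0 <= r <= t -> nrm (T r (opA G f) - b) <= M) ->
  nrm (T t f - f - t%:C *: b) <= t * M.
Proof.
move=> fD t0 hM.
have M0 : 0 <= M by apply: le_trans (nrm_ge0 _) (hM 0 _); rewrite lexx t0.
apply: dual_norm => [|s sD]; first exact: mulr_ge0.
pose u (r : R) := \sum_(p <- s) p.1^* * (pser (coef f) (phi r p.2) - r%:C * b p.2).
pose u' (r : R) := \sum_(p <- s) p.1^* * (T r (opA G f) p.2 - b p.2).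
have hu r : 0 <= r <= t -> cderiv u r (u' r).
  move=> /andP[r0 rt]; apply: cderiv_sum_seq => p /sD pD.
  apply: cderivZ; apply: cderivB; last exact: cderiv_id.
  apply: (cderiv_ext (cderiv_pser (conv_disc_coef f) (phiD r0 pD) (flow_cderiv flow_phi r0 pD))) => //.
  by rewrite T_val// opA_val// H2E ?derive1_H2//; exact: phiD.
have le r : 0 <= r <= t -> complex.Re (u' r) <= M * l2norm (kv s).
  move=> rt; rewrite Re_sum -[leLHS]/(evs (T r (opA G f) - b : H2 R) s).
  apply: le_trans (evs_le _ sD) _; apply: ler_wpM2r (hM r rt); exact: l2norm_ge0.
have key : complex.Re (u t) - M * l2norm (kv s) * t <= complex.Re (u 0) - M * l2norm (kv s) * 0.
  apply: (@is_derive_nonincr R (fun r => complex.Re (u r) - M * l2norm (kv s) * r)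
     (fun r => complex.Re (u' r) - M * l2norm (kv s) * 1)) => // r rt.
    have A : is_derive r 1 ((fun r => complex.Re (u r)) : R -> R) (complex.Re (u' r) : R).
      exact: (cderiv_Re (hu r rt)).
    have B : is_derive r 1 ((fun r => M * l2norm (kv s) * r) : R -> R) (M * l2norm (kv s) * 1 : R).
      exact: (is_deriveZ (M * l2norm (kv s)) (is_derive_id r 1)).
    exact: (is_deriveB A B).
  by rewrite mulr1 subr_le0 le.
have e : evs (T t f - f - t%:C *: b : H2 R) s = complex.Re (u t) - complex.Re (u 0).
  rewrite !Re_sum -sumrB /evs !big_seq; apply: eq_bigr => p /sD pD.
  rewrite -ReB -mulrBr; congr (complex.Re (_ * _)).
  rewrite !H2_sub_val H2_scale_val (T_val f t0 pD) (H2E f (phiD t0 pD)) (H2E f pD) (phi0 pD).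
  exact: sub_start.
by rewrite e; move: key; move: (complex.Re (u t)) (complex.Re (u 0)) (l2norm (kv s)) => a c k; lra.
Qed.

Let split_half (E' e' : R) : 0 < E' -> E' * (e' / (2 * (E' + 1))) + e' / (2 * (E' + 1)) = e' / 2.
Proof. by move=> E0; field; rewrite gt_eqF//; lra. Qed.

Let frac_le (k e' : R) : 0 <= e' -> 0 <= k -> e' / (2 * (k + 1)) * k <= e' / 2.
Proof. by move=> e0 k0; rewrite mulrAC ler_pdivrMr; [nra|lra]. Qed.

Let sum_half (a b c e' : R) : a + c = e' / 2 -> b <= e' / 2 -> a + (b + c) <= e'.
Proof. by lra. Qed.

(** Approximate x by a vector h of the domain: [duhamel] bounds |T_t h - h| by a multiple of t, and
    the uniform bound E of the operators on [0, 1] transfers this to x. *)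
Let T_small x (e : R) : 0 < e -> exists2 d : R, 0 < d & forall t, 0 <= t <= d -> nrm (T t x - x) <= e.
Proof.
move=> e0; pose E := expR K; have E0 : 0 < E by exact: expR_gt0.
have e'0 : 0 < e / (2 * (E + 1)) by rewrite divr_gt0//; lra.
have [h hD hx] := trunc_dense G x e'0.
pose N := nrm (opA G h); have N0 : 0 <= N by exact: nrm_ge0.
pose d := Num.min 1 (e / (2 * (E * N + 1))).
have EN : 0 <= E * N by rewrite mulr_ge0// ltW.
have d0 : 0 < d by rewrite lt_min ltr01 divr_gt0//; lra.
exists d => // t /andP[t0 td].
have [t1 tN] : t <= 1 /\ t <= e / (2 * (E * N + 1)) by move: td; rewrite le_min => /andP.
have EE r : 0 <= r <= t -> expR (K * r) <= E.
  move=> /andP[r0 rt]; rewrite ler_expR ler_piMr//; lra.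
have hT : nrm (T t h - h) <= t * (E * N).
  have := @duhamel h 0 t (E * N) hD t0; rewrite scaler0 subr0; apply => r rt.
  rewrite subr0; apply: le_trans (T_nrm _ _) _; first by case/andP: rt.
  by apply: ler_wpM2r (EE r rt).
have -> : T t x - x = T t (x - h) + ((T t h - h) + (h - x)).
  by rewrite linearB/= !addrA subrK subrK.
apply: le_trans (nrmD _ _) _; apply: (@le_trans _ _ (E * (e / (2 * (E + 1))) + (t * (E * N) + e / (2 * (E + 1))))).
  apply: lerD.
    apply: le_trans (T_nrm _ t0) _; apply: ler_pM; rewrite ?expR_ge0 ?nrm_ge0 ?(ltW hx)//.
    by apply: EE; rewrite t0 lexx.
  apply: le_trans (nrmD _ _) _; apply: (lerD hT).
  by rewrite nrmB; exact: (ltW hx).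
have a1 : E * (e / (2 * (E + 1))) + e / (2 * (E + 1)) = e / 2.
  exact: split_half.
have a2 : t * (E * N) <= e / 2.
  apply: le_trans (ler_wpM2r EN tN) _; exact: (frac_le (ltW e0) EN).
exact: (sum_half a1 a2).
Qed.

(** Reduces continuity at s to continuity at 0 by factoring out the operator of the smaller time,
    whose norm is at most exp (K s) in both cases. *)
Let T_orbit x s t : 0 <= s -> 0 <= t -> nrm (T t x - T s x) <= expR (K * s) * nrm (T `|t - s| x - x).
Proof.
move=> s0 t0; have [st|ts] := leP s t.
  have ts0 : 0 <= t - s by rewrite subr_ge0.
  have -> : T t x = T s (T (t - s) x) by rewrite -Tsg// addrC subrK.
  by rewrite -linearB ger0_norm// T_nrm.
have ts0 : 0 <= s - t by rewrite subr_ge0 ltW.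
have -> : T s x = T t (T (s - t) x) by rewrite -Tsg// addrC subrK.
rewrite -linearB distrC (ger0_norm ts0); apply: le_trans (T_nrm _ t0) _; rewrite nrmB.
apply: ler_wpM2r; first exact: nrm_ge0.
by rewrite ler_expR; apply: ler_wpM2l; [exact: K0|exact: ltW].
Qed.

Let near_dist (s d : R) : 0 < d -> \forall t \near nbhs s, `|t - s| < d.
Proof.
move=> d0; have h := @cvg_id R (nbhs s).
by move/cvgrPdist_lt : h => /(_ _ d0); apply: filterS => t; rewrite distrC.
Qed.

Let T_near x s (e : R) : 0 <= s -> 0 < e -> exists2 d : R, 0 < d & forall t, 0 <= t -> `|t - s| <= d ->
  nrm (T t x - T s x) <= e.
Proof.
move=> s0 e0; have E0 : 0 < expR (K * s) by exact: expR_gt0.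
have [d d0 hd] := T_small x (divr_gt0 e0 E0); exists d => // t t0 td.
apply: le_trans (T_orbit _ s0 t0) _; rewrite mulrC -ler_pdivlMr//.
by apply: hd; rewrite normr_ge0.
Qed.

Let T_strong x : {within `[0, +oo[, continuous (fun t => T t x)}.
Proof.
apply/subspace_continuousP => s; rewrite /= in_itv/= andbT => s0.
apply/(@cvg_H2P R R (within `[0, +oo[%classic (nbhs s)) _ (fun t => T t x) (T s x)).
apply/cvgrPdist_le => e e0; have [d d0 hd] := T_near x s0 e0.
near=> t; have t0 : 0 <= t.
  by near: t; rewrite near_withinE; apply: nearW => t; rewrite /= in_itv/= andbT.
rewrite sub0r normrN ger0_norm ?nrm_ge0//; apply: hd => //.
near: t; rewrite near_withinE.
have := @near_dist s d d0.
by apply: filterS => t td _; rewrite ltW.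
Unshelve. all: by end_near. Qed.

Let T_C0 : C0_semigroup T.
Proof. by split => [||t s t0 s0 x|]; [exact: T_cont|exact: T0|exact: Tsg|exact: T_strong]. Qed.

Let T_diff f : opA_dom G f -> diff_quotient T f t @[t --> 0^'+] --> opA G f.
Proof.
move=> fD; apply/(@cvg_H2P R R (0^'+) _ (diff_quotient T f) (opA G f)).
apply/cvgrPdist_le => e e0; have [d d0 hd] := T_small (opA G f) e0.
near=> t; have t0 : 0 < t by near: t; exact: nbhs_right_gt.
have td : t <= d by near: t; exact: nbhs_right_le.
rewrite sub0r normrN ger0_norm ?nrm_ge0//.
have -> : diff_quotient T f t - opA G f = (t^-1)%:C *: (T t f - f - t%:C *: opA G f).
  by rewrite /diff_quotient [RHS]scalerBr scalerA -rmorphM mulVf ?gt_eqF// scale1r.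
rewrite nrmZ normc_real ger0_norm ?invr_ge0 ?(ltW t0)// mulrC ler_pdivrMr// mulrC.
apply: duhamel (ltW t0) _ => // r /andP[r0 rt].
by apply: hd; rewrite r0 (le_trans rt td).
Unshelve. all: by end_near. Qed.

Let T_gen : is_generator T (opA_dom G) (opA G).
Proof.
split; last by move=> f; exact: T_diff.
apply/seteqP; split => f /=; first by move=> /T_diff h; apply: cvgP h.
(* Point evaluations are continuous and the flow has speed G, so the limit of the quotients takes
   the value G(z) f'(z); hence G f' is in H2. *)
move=> cf; apply: proj1 (@opA_dom_ex R G f (lim (diff_quotient T f t @[t --> 0^'+])) _) => z zD.
have h1 : diff_quotient T f t z @[t --> (0 : R)^'+] --> lim (diff_quotient T f t @[t --> 0^'+]) z.
  exact: (@H2_cvg_eval R R (0^'+) _ (diff_quotient T f) _ z zD cf).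
have h2 : (h^-1)%:C * (pser (coef f) (phi (h + 0) z) - pser (coef f) (phi 0 z)) @[h --> (0:R)^'+] -->
    pser (coef G) (phi 0 z) * pser (deriv (coef f)) (phi 0 z).
  by apply: cvg_dnbhs_at_right; exact: (cderiv_pser (conv_disc_coef f) (phiD (lexx 0) zD) (flow_cderiv flow_phi (lexx 0) zD)).
rewrite phi0// in h2.
rewrite derive1_H2// H2E//; apply: (@cvg_unique _ (@norm_hausdorff _ _) _ _ _ _ h2).
apply: cvg_trans h1; apply: near_eq_cvg; near=> t.
have t0 : 0 < t by near: t; exact: nbhs_right_gt.
by rewrite diff_quotient_val (T_val f (ltW t0) zD) (H2E f (phiD (ltW t0) zD)) (H2E f zD) addr0.
Unshelve. all: by end_near. Qed.

Let T_quasi : quasicontractive T.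
Proof.
exists K => // t t0 x; rewrite !H2_norm_val -rmorphM lecR; exact: T_nrm.
Qed.

(** The identity function links operators and symbols: T_t sends it to phi_t, which gives the
    regularity of the flow, and the generator sends it to G. *)
Lemma ident_H2 : exists2 I : H2 R, coef I = (fun n => (n == 1%N)%:R) & forall z, disc z -> I z = z.
Proof.
have si : square_summable (fun n => (n == 1%N)%:R : C).
  by apply: (@ss_fin R _ 2) => -[|[|n]].
have [I IE] := H2_of_coef si; exists I => // z zD; rewrite H2E// IE.
apply: csum_unique; apply: cvg_near_cst; near=> n; have n2 : (2 <= n)%N by near: n; exact: nbhs_infty_ge.
have t0 : \sum_(2 <= k < n) (k == 1%N)%:R * z ^+ k = 0.
  by rewrite big_nat big1// => -[|[|k]]//= _; rewrite mul0r.
rewrite /series/= (big_cat_nat (n := 2))//= t0.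
by rewrite big_nat_recr//= big_nat1 mul0r add0r mul1r addr0 expr1.
Unshelve. all: by end_near. Qed.

Let phi_analytic : analytic_semigroup phi.
Proof.
have [I _ IE] := ident_H2.
have phiE t z : 0 <= t -> disc z -> phi t z = T t I z by move=> t0 zD; rewrite T_val// IE//; exact: phiD.
split => [t t0 z zD||t s t0 s0 z zD|].
- split; first exact: phiD.
  have hp : has_power_series (phi t) (coef (T t I)).
    by move=> w wD; rewrite phiE//; exact: coef_series.
  by have [] := is_derive_power_series (conv_disc_coef _) hp zD.
- exact: phi0.
- exact: phi_sg.
apply/subspace_continuousP => -[s z] [/= s0 zD]; rewrite in_itv/= andbT in s0.
have [r /andP[r0 r1] [zr nr]] := near_disc zD.
have k0 : 0 <= (1 - r ^+ 2)^-1 by rewrite invr_ge0 subr_ge0 expr_le1// ltW.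
pose B := Num.sqrt (1 - r ^+ 2)^-1; pose c := coef (T s I).
(* The first summand bounds the change in time, uniformly for points of modulus at most r since B
   bounds their kernels; the second is the change in space at time s. The absolute value extends v
   to negative times. *)
pose v (tz : R * C) := nrm (T `|tz.1| I - T s I) * B + normc (pser c tz.2 - pser c z).
have v1 : nrm (T `|t| I - T s I) @[t --> s] --> (0 : R).
  apply/cvgrPdist_le => e e0; have [d d0 hd] := T_near I s0 e0.
  have := @near_dist s d d0.
  apply: filterS => t td; rewrite sub0r normrN ger0_norm ?nrm_ge0//; apply: hd; first exact: normr_ge0.
  rewrite -{1}(ger0_norm s0); apply: le_trans (ler_dist_dist _ _) _.
  exact: ltW.
have v2 : normc (pser c w - pser c z) @[w --> z] --> (0 : R).
  have h : pser c w @[w --> z] --> pser c z by exact: (continuous_pser (conv_disc_coef _) zD).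
  by have /cvg_normcP := h.
have hv : v tz @[tz --> (s, z)] --> (0 : R).
  have h : v tz @[tz --> (s, z)] --> 0 * B + 0.
    apply: cvgD; last exact: (cvg_comp _ _ cvg_snd v2).
    exact: (cvgM (cvg_comp _ _ cvg_fst v1) (cvg_cst B)).
  by apply: (cvg_conv h) => //; rewrite mul0r addr0.
have hv' : v x @[x --> within (`[0, +oo[%classic `*` @disc R) (nbhs (s, z))] --> (0 : R).
  exact: (@cvg_within_filter _ _ v (nbhs (s, z)) _ _ _ hv).
apply: (@cvg_normc0_le _ _ _ _ _ _ v _ hv').
have nr2 : \forall tz \near (s, z), normc tz.2 <= r by exact: (cvg_snd nr).
rewrite near_withinE; apply: filterS nr2 => -[t w] /= wr [/=].
rewrite in_itv/= andbT => t0 wD; rewrite /v/= /from_subspace/= (phiE _ _ t0 wD) (phiE _ _ s0 zD) (ger0_norm t0).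
have -> : T t I w - T s I z = (T t I - T s I : H2 R) w + (pser c w - pser c z).
  rewrite -[(T t I - T s I : H2 R) w]/(T t I w - T s I w) (H2E (T s I) wD) (H2E (T s I) zD).
  by rewrite addrA subrK.
apply: le_trans (le_normcD _ _) _; rewrite lerD2r.
apply: le_trans (normc_H2_le _ wD) _; apply: ler_wpM2l; first exact: nrm_ge0.
rewrite -(@ler_pXn2r _ 2)// ?nnegrE ?l2norm_ge0 ?sqrtr_ge0// l2norm_kernel// sqr_sqrtr//.
have rr : 0 < 1 - r ^+ 2 by rewrite subr_gt0 expr_lt1// ltW.
have wr2 : normc w ^+ 2 <= r ^+ 2 by rewrite lerXn2r// ?nnegrE ?normc_ge0// ltW.
have ww : 0 < 1 - normc w ^+ 2 by move: (normc w ^+ 2) (r ^+ 2) wr2 rr => a b; lra.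
by rewrite lef_pV2 ?posrE// lerD2l lerN2.
Qed.

Lemma flow_generates : is_generator T (opA_dom G) (opA G) /\ C0_semigroup T /\ quasicontractive T /\ composition_semigroup T.
Proof.
split; [exact: T_gen|split; [exact: T_C0|split; [exact: T_quasi|]]].
by exists phi; [exact: phi_analytic|move=> t t0 f z zD; exact: T_val].
Qed.

End composition_semigroup.

Lemma inward_generates (R : realType) (G : H2 R) : toeplitz_dissipative (coef G) ->
  (forall z, disc z -> complex.Re (z^* * pser (coef G) z) <= normc (coef G 0%N) * (1 - normc z ^+ 2)) ->
  generates_composition (opA_dom G) (opA G) /\ generates_quasicontractive (opA_dom G) (opA G).
Proof.
move=> HG inward; have K0 := normc_ge0 (coef G 0%N).
have [phi hphi] := flow_exists (conv_disc_coef G) K0 inward.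
have phi0 z : disc z -> phi 0 z = z by move=> /hphi[].
have hfl z : disc z -> forall T : R, 0 <= T -> flow_line (coef G) (fun t => phi t z) T by move=> /hphi[].
have phi_sg := flow_semigroup (conv_disc_coef G) K0 inward hphi.
have [T hT] := composition_ops HG phi0 hfl.
have [||gT [C0 [qT cT]]] := @flow_generates R G phi phi0 phi_sg hfl T.
- by move=> t f t0; have [] := hT t f t0.
- by move=> t f z t0; have [_] := hT t f t0; exact.
by split; exists T.
Qed.

(** * The numerical range of the generator *)

Section numerical_range.
Variable R : realType.
Local Notation C := R[i].
Local Notation ss := square_summable.
Implicit Types (c d g q : nat -> C) (f G : H2 R).

Lemma dot_fin c d N : (forall n, (N <= n)%N -> d n = 0) ->
  dot c d = complex.Re (\sum_(0 <= n < N) c n * (d n)^*).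
Proof.
move=> h; apply: dot_unique; apply: cvg_near_cst; near=> M.
have NM : (N <= M)%N by near: M; exact: nbhs_infty_ge.
have z : \sum_(N <= n < M) complex.Re (c n * (d n)^*) = 0.
  by rewrite big_nat big1// => n /andP[Nn _]; rewrite h// conj0 mulr0.
by rewrite /series/= (big_cat_nat (n := N))//= z addr0 Re_sum.
Unshelve. all: by end_near. Qed.

Lemma nrm_sqr_fin f N : (forall n, (N <= n)%N -> coef f n = 0) ->
  nrm f ^+ 2 = complex.Re (\sum_(0 <= n < N) coef f n * (coef f n)^*).
Proof. by move=> h; rewrite -(dot_sqr (ss_coef f)) (dot_fin _ h). Qed.

(** The easy half of the Lumer-Phillips theorem: Re <(T_t f - f) / t, f> is at most (exp (w t) - 1)
    / t times |f|^2, and t tends to 0. *)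
Lemma dissipative_of_quasicontractive G (T : R -> {linear H2 R -> H2 R}) (w : R) f :
  (forall t : R, 0 <= t -> forall x, `|T t x| <= (expR (w * t))%:C * `|x|) ->
  diff_quotient T f t @[t --> (0 : R)^'+] --> opA G f ->
  dot (coef (opA G f)) (coef f) <= w * nrm f ^+ 2.
Proof.
move=> hT hf; set A := opA G f.
have hd : dot (coef (diff_quotient T f t)) (coef f) @[t --> (0 : R)^'+] --> dot (coef A) (coef f).
  have /(@cvg_H2P R R (0^'+) _ (diff_quotient T f) A) h := hf.
  have h2 : nrm (diff_quotient T f t - A) * nrm f @[t --> (0 : R)^'+] --> 0 * nrm f.
    exact: (cvgM h (cvg_cst (nrm f))).
  rewrite mul0r in h2; apply/cvgrPdist_le => e e0.
  move/cvgrPdist_le : h2 => /(_ e e0); apply: filterS => t.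
  rewrite sub0r normrN ger0_norm ?mulr_ge0 ?nrm_ge0// => h3; apply: le_trans h3.
  rewrite distrC -(dotBl (ss_coef _) (ss_coef _) (ss_coef _)).
  apply: le_trans (dot_abs_le (ssB (ss_coef _) (ss_coef _)) (ss_coef _)) _.
  rewrite /nrm (_ : coef (diff_quotient T f t - A) = fun n => coef (diff_quotient T f t) n - coef A n)//.
  by apply/funext => n; rewrite coefB.
have he : (expR (w * t) - 1) / t * nrm f ^+ 2 @[t --> (0 : R)^'+] --> w * nrm f ^+ 2.
  apply: cvgM; last exact: cvg_cst.
  apply: cvg_dnbhs_at_right.
  have /is_derive_quotient h := is_derive_expRM w 0.
  by apply: (cvg_conv h); [apply/funext => t; rewrite addr0 mulr0 expR0 mulrC|rewrite mulr0 expR0 mulr1].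
apply: (ler_cvg_to hd he); near=> t.
have t0 : 0 < t by near: t; exact: nbhs_right_gt.
rewrite mulrAC ler_pdivlMr// mulrC.
have e1 : t * dot (coef (diff_quotient T f t)) (coef f) = dot (coef (T t f)) (coef f) - nrm f ^+ 2.
  rewrite -(dotZl t (ss_coef _) (ss_coef _)) -(dot_sqr (ss_coef f)) -(dotBl (ss_coef _) (ss_coef _) (ss_coef _)).
  congr (dot _ (coef f)); apply/funext => n.
  by rewrite coefZ coefB mulrA -rmorphM divff ?gt_eqF// mul1r.
rewrite e1 mulrBl mul1r lerD2r; apply: le_trans (dot_le (ss_coef _) (ss_coef _)) _.
rewrite expr2 mulrA; apply: ler_wpM2r; first exact: nrm_ge0.
by have := hT t (ltW t0) f; rewrite !H2_norm_val -rmorphM lecR.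
Unshelve. all: by end_near. Qed.

(** Leibniz rule for z^(n+1) q, whose derivative is z^n ((n + 1) q + z q'); the sequence i q_i
    belongs to z q'. *)
Lemma conv_deriv_shift g q n j :
  conv g (deriv (fun k => if (n.+1 <= k)%N then q (k - n.+1)%N else 0)) (j + n.+1) =
  n.+1%:R * conv g q j.+1 + conv g (fun i => i%:R * q i) j.+1.
Proof.
rewrite /conv /deriv (big_cat_nat (n := n))//=; last lia.
rewrite [X in X + _]big_nat [X in X + _]big1; last first.
  by move=> k /andP[_ kn]; rewrite ltnS leqNgt kn/= !mulr0.
rewrite add0r -{1}[n]add0n big_addn (_ : ((j + n.+1).+1 - n)%N = j.+2); last lia.
rewrite big_distrr/= -big_split/=; apply: eq_big_nat => i /andP[_ ij].
rewrite ltnS leq_addl subSS addnK (_ : (j + n.+1 - (i + n) = j.+1 - i)%N); last lia.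
by rewrite -addnS addnC natrD; ring.
Qed.

Lemma sum_shift (F : nat -> C) N n : (forall k, (k < n)%N -> F k = 0) ->
  \sum_(0 <= k < N + n) F k = \sum_(0 <= j < N) F (j + n)%N.
Proof.
move=> h; rewrite (big_cat_nat (n := n))//= ?leq_addl// [X in X + _]big_nat [X in X + _]big1.
  by rewrite add0r -{1}[n]add0n big_addn addnK.
by move=> k /andP[_ kn]; exact: h.
Qed.

Lemma dissipative_toeplitz G (w : R) :
  (forall f, opA_dom G f -> dot (coef (opA G f)) (coef f) <= w * nrm f ^+ 2) ->
  toeplitz_dissipative (coef G).
Proof.
move=> H N q hq; set X := complex.Re _.
pose Y := complex.Re (\sum_(0 <= j < N) conv (coef G) (fun i => i%:R * q i) j.+1 * (q j)^*).
pose S := complex.Re (\sum_(0 <= j < N) q j * (q j)^*).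
(* Neither Y nor S depends on n, multiplication by z^(n+1) being isometric; a positive X would
   contradict this for large n. *)
have key n : n.+1%:R * X + Y <= w * S.
  pose c k := if (n.+1 <= k)%N then q (k - n.+1)%N else 0.
  have c0 k : (N + n.+1 <= k)%N -> c k = 0.
    by move=> Nk; rewrite /c; case: ifP => // _; apply: hq; lia.
  have [f fE] := H2_of_coef (ss_fin c0).
  have f0 k : (N + n.+1 <= k)%N -> coef f k = 0 by rewrite fE; exact: c0.
  have [fD AE] := fin_in_dom G f0.
  have cj j : c (j + n.+1)%N = q j by rewrite /c leq_addl addnK.
  have ck k : (k < n.+1)%N -> c k = 0 by move=> kn; rewrite /c leqNgt kn.
  have := H f fD; rewrite (nrm_sqr_fin f0) (dot_fin _ f0) AE fE.
  rewrite !sum_shift; last 2 first.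
  - by move=> k kn; rewrite ck// mul0r.
  - by move=> k kn; rewrite ck// conj0 mulr0.
  have eS : \sum_(0 <= j < N) c (j + n.+1)%N * (c (j + n.+1)%N)^* = \sum_(0 <= j < N) q j * (q j)^*.
    by apply: eq_bigr => j _; rewrite cj.
  rewrite eS -/S; suff -> : n.+1%:R * X + Y =
    complex.Re (\sum_(0 <= j < N) conv (coef G) (deriv c) (j + n.+1) * (c (j + n.+1)%N)^*) by [].
  rewrite /X /Y -ReM_real -ReD big_distrr/= -big_split/=; congr complex.Re.
  apply: eq_bigr => j _; rewrite conv_deriv_shift cj mulrDl mulrA; congr (_ * _ * _ + _).
  by rewrite rmorph_nat.
rewrite leNgt; apply/negP => X0.
have := archi_boundP (_ : 0 <= (`|w * S - Y| + 1) / X); rewrite divr_ge0 ?addr_ge0 ?(ltW X0)// => /(_ isT).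
rewrite ltr_pdivrMr//; set n := Num.bound _ => h.
have := key n; rewrite -natr1 mulrDl mul1r; move: h; have := ler_norm (w * S - Y).
by move: (`|w * S - Y|) (n%:R * X) (w * S) => a b d; lra.
Qed.

Lemma quasicontractive_toeplitz G : generates_quasicontractive (opA_dom G) (opA G) ->
  toeplitz_dissipative (coef G).
Proof.
move=> [T [_ [w w0 hw] [_ hA]]]; apply: (@dissipative_toeplitz G w) => f fD.
exact: dissipative_of_quasicontractive hw (hA f fD).
Qed.

End numerical_range.

(** * Means over the circle *)

Section circle.
Variable R : realType.
Local Notation C := R[i].
Implicit Types (x y k : R) (u v : nat -> C) (z : C).

Lemma cisD x y : cis (x + y) = cis x * cis y.
Proof. by rewrite /cis cosD sinD; congr (_ +i* _); rewrite addrC. Qed.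

Lemma cis0 : cis 0 = 1 :> C.
Proof. by rewrite /cis cos0 sin0. Qed.

Lemma cis_conj x : (cis x)^* = cis (- x).
Proof. by rewrite conjE /cis /= cosN sinN. Qed.

Lemma cisX x n : cis x ^+ n = cis (n%:R * x).
Proof.
elim: n => [|n IH]; first by rewrite mul0r cis0.
by rewrite exprSr IH -cisD -natr1 mulrDl mul1r.
Qed.

Lemma cisXB x n m : cis x ^+ n * (cis x)^* ^+ m = cis ((n%:R - m%:R) * x) :> C.
Proof. by rewrite cis_conj !cisX mulrN -cisD mulrBl. Qed.

Lemma cis_period x : cis (x + pi *+ 2) = cis x.
Proof. by rewrite cisD [cis (_ *+ _)]/cis cos2pi sin2pi -[_ +i* 0]/(1 : C) mulr1. Qed.

Lemma cisM_conj x : cis x * (cis x)^* = 1.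
Proof. by rewrite cis_conj -cisD subrr cis0. Qed.

Lemma normc_cis x : normc (cis x) = 1.
Proof.
apply/eqP; rewrite -(@eqrXn2 _ 2)// ?normc_ge0// expr1n.
by rewrite sqr_normc_Re cisM_conj.
Qed.

Lemma cderiv_cis k x : cderiv (fun y => cis (k * y)) x (k%:C * (0 +i* 1) * cis (k * x)).
Proof.
have h : is_derive x 1 ((fun y => k * y) : R -> R) (k * 1).
  exact: (is_deriveZ k (is_derive_id x 1)).
apply: cderiv_ReIm.
  have := @is_derive1_comp R cos (fun y => k * y) x _ _ (is_derive_cos _) h.
  move=> d; apply: (is_derive_ext d) => //.
  by rewrite /GRing.scale/=; ring.
have := @is_derive1_comp R sin (fun y => k * y) x _ _ (is_derive_sin _) h.
move=> d; apply: (is_derive_ext d) => //.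
by rewrite /GRing.scale/=; ring.
Qed.

Lemma ftc_is_derive (F f : R -> R) (a b : R) : a < b -> (forall x, is_derive x 1 F (f x)) ->
  continuous f ->
  (\int[lebesgue_measure]_(x in `[a, b]) (f x)%:E = (F b - F a)%:E)%E.
Proof.
move=> ab hF cf; have cF x : {for x, continuous F}.
  by apply/differentiable_continuous/derivable1_diffP; have [] := hF x.
rewrite EFinB (continuous_FTC2 (F := F) ab)//.
- exact: continuous_subspaceT.
- split => [x _||]; first by have [] := hF x.
    by apply: cvg_at_right_filter; exact: cF.
  by apply: cvg_at_left_filter; exact: cF.
- by move=> x _; rewrite derive1E; have := hF x => h; rewrite derive_val.
Qed.

Definition circle_series u x := csum (fun n => u n * cis x ^+ n).

Let term u v n m x : C := u n * cis x ^+ n * (v m * cis x ^+ m)^*.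

Let termE u v n m x : term u v n m x = u n * (v m)^* * cis ((n%:R - m%:R) * x).
Proof. by rewrite /term conjM conjX -cisXB mulrACA. Qed.

(** Explicit primitives: the off-diagonal ones are periodic and contribute nothing over a period,
    which is the orthogonality of the characters. *)
Let anti u v n m x : C :=
  if n == m then x%:C * (u n * (v m)^*)
  else u n * (v m)^* * ((n%:R - m%:R)%:C * (0 +i* 1))^-1 * cis ((n%:R - m%:R) * x).

Let anti_cderiv u v n m x : cderiv (anti u v n m) x (term u v n m x).
Proof.
rewrite termE /anti; case: eqP => [->|/eqP nm].
  by rewrite subrr mul0r cis0 mulr1; exact: cderiv_id.
have h := cderivZ (k := u n * (v m)^* * ((n%:R - m%:R : R)%:C * (0 +i* 1))^-1) (@cderiv_cis (n%:R - m%:R : R) x).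
apply: (cderiv_ext h) => //; rewrite mulrA; congr (_ * _); rewrite mulfVK// mulf_neq0//.
  by apply: realc_neq0; rewrite subr_eq0 eqr_nat.
by rewrite eq_complex/= oner_eq0 andbF.
Qed.

Let anti_period u v n m a : anti u v n m (a + pi *+ 2) - anti u v n m a =
  if n == m then (pi *+ 2)%:C * (u n * (v m)^*) else 0.
Proof.
rewrite /anti; case: eqP => [_|_]; first by rewrite -mulrBl -rmorphB addrAC subrr add0r.
by rewrite -mulrBr -!cisXB cis_period subrr mulr0.
Qed.

Let pterm u v N x := complex.Re (series (fun n => u n * cis x ^+ n) N * (series (fun n => v n * cis x ^+ n) N)^*).

Let ptermE u v N x : pterm u v N x = complex.Re (\sum_(0 <= n < N) \sum_(0 <= m < N) term u v n m x).
Proof.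
rewrite /pterm /series/= conj_sum big_distrl/=; congr complex.Re.
by apply: eq_bigr => n _; rewrite big_distrr.
Qed.

Lemma continuous_cis : continuous (@cis R : R -> C).
Proof.
move=> x; apply: cvg_ReIm => /=; first exact: continuous_cos.
exact: continuous_sin.
Qed.

Lemma continuous_cisX n x : cis y ^+ n @[y --> x] --> (cis x ^+ n : C).
Proof.
have h : cis (n%:R * y) @[y --> x] --> (cis (n%:R * x) : C).
  have h0 : n%:R * y @[y --> x] --> n%:R * x by exact: (cvgM (cvg_cst _) cvg_id).
  exact: (cvg_comp _ _ h0 (@continuous_cis _)).
by apply: (cvg_conv h); [apply/funext => y|]; rewrite cisX.
Qed.

Let continuous_part u N : continuous (fun x => series (fun n => u n * cis x ^+ n) N).
Proof.
elim: N => [|N IH] x.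
  rewrite (_ : (fun y => _) = fun=> 0); first exact: cvg_cst.
  by apply/funext => y; rewrite /series/= big_geq.
have h := @continuous_cisX N x.
have h2 : series (fun n => u n * cis y ^+ n) N + u N * cis y ^+ N @[y --> x] -->
    series (fun n => u n * cis x ^+ n) N + u N * cis x ^+ N.
  exact: (cvgD (IH x) (cvgM (cvg_cst (u N)) h)).
by apply: (cvg_conv h2); [apply/funext => y|]; rewrite /series/= big_nat_recr.
Qed.

Let continuous_pterm u v N : continuous (pterm u v N).
Proof.
move=> x; apply: cvg_Re; apply: cvgM; first exact: continuous_part.
apply: cvg_conj; exact: continuous_part.
Qed.

Let int_pterm u v N a : (\int[lebesgue_measure]_(x in `[a, (a + pi *+ 2)%R]) (pterm u v N x)%:E =
  (pi *+ 2 * \sum_(0 <= n < N) complex.Re (u n * (v n)^*))%:E)%E.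
Proof.
pose P x := complex.Re (\sum_(0 <= n < N) \sum_(0 <= m < N) anti u v n m x).
have dP x : is_derive x 1 P (pterm u v N x).
  rewrite ptermE; apply: cderiv_Re; apply: cderiv_sum => n; apply: cderiv_sum => m.
  exact: anti_cderiv.
have ap : a < a + pi *+ 2 by rewrite ltrDl mulrn_wgt0 ?pi_gt0.
rewrite (ftc_is_derive ap dP (@continuous_pterm u v N)); congr (_%:E).
rewrite /P -ReB -sumrB -Re_sum -ReM_real big_distrr/=; congr complex.Re.
apply: eq_big_nat => n /andP[_ nN]; rewrite -sumrB.
under eq_bigr do rewrite anti_period eq_sym.
by rewrite -big_mkcond big_nat1_eq nN.
Qed.

Lemma circle_series_cvg u x : geo u -> series (fun n => u n * cis x ^+ n) @ \oo --> circle_series u x.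
Proof.
move=> h; apply: geo_cvg; apply: (geo_le (K := 1) h) => n.
by rewrite normcM normcX normc_cis expr1n mulr1 mul1r.
Qed.

Lemma circle_series_bound u : geo u -> exists2 M : R, 0 <= M &
  forall x N, normc (series (fun n => u n * cis x ^+ n) N) <= M.
Proof.
move=> hu; have cu := geo_asum hu; exists (limn (series (fun n => normc (u n)))) => [|x N].
  by apply: (le_trans _ (nondecreasing_cvgn_le _ cu 0%N)); [rewrite /series/= big_geq|apply/nondecreasing_series => n _ _; exact: normc_ge0].
rewrite /series/=; apply: le_trans (@normc_sum _ _ _ _ _) _.
apply: (le_trans _ (nondecreasing_cvgn_le _ cu N)); last by apply/nondecreasing_series => n _ _; exact: normc_ge0.
by apply: ler_sum => n _; rewrite normcM normcX normc_cis expr1n mulr1.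
Qed.

(** Rescaling by a radius r between the decay rate and 1 turns values on the circle into values
    inside the disc, where continuity is available. *)
Lemma circle_series_pser u : geo u -> exists2 c, conv_disc c &
  exists2 r : R, 0 < r < 1 & forall x, circle_series u x = pser c (r%:C * cis x).
Proof.
move=> [K [s [K0 /andP[s0 s1] hs]]]; pose r := (1 + s) / 2.
have r0 : 0 < r by rewrite /r; lra.
have r1 : r < 1 by rewrite /r; lra.
have sr : s < r by rewrite /r; lra.
exists (fun n => u n * (r^-1)%:C ^+ n).
  apply: geo_conv_disc; exists K, (s / r); split; first exact: K0.
    by rewrite divr_ge0 ?(ltW r0)//= ltr_pdivrMr// mul1r.
  move=> n; rewrite normcM normcX normc_real ger0_norm ?invr_ge0 ?(ltW r0)//.
  by rewrite exprMn mulrA; apply: ler_wpM2r (hs n); rewrite exprn_ge0// invr_ge0 ltW.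
exists r => [|x]; first by rewrite r0 r1.
rewrite /circle_series /pser; congr csum; apply/funext => n.
have e : (r^-1)%:C * r%:C = 1 :> C by rewrite -rmorphM mulVf ?gt_eqF.
by rewrite (exprMn _ r%:C) mulrA -(mulrA (u n)) -exprMn e expr1n mulr1.
Qed.

Lemma disc_circle (r : R) x : 0 <= r < 1 -> disc (r%:C * cis x).
Proof.
by move=> /andP[r0 r1]; apply/disc_normc; rewrite normcM normc_cis mulr1 normc_real ger0_norm.
Qed.

Lemma continuous_pser_circle c (r : R) : conv_disc c -> 0 <= r < 1 ->
  continuous (fun x => pser c (r%:C * cis x)).
Proof.
move=> hc r01 x; have cx : cis y @[y --> x] --> (cis x : C) by exact: continuous_cis.
have h : r%:C * cis y @[y --> x] --> r%:C * cis x by exact: (cvgM (cvg_cst r%:C) cx).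
exact: (cvg_comp _ _ h (continuous_pser hc (disc_circle x r01))).
Qed.

Lemma continuous_circle_series u : geo u -> continuous (circle_series u).
Proof.
move=> /circle_series_pser[c hc [r /andP[r0 r1] e]].
rewrite (_ : circle_series u = fun x => pser c (r%:C * cis x)); last exact/funext.
by apply: continuous_pser_circle => //; rewrite ltW.
Qed.

Lemma measurable_continuous (f : R -> R) (D : set R) : continuous f -> measurable_fun D f.
Proof. by move=> cf; apply: measurable_funTS; exact: continuous_measurable_fun. Qed.

(* Bounded convergence from the partial sums. *)
Lemma parseval u v a : geo u -> geo v ->
  (\int[lebesgue_measure]_(x in `[a, (a + pi *+ 2)%R])
     (complex.Re (circle_series u x * (circle_series v x)^* ))%:E = (pi *+ 2 * dot u v)%:E)%E.
Proof.
move=> hu hv; have [A A0 hA] := circle_series_bound hu; have [B B0 hB] := circle_series_bound hv.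
pose h x := complex.Re (circle_series u x * (circle_series v x)^*).
have ch : continuous h.
  move=> x; apply: cvg_Re; apply: cvgM; first exact: (continuous_circle_series hu).
  by apply: cvg_conj; exact: (continuous_circle_series hv).
have cvgh x : pterm u v N x @[N --> \oo] --> h x.
  apply: cvg_Re; apply: cvgM; first exact: circle_series_cvg.
  by apply: cvg_conj; exact: circle_series_cvg.
have hb N x : `|pterm u v N x| <= A * B.
  apply: le_trans (abs_Re_le _) _; rewrite normcM normc_conj.
  by apply: ler_pM; rewrite ?normc_ge0.
pose D := `[a, (a + pi *+ 2)%R]%classic.
have mD : measurable D by exact: measurable_itv.
have iAB : (@lebesgue_measure R).-integrable D (EFin \o cst (A * B)).
  by apply: continuous_compact_integrable; [exact: segment_compact|apply: continuous_subspaceT => x; exact: cvg_cst].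
have [||||_ _ l] := @dominated_convergence _ _ R (@lebesgue_measure R) D mD
  (fun N x => (pterm u v N x)%:E) (EFin \o h) (EFin \o cst (A * B)) _ _ _ iAB.
- by move=> N; apply/measurable_EFinP; apply: measurable_continuous; exact: continuous_pterm.
- by apply/measurable_EFinP; exact: measurable_continuous.
- by apply: aeW => x _; apply/cvg_EFin; [exact: nearW|exact: cvgh].
- by apply: aeW => x N _; rewrite /= lee_fin hb.
have l2 : (pi *+ 2 * \sum_(0 <= n < N) complex.Re (u n * (v n)^*))%:E @[N --> \oo] --> (pi *+ 2 * dot u v)%:E.
  apply/cvg_EFin; first exact: nearW.
  exact: (cvgM (cvg_cst _) (dot_cvg (geo_ss hu) (geo_ss hv))).
symmetry; apply: (cvg_unique _ l2); first exact: ereal_hausdorff.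
by apply: (cvg_conv l) => //; apply/funext => N; exact: int_pterm.
Qed.

End circle.

(** * The Toeplitz form as a circle mean *)

Section toeplitz_form.
Variable R : realType.
Local Notation C := R[i].
Implicit Types (g q u v : nat -> C) (G f : H2 R).

Lemma mulr_conj (z : C) : z * z^* = (normc z ^+ 2)%:C.
Proof.
rewrite sqr_normcE conjE; case: z => x y; apply/eqP; rewrite eq_complex/=.
by apply/andP; split; apply/eqP; ring.
Qed.

(** Involves only g_0, ..., g_N, so it is continuous under convergence of each coefficient of g. *)
Definition tform g q N := complex.Re (\sum_(0 <= j < N) conv g q j.+1 * (q j)^*).

Lemma cvg_sum (T I : Type) (F : set_system T) (FF : Filter F) (r : seq I) (f : T -> I -> C) (l : I -> C) :
  (forall i, f t i @[t --> F] --> l i) ->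
  \sum_(i <- r) f t i @[t --> F] --> \sum_(i <- r) l i.
Proof.
move=> h; elim: r => [|i r IH].
  by rewrite big_nil; under eq_fun do rewrite big_nil; exact: cvg_cst.
rewrite big_cons; under eq_fun do rewrite big_cons; exact: (cvgD (h i) IH).
Qed.

Lemma cvg_tform (T : Type) (F : set_system T) (FF : Filter F) (a : T -> nat -> C) g q N :
  (forall n, a t n @[t --> F] --> g n) -> tform (a t) q N @[t --> F] --> tform g q N.
Proof.
move=> h; apply: cvg_Re; apply: cvg_sum => j.
apply: (cvgM _ (cvg_cst (q j)^*)); apply: cvg_sum => k.
exact: (cvgM (h _) (cvg_cst _)).
Qed.

Lemma tform_lin (k : R) (a b : nat -> C) q N :
  tform (fun n => k%:C * (a n - b n)) q N = k * (tform a q N - tform b q N).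
Proof.
rewrite /tform -ReB -sumrB -ReM_real big_distrr/=; congr complex.Re.
apply: eq_bigr => j _; rewrite -mulrBl mulrA; congr (_ * _).
rewrite /conv -sumrB big_distrr/=; apply: eq_bigr => i _.
by rewrite -mulrBl mulrA.
Qed.

Lemma geo_fin q N : (forall n, (N <= n)%N -> q n = 0) -> geo q.
Proof.
elim: N q => [|N IH] q h; last by apply: geo_shift; apply: IH => n Nn; exact: h.
by rewrite (_ : q = fun=> 0); [exact: geo0|apply/funext => n; exact: h].
Qed.

Lemma circle_seriesB u v x : geo u -> geo v ->
  circle_series (fun n => u n - v n) x = circle_series u x - circle_series v x.
Proof.
have h w : geo w -> geo (fun n => w n * cis x ^+ n).
  by move=> hw; apply: (geo_le (K := 1) hw) => n; rewrite normcM normcX normc_cis expr1n mulr1 mul1r.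
move=> /h hu /h hv; rewrite /circle_series -csumB//; congr csum; apply/funext => n.
by rewrite mulrBl.
Qed.

Lemma circle_seriesZ (k : C) u x : geo u ->
  circle_series (fun n => k * u n) x = k * circle_series u x.
Proof.
move=> hu; rewrite /circle_series -csumZ; first by congr csum; apply/funext => n; rewrite mulrA.
by apply: (geo_le (K := 1) hu) => n; rewrite normcM normcX normc_cis expr1n mulr1 mul1r.
Qed.

Lemma circle_series_conv u v x : geo u -> geo v ->
  circle_series (conv u v) x = circle_series u x * circle_series v x.
Proof.
have h w : geo w -> geo (fun n => w n * cis x ^+ n).
  by move=> hw; apply: (geo_le (K := 1) hw) => n; rewrite normcM normcX normc_cis expr1n mulr1 mul1r.
move=> /h hu /h hv; rewrite /circle_series -csum_conv//; congr csum; apply/funext => n.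
rewrite /conv big_distrl/=; apply: eq_big_nat => k /andP[_ kn].
by rewrite mulrACA -exprD subnK.
Qed.

Definition shift u n : C := if n is m.+1 then u m else 0.

Lemma geo_shiftr u : geo u -> geo (shift u).
Proof. by move=> hu; apply: geo_shift. Qed.

Lemma circle_series_shift u x : geo u -> circle_series (shift u) x = cis x * circle_series u x.
Proof.
have h w : geo w -> geo (fun n => w n * cis x ^+ n).
  by move=> hw; apply: (geo_le (K := 1) hw) => n; rewrite normcM normcX normc_cis expr1n mulr1 mul1r.
move=> hu; rewrite /circle_series (csumS (h _ (geo_shiftr hu))) mul0r add0r -csumZ; last exact: h.
by congr csum; apply/funext => n; rewrite exprS mulrCA.
Qed.

Lemma dot_circle_ge0 u v : geo u -> geo v ->
  (forall x, 0 <= complex.Re (circle_series u x * (circle_series v x)^* )) -> 0 <= dot u v.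
Proof.
move=> hu hv h; have p := parseval 0 hu hv.
have : (0 <= (pi *+ 2 * dot u v)%:E :> \bar R)%E.
  by rewrite -p; apply: integral_ge0 => x _; rewrite lee_fin h.
by rewrite lee_fin pmulr_rge0// mulrn_wgt0// pi_gt0.
Qed.

Lemma dot_shift u q N : (forall n, (N <= n)%N -> q n = 0) ->
  dot u (shift q) = complex.Re (\sum_(0 <= j < N) u j.+1 * (q j)^*).
Proof.
move=> h; rewrite (@dot_fin R u (shift q) N.+1); last by case=> // n; exact: h.
by rewrite big_nat_recl//= conj0 mulr0 add0r.
Qed.

Definition dilate g (r : R) n : C := g n * r%:C ^+ n.

Lemma circle_series_dilate g r x : circle_series (dilate g r) x = pser g (r%:C * cis x).
Proof. by rewrite /circle_series /pser; congr csum; apply/funext => n; rewrite exprMn mulrA. Qed.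

(* The circle mean of [Re (conj z g(r z)) |q(z)|^2] is a Toeplitz form. *)
Lemma tform_dilate_le g q N (r B : R) : conv_disc g -> 0 <= r < 1 ->
  (forall n, (N <= n)%N -> q n = 0) ->
  (forall x, complex.Re ((cis x)^* * pser g (r%:C * cis x)) <= B) ->
  tform (dilate g r) q N <= B * complex.Re (\sum_(0 <= j < N) q j * (q j)^*).
Proof.
move=> hg r01 hq hB; have gq := geo_fin hq; have gg : geo (dilate g r) := hg r r01.
have gu := geo_conv gg gq; have gv := geo_shiftr gq; have gB := geoZ B%:C gv.
have gw := geoD gB (geoZ (-1) gu).
(* These are the coefficients of B z q - G(r .) q; pairing with z q gives the mean of (B - Re (conj
   z G(r z))) |q|^2. *)
pose w n := B%:C * shift q n - conv (dilate g r) q n.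
have hw : geo w.
  by move: gw; congr geo; apply/funext => n; rewrite mulN1r.
have pos x : 0 <= complex.Re (circle_series w x * (circle_series (shift q) x)^*).
  rewrite circle_seriesB// circle_seriesZ// circle_series_conv// circle_series_shift//.
  rewrite circle_series_dilate; set Q := circle_series q x; set P := pser _ _.
  have -> : (B%:C * (cis x * Q) - P * Q) * (cis x * Q)^* = (normc Q ^+ 2)%:C * (B%:C - (cis x)^* * P).
    have -> : (normc Q ^+ 2)%:C = Q * Q^* by rewrite mulr_conj.
    rewrite conjM -[B%:C in RHS]mulr1 -(cisM_conj x); ring.
  by rewrite ReM_real mulr_ge0 ?sqr_ge0// ReB subr_ge0; exact: hB.
have := dot_circle_ge0 hw gv pos; rewrite (dot_shift _ hq) /tform.
rewrite (_ : \sum_(0 <= j < N) w j.+1 * (q j)^* = B%:C * (\sum_(0 <= j < N) q j * (q j)^*) -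
   \sum_(0 <= j < N) conv (dilate g r) q j.+1 * (q j)^*).
  by rewrite ReB ReM_real subr_ge0.
by rewrite big_distrr/= -sumrB; apply: eq_bigr => j _; rewrite /w mulrBl mulrA.
Qed.

Lemma dilate_cvg g n : dilate g r n @[r --> (1 : R)^'-] --> g n.
Proof.
have h m : (r%:C : C) ^+ m @[r --> (1 : R)^'-] --> (1 : C).
  elim: m => [|m IH]; first by under eq_fun do rewrite expr0; exact: cvg_cst.
  have r1 : (r%:C : C) @[r --> (1 : R)^'-] --> ((1 : R)%:C : C).
    by apply: cvg_real_complex; apply: cvg_at_left_filter; exact: cvg_id.
  have h : (r%:C : C) * r%:C ^+ m @[r --> (1 : R)^'-] --> (1 : R)%:C * (1 : C) by exact: (cvgM r1 IH).
  by apply: (cvg_conv h); [apply/funext => r; rewrite exprS|rewrite mulr1].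
have h2 : dilate g r n @[r --> (1 : R)^'-] --> g n * 1 by exact: (cvgM (cvg_cst (g n)) (h n)).
by apply: (cvg_conv h2) => //; rewrite mulr1.
Qed.

Lemma tform_le_lim g q N (B : R -> R) (b : R) : conv_disc g ->
  (forall n, (N <= n)%N -> q n = 0) -> B r @[r --> (1 : R)^'-] --> b ->
  (forall r x, 0 < r < 1 -> complex.Re ((cis x)^* * pser g (r%:C * cis x)) <= B r) ->
  tform g q N <= b * complex.Re (\sum_(0 <= j < N) q j * (q j)^*).
Proof.
move=> hg hq hb hB; set S := complex.Re _.
have h1 : tform (dilate g r) q N @[r --> (1 : R)^'-] --> tform g q N.
  by apply: cvg_tform => n; exact: dilate_cvg.
have h2 : B r * S @[r --> (1 : R)^'-] --> b * S by exact: (cvgM hb (cvg_cst S)).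
apply: (ler_cvg_to h1 h2); near=> r.
have r0 : 0 < r by near: r; exact: nbhs_left_gt.
have r1 : r < 1 by near: r; exact: nbhs_left_lt.
by apply: tform_dilate_le => // [|x]; [rewrite ltW|apply: hB; rewrite r0].
Unshelve. all: by end_near. Qed.

Lemma inward_bound_cvg (K : R) : K * (1 - r ^+ 2) / r @[r --> (1 : R)^'-] --> (0 : R).
Proof.
have i1 : (r : R) @[r --> (1 : R)^'-] --> (1 : R) by apply: cvg_at_left_filter; exact: cvg_id.
have h : K * (1 - r * r) / r @[r --> (1 : R)^'-] --> K * (1 - 1 * 1) / 1.
  apply: cvgM; last by apply: cvgV => //; exact: oner_neq0.
  by apply: cvgM; [exact: cvg_cst|apply: cvgB; [exact: cvg_cst|exact: cvgM]].
by apply: (cvg_conv h); [|rewrite mulr1 subrr mulr0 mul0r].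
Qed.

Lemma inward_circle g (K r x : R) : 0 < r -> r < 1 ->
  (forall z, disc z -> complex.Re (z^* * pser g z) <= K * (1 - normc z ^+ 2)) ->
  complex.Re ((cis x)^* * pser g (r%:C * cis x)) <= K * (1 - r ^+ 2) / r.
Proof.
move=> r0 r1 hV; have zD : disc (r%:C * cis x) by apply: disc_circle; rewrite ltW.
have := hV _ zD; rewrite conjM conj_real -mulrA ReM_real normcM normc_cis mulr1 normc_real ger0_norm ?(ltW r0)//.
by rewrite ler_pdivlMr// mulrC.
Qed.

Lemma inward_toeplitz g (K : R) : conv_disc g ->
  (forall z, disc z -> complex.Re (z^* * pser g z) <= K * (1 - normc z ^+ 2)) ->
  toeplitz_dissipative g.
Proof.
move=> hg hV N q hq; rewrite -/(tform g q N).
have := tform_le_lim hg hq (inward_bound_cvg K); rewrite mul0r; apply => r x /andP[r0 r1].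
exact: inward_circle.
Qed.

Lemma composition_toeplitz G : generates_composition (opA_dom G) (opA G) ->
  toeplitz_dissipative (coef G).
Proof.
move=> [T [C0 [phi [hphi _ _ _] hT] [_ hA]]] N q hq; rewrite -/(tform (coef G) q N).
(* At the identity function the form equals |q|^2, and at its image phi_t it is at most |q|^2 since
   |phi_t| < 1. The difference quotients of these images tend to G. *)
have [I Ic Iv] := ident_H2 R; set S := complex.Re (\sum_(0 <= j < N) q j * (q j)^*).
have I0 n : (2 <= n)%N -> coef I n = 0 by rewrite Ic; case: n => [|[|]].
have [ID IA] := fin_in_dom G I0.
have AG : coef (opA G I) = coef G.
  rewrite IA; apply/funext => n; rewrite /conv big_nat_recl//= big1 => [|k _].
    by rewrite /deriv Ic/= mulr1 subn0 addr0 mulr1.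
  by rewrite /deriv Ic/= !mulr0.
have tI : tform (coef I) q N = S.
  congr complex.Re; apply: eq_bigr => j _; congr (_ * _); rewrite /conv.
  rewrite (eq_big_nat _ _ (F2 := fun k => if k == j then q k else 0)) => [|k /andP[_ kj]].
    by rewrite -big_mkcond big_nat1_eq leq0n ltnW.
  rewrite Ic (_ : ((j.+1 - k)%N == 1%N) = (k == j)); last by lia.
  by case: (k == j); rewrite ?mul1r ?mul0r.
have tT t : 0 <= t -> tform (coef (T t I)) q N <= S.
  move=> t0; have := @tform_le_lim (coef (T t I)) q N (fun=> 1) 1 (conv_disc_coef _) hq (cvg_cst _).
  rewrite mul1r; apply => r x /andP[r0 r1].
  have zD : disc (r%:C * cis x) by apply: disc_circle; rewrite ltW.
  rewrite -(H2E (T t I) zD) (hT t t0 I _ zD); have [pD _] := hphi t t0 _ zD; rewrite (Iv _ pD).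
  apply: le_trans (Re_le _) _; rewrite normcM normc_conj normc_cis mul1r.
  by apply: ltW; apply/disc_normc.
have hd : tform (coef (diff_quotient T I t)) q N @[t --> (0 : R)^'+] --> tform (coef G) q N.
  apply: cvg_tform => n; rewrite -AG.
  have /(@cvg_H2P R R (0^'+) _ (diff_quotient T I) (opA G I)) h := hA I ID.
  apply: (cvg_normc0_le (v := fun t => nrm (diff_quotient T I t - opA G I))); last exact: h.
  by apply: nearW => t; rewrite -coefB; exact: (ss_coef_le n (ss_coef _)).
apply: (ler_cvg_to hd (cvg_cst 0)); near=> t.
have t0 : 0 < t by near: t; exact: nbhs_right_gt.
have ti0 : 0 <= t^-1 by rewrite invr_ge0 ltW.
have e : coef (diff_quotient T I t) = fun n => (t^-1)%:C * (coef (T t I) n - coef I n).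
  by apply/funext => n; rewrite coefZ coefB.
have hs : tform (coef (T t I)) q N - S <= 0 by move: (tT t (ltW t0)); rewrite subr_le0.
have e2 : tform (coef (diff_quotient T I t)) q N = t^-1 * (tform (coef (T t I)) q N - S).
  rewrite e -tI.
  exact: tform_lin.
have fin : tform (coef (diff_quotient T I t)) q N <= 0.
  rewrite e2.
  exact: (mulr_ge0_le0 ti0 hs).
exact: fin.
Unshelve. all: by end_near. Qed.

End toeplitz_form.

(** * Fatou's theorem *)

Section poisson.
Variable R : realType.
Local Notation C := R[i].
Implicit Types (x y t s r : R) (u v : nat -> C) (z w : C).

Lemma sin_le_id y : 0 <= y -> sin y <= y.
Proof.
move=> y0; have := @is_derive_nonincr R (fun t => sin t - t) (fun t => cos t - 1) 0 y y0.
by rewrite sin0 subrr subr_le0; apply => t _; rewrite subr_le0 cos_le1.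
Qed.

Lemma cos_ge_quadratic y : 0 <= y -> 1 - y ^+ 2 / 2 <= cos y.
Proof.
move=> y0; have := @is_derive_nonincr R (fun t => 1 - t ^+ 2 / 2 - cos t) (fun t => sin t - t) 0 y y0.
rewrite cos0 expr0n mul0r subr0 subrr subr_le0; apply => t; last first.
  by move=> /andP[t0 _]; rewrite subr_le0 sin_le_id.
move=> _; have h2 := is_deriveM (is_derive_id t (1 : R)) (is_derive_id t (1 : R)).
have h := is_deriveB (is_deriveB (is_derive_cst (1 : R) t 1) (is_deriveZ 2^-1 h2)) (is_derive_cos t).
apply: (is_derive_ext h); first by apply/funext => r; rewrite -[LHS]/(1 - 2^-1 * (r * r) - cos r) expr2 mulrC.
by rewrite /GRing.scale/=; field.
Qed.

Lemma sin_ge_half y : 0 <= y <= 1 -> y / 2 <= sin y.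
Proof.
move=> /andP[y0 y1]; have := @is_derive_nonincr R (fun t => 2^-1 * t - sin t) (fun t => 2^-1 * 1 - cos t) 0 y y0.
rewrite sin0 mulr0 subrr subr_le0 [_ * y]mulrC; apply => t /andP[t0 ty].
by have := cos_ge_quadratic t0; nra.
Qed.

Lemma sin_ge_linear y : 0 <= y <= pi / 2 -> y / 4 <= sin y.
Proof.
move=> /andP[y0 yp]; have [/andP[_ p2] _] := pihalf_02_cos_pihalf R.
have [y1|y1] := leP y 1.
  by apply: le_trans (sin_ge_half _); [lra|rewrite y0].
have s1 : 1 / 2 <= sin (1 : R) by apply: sin_ge_half; rewrite ler01 lexx.
have : - sin y <= - sin 1.
  apply: (@is_derive_nonincr R (fun t => - sin t) (fun t => - cos t) 1 y (ltW y1)) => t /andP[t0 ty].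
  rewrite oppr_le0; apply: cos_ge0_pihalf; rewrite (le_trans ty yp) andbT.
  by apply: (@le_trans _ _ 0); [rewrite oppr_le0 divr_ge0 ?pi_ge0|lra].
by lra.
Qed.

(** From 1 - cos t = 2 sin(t/2)^2 and sin y >= y / 4 on [0, pi/2]; the constant is 2 / 8^2. *)
Lemma cos_le_quadratic t : `|t| <= pi -> cos t <= 1 - t ^+ 2 / 32.
Proof.
wlog t0 : t / 0 <= t => [h tp|].
  have [t0|t0] := leP 0 t; first exact: h.
  by have := h (- t); rewrite cosN sqrrN normrN; apply => //; rewrite oppr_ge0 ltW.
rewrite ger0_norm// => tp; have hs := @sin_ge_linear (t / 2).
have : t / 2 / 4 <= sin (t / 2) by apply: hs; lra.
have -> : cos t = 1 - 2 * sin (t / 2) ^+ 2.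
  have {1}-> : t = t / 2 + t / 2 by lra.
  by rewrite cosD; have := cos2Dsin2 (t / 2); rewrite !expr2; lra.
by move: (sin _) => k; nra.
Qed.

Lemma normc_one_sub_cis s t : normc (1 - s%:C * cis t) ^+ 2 = (1 - s) ^+ 2 + 2 * s * (1 - cos t).
Proof.
rewrite sqr_normcE ReB ImB ReM_real ImM_real /=.
by have := cos2Dsin2 t => h; rewrite (_ : (1 - s * cos t) ^+ 2 + (0 - s * sin t) ^+ 2 =
  1 - 2 * s * cos t + s ^+ 2 * (cos t ^+ 2 + sin t ^+ 2)); [rewrite h; ring|ring].
Qed.

(** Since 2 s >= 1, [normc_one_sub_cis] and 1 - cos t >= t^2 / 32 give the factor 32. *)
Lemma normc_one_sub_cis_ge s t : 1 / 2 <= s <= 1 -> `|t| <= pi ->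
  (1 - s) ^+ 2 + t ^+ 2 <= 32 * normc (1 - s%:C * cis t) ^+ 2.
Proof.
move=> /andP[s0 s1] /cos_le_quadratic tp; rewrite normc_one_sub_cis.
by move: tp; move: (cos t) => c ?; nra.
Qed.

Lemma csum_geometric z : disc z -> csum (fun n => z ^+ n) = (1 - z)^-1.
Proof.
move=> zD; have g : geo (fun n => z ^+ n) by have := geo_expr (w := z^* ); rewrite conjCK; apply; apply/disc_normc; rewrite normc_conj; exact/disc_normc.
have z1 : 1 - z != 0.
  by rewrite subr_eq0; apply/eqP => e; have /disc_normc := zD; rewrite -e normc1 ltxx.
apply: (mulIf z1); rewrite mulVf// mulrBr mulr1 {1}(csumS g) expr0 mulrC -csumZ//.
by rewrite (_ : (fun n => z * z ^+ n) = fun n => z ^+ n.+1) ?addrK//; apply/funext => n; rewrite exprS.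
Qed.

Definition kernel w n : C := w^* ^+ n.

Lemma circle_series_kernel s (theta x : R) : 0 <= s < 1 ->
  circle_series (kernel (s%:C * cis theta)) x = (1 - s%:C * cis (x - theta))^-1.
Proof.
move=> s01; rewrite -csum_geometric; last exact: disc_circle.
rewrite /circle_series; congr csum; apply/funext => n.
by rewrite /kernel -exprMn conjM conj_real cis_conj -mulrA -cisD [- _ + _]addrC.
Qed.

Lemma continuous_normc_circle u : geo u -> continuous (fun x => normc (circle_series u x)).
Proof.
move=> hu x; have h : circle_series u y @[y --> x] --> circle_series u x by exact: continuous_circle_series.
exact: (cvg_normc h).
Qed.

Lemma measurable_circle_normc u (D : set R) : geo u -> measurable_fun D (fun x => normc (circle_series u x)).
Proof.
move=> hu; apply: measurable_continuous => x.
exact: continuous_normc_circle.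
Qed.

(** The Poisson estimate from Parseval: u(w) k_w(w) is the inner product of u k_w with k_w, where
    k_w(w) = 1 / (1 - |w|^2), and |k_w|^2 / k_w(w) is the Poisson kernel. *)
Lemma poisson_le u w a : geo u -> disc w ->
  ((pi *+ 2 * (normc (pser u w) / (1 - normc w ^+ 2)))%:E <=
  \int[lebesgue_measure]_(x in `[a, (a + pi *+ 2)%R])
    (normc (circle_series u x) * normc (circle_series (kernel w) x) ^+ 2)%:E)%E.
Proof.
move=> hu wD; have hk : geo (kernel w) := geo_expr wD.
have hc := geo_conv hu hk.
have [k k1 ke] := unimodular_Re (pser u w).
have hkc := geoZ k hc.
have ek : kernel w = fun n => 1 * w^* ^+ n by apply/funext => n; rewrite mul1r.
have wx : 0 < 1 - normc w ^+ 2.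
  by have /disc_normc := wD; have := normc_ge0 w; nra.
have e : normc (pser u w) / (1 - normc w ^+ 2) = dot (fun n => k * conv u (kernel w) n) (kernel w).
  rewrite [X in dot _ X]ek (dot_kernel 1 (geo_ss hkc) wD) conj1 mul1r.
  rewrite pserZ//; last exact: geo_conv_disc.
  rewrite pser_conv//; [|exact: geo_conv_disc..].
  rewrite pser_kernel// [w^* * w]mulrC mulr_conj.
  have -> : (1 - (normc w ^+ 2)%:C)^-1 = ((1 - normc w ^+ 2)^-1)%:C :> C.
    by rewrite realcV rmorphB rmorph1.
  by rewrite mulrA [_ * _%:C]mulrC ReM_real ke mulrC.
rewrite e -(parseval a hkc hk); apply: le_integral => //.
- apply: continuous_compact_integrable; first exact: segment_compact.
  apply: continuous_subspaceT => x; apply: cvg_Re; apply: cvgM; first exact: (continuous_circle_series hkc).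
  apply: cvg_conj; exact: (continuous_circle_series hk).
- apply: continuous_compact_integrable; first exact: segment_compact.
  apply: continuous_subspaceT => x; apply: cvgM; first exact: continuous_normc_circle.
  have h : normc (circle_series (kernel w) y) @[y --> x] --> normc (circle_series (kernel w) x) by exact: continuous_normc_circle.
  exact: (cvgM h h).
move=> x _; rewrite lee_fin; apply: le_trans (Re_le _) _.
by rewrite circle_seriesZ// circle_series_conv// !normcM normc_conj k1 mul1r -mulrA -expr2.
Qed.

(** Take the dyadic shell of t: for k > 0 it satisfies t >= 2^(k-1) d, whence the factor 4. *)
Lemma dyadic_bound (d t : R) n : 0 < d -> 0 <= t < 2 ^+ n * d ->
  exists k, [/\ (k <= n)%N, t < 2 ^+ k * d & (d ^+ 2 + t ^+ 2)^-1 <= 4 / (4 ^+ k * d ^+ 2)].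
Proof.
move=> d0 /andP[t0]; have d2 : 0 < d ^+ 2 by exact: exprn_gt0.
have t2 : 0 <= t ^+ 2 by exact: sqr_ge0.
elim: n => [|n IH] tn.
  exists 0%N; split => //; rewrite expr0 mul1r; apply: (@le_trans _ _ (d ^+ 2)^-1).
    by rewrite lef_pV2 ?posrE ?lerDl// ltr_pwDl.
  by rewrite ler_peMl ?invr_ge0 ?(ltW d2)//; lra.
have [/IH[k [kn tk hk]]|nt] := ltP t (2 ^+ n * d); first by exists k; split => //; exact: leqW.
exists n.+1; split => //; have p0 : (0 : R) < 4 ^+ n by exact: exprn_gt0.
have -> : 4 / (4 ^+ n.+1 * d ^+ 2) = (4 ^+ n * d ^+ 2)^-1 :> R.
  by rewrite exprS; field; rewrite !gt_eqF.
rewrite lef_pV2 ?posrE ?mulr_gt0//; last exact: ltr_pwDl.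
have -> : 4 ^+ n * d ^+ 2 = (2 ^+ n * d) ^+ 2.
  by rewrite exprMn -exprM mulnC exprM (_ : 2 ^+ 2 = 4 :> R)//; ring.
have : (2 ^+ n * d) ^+ 2 <= t ^+ 2.
  by rewrite lerXn2r// nnegrE// mulr_ge0 ?exprn_ge0// ltW.
by lra.
Qed.

End poisson.

(** * Weak-type estimate for the radial maximal function *)

Section maximal.
Variable R : realType.
Local Notation C := R[i].
Local Notation mu := (@lebesgue_measure R).
Implicit Types (x y t s r : R) (u v c : nat -> C) (z w : C).

Lemma kernel_dyadic s t n : 1 / 2 <= s < 1 -> `|t| <= pi -> pi < 2 ^+ n * (1 - s) ->
  exists k, [/\ (k < n.+1)%N, `|t| < 2 ^+ k * (1 - s) &
    normc ((1 - s%:C * cis t)^-1) ^+ 2 <= 128 / (4 ^+ k * (1 - s) ^+ 2)].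
Proof.
move=> /andP[s0 s1] tp pn; have d0 : 0 < 1 - s by rewrite subr_gt0.
have [|k [kn tk hk]] := @dyadic_bound R (1 - s) `|t| n d0.
  by rewrite normr_ge0 (le_lt_trans tp pn).
exists k; split => //; have h := @normc_one_sub_cis_ge R s t _ tp.
have {h} : (1 - s) ^+ 2 + t ^+ 2 <= 32 * normc (1 - s%:C * cis t) ^+ 2.
  by apply: h; rewrite s0 ltW.
rewrite normcV exprVn -[t ^+ 2]real_normK ?num_real//.
set A := (1 - s) ^+ 2 + _ in hk *; set B := normc _ ^+ 2 => AB.
have A0 : 0 < A by rewrite /A ltr_pwDl ?sqr_ge0// exprn_gt0.
have B0 : 0 < B by nra.
have h : B^-1 <= 32 * A^-1.
  by rewrite -[B^-1]mul1r ler_pdivrMr// mulrAC ler_pdivlMr// mul1r.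
apply: le_trans h _; rewrite (_ : 128 = 32 * 4 :> R); last by ring.
by rewrite -mulrA ler_wpM2l.
Qed.

Lemma sum_half_pow n : \sum_(0 <= k < n) (2^-1 : R) ^+ k <= 2.
Proof.
suff : \sum_(0 <= k < n) (2^-1 : R) ^+ k = 2 - 2 * 2^-1 ^+ n.
  by move=> ->; have : 0 <= (2^-1 : R) ^+ n by []; lra.
elim: n => [|n IH]; first by rewrite big_geq// expr0; ring.
by rewrite big_nat_recr//= IH exprS; field.
Qed.

(* If all ball averages of f at theta are at most lambda, so is the Poisson integral up to a constant:
   the Poisson kernel is dominated by a sum of dyadic box kernels. *)
Lemma poisson_maximal u (f : R -> R) s (theta lam : R) : geo u -> 1 / 2 <= s < 1 ->
  measurable_fun setT f -> (forall x, 0 <= f x) ->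
  (forall x, `|x - theta| <= pi -> normc (circle_series u x) <= f x) ->
  (forall r, 0 < r -> (\int[mu]_(x in ball theta r) (f x)%:E <= (r *+ 2 * lam)%:E)%E) ->
  normc (pser u (s%:C * cis theta)) <= 512 * lam.
Proof.
move=> hu /andP[s0 s1] mf f0 Ff hf; set w := s%:C * cis theta.
have s01 : 0 <= s < 1 by rewrite s1 andbT; lra.
have wD : disc w by exact: disc_circle.
have nw : normc w = s by rewrite normcM normc_cis mulr1 normc_real ger0_norm//; lra.
set d := 1 - s; have d0 : 0 < d by rewrite subr_gt0.
(* With this n the dyadic balls exhaust a full period around theta. *)
have [n hn] : exists n, pi < 2 ^+ n * d.
  have := archi_boundP (_ : 0 <= pi / d); rewrite divr_ge0 ?pi_ge0 ?(ltW d0)// => /(_ isT).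
  set m := Num.bound _ => h; exists m; rewrite -ltr_pdivrMr//; apply: lt_trans h _.
  by rewrite -natrX ltr_nat ltn_expl.
set a := theta - pi; pose D := `[a, (a + pi *+ 2)%R]%classic.
have mD : measurable D by exact: measurable_itv.
have Dx x : D x -> `|x - theta| <= pi.
  by rewrite /D/= in_itv/= /a => /andP[h1 h2]; rewrite ler_norml; move: h1 h2; rewrite mulr2n; move: pi => p; lra.
pose B k := ball theta (2 ^+ k * d); pose W k : R := 128 / (4 ^+ k * d ^+ 2).
have W0 k : 0 <= W k by rewrite divr_ge0// mulr_ge0 ?exprn_ge0// ltW.
have mB k : measurable (B k) by exact: measurable_ball.
pose fB k x := (f \_ (B k)) x.
have fB0 k x : 0 <= fB k x by rewrite /fB patchE; case: ifP.
have mfB k : measurable_fun setT (fB k).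
  by apply/(measurable_restrictT _ (mB k)); exact: measurable_funTS.
have mWf k : measurable_fun D (fun x => (W k * fB k x)%:E).
  apply/measurable_EFinP; exact: (measurable_funM (measurable_cst (W k)) (measurable_funTS (mfB k))).
have bound x : D x -> normc (circle_series u x) * normc (circle_series (kernel w) x) ^+ 2 <=
    \sum_(0 <= k < n.+1) W k * fB k x.
  move=> xD; have tp := Dx x xD; rewrite circle_series_kernel//.
  have [|k [kn tk hk]] := @kernel_dyadic s (x - theta) n _ tp hn; first by rewrite s0.
  have fk : fB k x = f x.
    by rewrite /fB patchE ifT// inE /B -ball_normE/= distrC.
  rewrite (bigD1_seq k) ?iota_uniq//=; last by rewrite mem_index_iota.
  apply: (@le_trans _ _ (W k * fB k x)).
    by rewrite mulrC fk; apply: ler_pM => //; rewrite ?sqr_ge0 ?normc_ge0//; exact: Ff.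
  by rewrite lerDl; apply: sumr_ge0 => i _; rewrite mulr_ge0.
(* The box of height W k lives on an interval of length 2^(k+1) d, which gives 256 lam / (2^k d);
   summing over k at most doubles the constant. *)
have intk k : (\int[mu]_(x in D) (W k * fB k x)%:E <= (256 * lam / d * 2^-1 ^+ k)%:E)%E.
  under eq_integral do rewrite EFinM.
  rewrite ge0_integralZl_EFin//; last 2 first.
  - by move=> x _; rewrite lee_fin.
  - apply/measurable_EFinP; exact: (measurable_funTS (mfB k)).
  have pk : 0 < 2 ^+ k * d by rewrite mulr_gt0// exprn_gt0.
  apply: (@le_trans _ _ ((W k)%:E * ((2 ^+ k * d) *+ 2 * lam)%:E)%E).
    apply: lee_wpmul2l; first by rewrite lee_fin.
    apply: le_trans (hf _ pk).
    have -> : (\int[mu]_(x in D) (fB k x)%:E = \int[mu]_(x in D `&` B k) (f x)%:E)%E.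
      rewrite integral_mkcondr; apply: eq_integral => x _.
      by rewrite /fB !patchE; case: ifP.
    apply: ge0_subset_integral.
    - exact: (measurableI _ _ mD (mB k)).
    - exact: mB.
    - by apply/measurable_EFinP; exact: (measurable_funTS mf).
    - by move=> x _; rewrite lee_fin.
    - by move=> x [].
  rewrite -EFinM lee_fin le_eqVlt; apply/orP; left; apply/eqP.
  have e4 : 4 ^+ k = 2 ^+ k * 2 ^+ k :> R by rewrite -exprMn; congr (_ ^+ _); ring.
  by rewrite /W e4 exprVn mulr2n; field; rewrite !gt_eqF// exprn_gt0.
have key : ((pi *+ 2 * (normc (pser u w) / (1 - s ^+ 2)))%:E <= (512 * lam / d)%:E)%E.
  rewrite -nw; apply: le_trans (poisson_le a hu wD) _.
  apply: (@le_trans _ _ (\int[mu]_(x in D) (\sum_(0 <= k < n.+1) (W k * fB k x)%:E))%E).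
    apply: ge0_le_integral => //.
    - by move=> x _; rewrite lee_fin mulr_ge0 ?normc_ge0 ?sqr_ge0.
    - apply/measurable_EFinP; apply: measurable_funM; first exact: measurable_circle_normc.
      by apply: measurable_funX; exact: measurable_circle_normc (geo_expr wD).
    - by apply: emeasurable_sum => k; exact: mWf.
    - by move=> x xD; rewrite sumEFin lee_fin; exact: bound.
  rewrite ge0_integral_sum//; last by move=> k x _; rewrite lee_fin mulr_ge0.
  apply: (@le_trans _ _ (\sum_(0 <= k < n.+1) (256 * lam / d * 2^-1 ^+ k)%:E)%E).
    by apply: lee_sum => k _; exact: intk.
  rewrite sumEFin lee_fin -big_distrr/=.
  have lam0 : 0 <= lam.
    have := hf 1 ltr01; rewrite -lee_fin.
    have : (0 <= \int[mu]_(x in ball theta 1) (f x)%:E)%E by apply: integral_ge0 => x _; rewrite lee_fin.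
    by move=> h1 h2; have := le_trans h1 h2; rewrite !lee_fin pmulr_rge0.
  apply: (@le_trans _ _ (256 * lam / d * 2)).
    apply: ler_wpM2l (@sum_half_pow n.+1); apply: divr_ge0 (ltW d0); exact: mulr_ge0.
  by rewrite le_eqVlt; apply/orP; left; apply/eqP; field; rewrite gt_eqF.
move: key; rewrite lee_fin -/w; set N := normc (pser u w) => key.
have N0 : 0 <= N by exact: normc_ge0.
have p2 := pi_ge2 R.
have e : 1 - s ^+ 2 = d * (1 + s) by rewrite /d; ring.
have s1p : 0 < 1 + s by lra.
have : pi *+ 2 * (N / (1 + s)) <= 512 * lam.
  move: key; rewrite e ler_pdivlMr//.
  by rewrite (_ : pi *+ 2 * (N / (d * (1 + s))) * d = pi *+ 2 * (N / (1 + s)))//; field; rewrite !gt_eqF.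
apply: le_trans; rewrite mulrA ler_pdivlMr// mulr2n.
by move: p2 N0; move: pi => p; nra.
Qed.

(** The pointwise inequality |u| <= (e^2 + |u|^2) / (2 e) replaces Cauchy-Schwarz; it is the reason
    for e > 0. *)
Lemma circle_mean_normc_le u (a e : R) : geo u -> 0 < e -> l2norm u <= e ->
  (\int[mu]_(x in `[a, (a + pi *+ 2)%R]) (normc (circle_series u x))%:E <= (pi *+ 2 * e)%:E)%E.
Proof.
move=> hu e0 ue; pose D := `[a, (a + pi *+ 2)%R]%classic.
have mD : measurable D by exact: measurable_itv.
pose q x := complex.Re (circle_series u x * (circle_series u x)^*).
have qE x : q x = normc (circle_series u x) ^+ 2 by rewrite sqr_normc_Re.
have mq : measurable_fun D q.
  rewrite (_ : q = fun x => normc (circle_series u x) ^+ 2); last exact/funext.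
  by apply: measurable_funX; exact: measurable_circle_normc.
have muD : (mu D = (pi *+ 2)%:E)%E.
  rewrite lebesgue_measure_itv/= lte_fin ltrDl mulrn_wgt0 ?pi_gt0// -EFinB.
  by rewrite addrC addrA addNr add0r.
apply: (@le_trans _ _ (\int[mu]_(x in D) (((2 * e)^-1)%:E * ((e ^+ 2)%:E + (q x)%:E)))%E).
  apply: ge0_le_integral => //.
  - by move=> x _; rewrite lee_fin normc_ge0.
  - by apply/measurable_EFinP; exact: measurable_circle_normc.
  - apply: emeasurable_funM; first exact: measurable_cst.
    by apply: emeasurable_funD; [exact: measurable_cst|exact/measurable_EFinP].
  - move=> x _; rewrite -EFinD -EFinM lee_fin qE mulrC ler_pdivlMr; last by rewrite mulr_gt0.
    by have := sqr_ge0 (e - normc (circle_series u x)); rewrite sqrrB; move: (normc _) => y; nra.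
rewrite ge0_integralZl_EFin//; last 3 first.
- by move=> x _; rewrite -EFinD lee_fin qE addr_ge0 ?sqr_ge0.
- by apply: emeasurable_funD; [exact: measurable_cst|exact/measurable_EFinP].
- by rewrite invr_ge0 mulr_ge0// ltW.
rewrite ge0_integralD//; last 3 first.
- by move=> x _; rewrite lee_fin sqr_ge0.
- by move=> x _; rewrite lee_fin qE sqr_ge0.
- exact/measurable_EFinP.
rewrite integral_cst// [X in (_ * (_ + X))%E](parseval a hu hu) (dot_sqr (geo_ss hu)).
rewrite [X in (_ * (_ * X + _))%E]muD.
rewrite -EFinM lee_fin.
have p0 : 0 < pi *+ 2 :> R by rewrite mulrn_wgt0// pi_gt0.
rewrite mulrC ler_pdivrMr; last by rewrite mulr_gt0.
have : l2norm u ^+ 2 <= e ^+ 2 by rewrite lerXn2r// nnegrE ?l2norm_ge0// ltW.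
by move: (l2norm u ^+ 2) p0 => l; move: (pi *+ 2) => p; nra.
Qed.

Lemma weak_type u (e lam : R) (A : set R) : geo u -> 0 < e -> l2norm u <= e -> 0 < lam ->
  measurable A -> (forall theta, A theta -> 0 <= theta <= pi *+ 2 /\
     exists2 s : R, 1 / 2 <= s < 1 & 512 * lam < normc (pser u (s%:C * cis theta))) ->
  (mu A <= (3 / lam * (pi *+ 4 * e))%:E)%E.
Proof.
move=> hu e0 ue lam0 mA hA; pose h x := normc (circle_series u x).
(* This interval contains the period centred at every theta in [0, 2 pi]; being two periods long, it
   produces [pi *+ 4]. *)
pose I := `[(- pi : R)%R, (pi *+ 3 : R)%R]%classic; have mI : measurable I by exact: measurable_itv.
pose f := h \_ I.
have p0 : 0 < pi :> R by exact: pi_gt0.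
have p2E : pi *+ 2 = 2 * pi :> R by rewrite mulr_natl.
have p3E : pi *+ 3 = 3 * pi :> R by rewrite mulr_natl.
have ih : mu.-integrable I (EFin \o h).
  apply: continuous_compact_integrable; first exact: segment_compact.
  by apply: continuous_subspaceT; exact: continuous_normc_circle.
have lf : locally_integrable setT f by exact: integrable_locally_restrict.
have f0 x : 0 <= f x by rewrite /f patchE; case: ifP => // _; exact: normc_ge0.
have mf : measurable_fun setT f by case: lf.
have max := maximal_inequality lf lam0.
have mHL : measurable [set x | (HL_maximal f x > lam%:E)%E].
  rewrite -[X in measurable X]setTI; apply: emeasurable_fun_o_infty => //.
  exact: measurable_HL_maximal.
have AH : A `<=` [set x | (HL_maximal f x > lam%:E)%E].
  move=> theta /hA[/andP[t0 tp] [s s1 hs]]; rewrite /= ltNge; apply/negP => hl.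
  move: hs; rewrite ltNge => /negP; apply; apply: (poisson_maximal hu s1 mf f0).
    move=> x; rewrite ler_norml => /andP[x1 x2]; rewrite /f patchE ifT// inE /I/= in_itv/=.
    by rewrite p3E; move: t0 tp x1 x2; rewrite p2E; move: pi p0 => p; lra.
  move=> r r0; have : (iavg f (ball theta r) <= lam%:E)%E.
    apply: le_trans hl; apply: ereal_sup_ubound; exists r => //=.
    by rewrite in_itv/= r0.
  have r2 : 0 < r *+ 2 by rewrite mulrn_wgt0.
  rewrite /iavg lebesgue_measure_ball ?(ltW r0)// inver (gt_eqF r2) lee_pdivrMl// -EFinM.
  apply: le_trans; rewrite le_eqVlt; apply/orP; left; apply/eqP.
  by apply: eq_integral => x _; rewrite gee0_abs// lee_fin.
have muA : (mu A <= mu [set x | (HL_maximal f x > lam%:E)%E])%E.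
  by apply: le_measure; rewrite ?inE.
apply: (le_trans muA); apply: (le_trans max); rewrite (EFinM (3 / lam)); apply: lee_wpmul2l; first by rewrite lee_fin divr_ge0// ltW.
have -> : (\int[mu]_(y in setT) `|(f y)%:E| = \int[mu]_(y in I) (h y)%:E)%E.
  rewrite [RHS]integral_mkcond; apply: eq_integral => x _.
  by rewrite /f !patchE; case: ifP => _; rewrite ?abse0// gee0_abs// lee_fin normc_ge0.
pose I1 := `[(- pi : R)%R, (- pi + pi *+ 2 : R)%R]%classic; pose J2 := `](- pi + pi *+ 2 : R)%R, (pi + pi *+ 2 : R)%R]%classic.
pose I2 := `[pi : R, (pi + pi *+ 2 : R)%R]%classic.
have IE : I = I1 `|` J2.
  apply/seteqP; split => x; rewrite /I /I1 /J2 /= !in_itv/=.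
    move=> /andP[x1 x2]; have [x3|x3] := leP x (- pi + pi *+ 2); [left|right]; rewrite ?x1 ?x3//=.
  by rewrite p2E p3E; move: pi p0 => p p0 [|] /andP[x1 x2]; lra.
have mh D : measurable_fun D (fun x => (h x)%:E) by apply/measurable_EFinP; exact: measurable_circle_normc.
have mI1 : measurable I1 by exact: measurable_itv.
have mJ2 : measurable J2 by exact: measurable_itv.
have dj : [disjoint I1 & J2]%classic.
  rewrite disj_set2E; apply/eqP/seteqP; split => // x []; rewrite /I1 /J2 /= !in_itv/= => /andP[_ x1] /andP[x2 _].
  by have := lt_le_trans x2 x1; rewrite ltxx.
have h0 x : (I1 `|` J2) x -> (0 <= (h x)%:E)%E by move=> _; rewrite lee_fin normc_ge0.
rewrite IE ge0_integral_setU; [|exact: mI1|exact: mJ2|exact: mh|exact: h0|exact: dj].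
have -> : (pi *+ 4 * e)%:E = ((pi *+ 2 * e)%:E + (pi *+ 2 * e)%:E)%E :> \bar R.
  by rewrite -EFinD -mulrDl -mulrnDr.
apply: leeD; first exact: circle_mean_normc_le.
apply: le_trans (circle_mean_normc_le pi hu e0 ue).
apply: ge0_subset_integral => //.
- exact: mh.
- by move=> x _; rewrite lee_fin normc_ge0.
- move=> x; rewrite /J2 /= !in_itv/= => /andP[x1 ->]; rewrite andbT.
  by move: x1; rewrite p2E; move: pi p0 => p; lra.
Qed.

Lemma weak_type_const : exists2 K : R, 0 < K & forall u (e lam : R) (A : set R),
  geo u -> 0 < e -> l2norm u <= e -> 0 < lam ->
  measurable A -> (forall theta, A theta -> 0 <= theta <= pi *+ 2 /\
     exists2 s : R, 1 / 2 <= s < 1 & lam < normc (pser u (s%:C * cis theta))) ->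
  (mu A <= (K / lam * e)%:E)%E.
Proof.
have k0 : (0 : R) < 512 by rewrite ltr0n.
move: weak_type k0; move: (512 : R) => k hk k0; exists (3 * k * (pi *+ 4)).
  by apply: mulr_gt0; [exact: mulr_gt0|rewrite mulrn_wgt0// pi_gt0].
move=> u e lam A hu e0 ue lam0 mA hA.
have e1 : 3 * k * (pi *+ 4) / lam * e = 3 / (lam / k) * (pi *+ 4 * e).
  by move: (pi *+ 4) => p; field; rewrite !gt_eqF.
have lk : 0 < lam / k by exact: divr_gt0.
rewrite e1; apply: (hk u e (lam / k) A hu e0 ue lk mA).
by move=> theta /hA[t [s s1 hs]]; split => //; exists s => //; rewrite mulrC divfK// gt_eqF.
Qed.

End maximal.

(** * Almost everywhere existence of radial limits *)

Section fatou.
Variable R : realType.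
Local Notation C := R[i].
Local Notation ss := square_summable.
Local Notation mu := (@lebesgue_measure R).
Implicit Types (theta r lam e : R) (c : nat -> C).

Let geo_dilate c r : conv_disc c -> 0 <= r < 1 -> geo (dilate c r).
Proof. by move=> hc r01; exact: hc. Qed.

Lemma l2norm_dilate c r : ss c -> 0 <= r <= 1 -> l2norm (dilate c r) <= l2norm c.
Proof.
move=> sc /andP[r0 r1]; apply: proj2 (@ss_partial_le R (dilate c r) (l2norm c) _ (l2norm_ge0 _)) => N.
apply: le_trans (ss_partial N sc); apply: ler_sum => n _.
rewrite /dilate normcM normcX normc_real ger0_norm// lerXn2r// ?nnegrE ?mulr_ge0 ?normc_ge0 ?exprn_ge0//.
by rewrite ler_piMr ?normc_ge0// exprn_ile1.
Qed.

(** Superlevel set of a radial maximal function. Radii start at 1/2, where the kernel estimates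
    hold; rho < 1 allows a dilation to geometric decay, and rho = 1 is the case of interest. *)
Definition exceed c lam (rho : R) : set R := [set theta | 0 <= theta <= pi *+ 2 /\
  exists2 r, 1 / 2 <= r < rho & lam < normc (pser c (r%:C * cis theta))].

Lemma measurable_exceed c lam rho : conv_disc c -> rho <= 1 -> measurable (exceed c lam rho).
Proof.
move=> hc rho1; pose h r theta := normc (pser c (r%:C * cis theta)).
have -> : exceed c lam rho = `[0%R, (pi *+ 2 : R)%R]%classic `&`
    \bigcup_(r in [set r | 1 / 2 <= r < rho]) (h r @^-1` [set y | lam < y]).
  apply/seteqP; split => theta; rewrite /exceed /= in_itv/=.
    by move=> [-> [r r1 hr]]; split => //; exists r.
  by move=> [-> [r r1 hr]]; split => //; exists r.
apply: measurableI; first exact: measurable_itv.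
(* The union over r is uncountable, but each set in it is open. *)
apply: open_measurable; apply: bigcup_open => r /= /andP[r0 r1].
apply: open_comp; last exact: open_gt.
move=> theta _; have h1 : pser c (r%:C * cis x) @[x --> theta] --> pser c (r%:C * cis theta).
  by apply: continuous_pser_circle => //; rewrite (lt_le_trans r1 rho1) andbT; lra.
exact: (cvg_normc h1).
Qed.

(** Dilating by rho gives geometric decay without increasing the norm; the radius r becomes r / rho,
    still in [1/2, 1[. *)
Lemma exceed_lt_le : exists2 K : R, 0 < K & forall c lam e rho, ss c -> 0 < rho < 1 -> 0 < e ->
  l2norm c <= e -> 0 < lam -> (mu (exceed c lam rho) <= (K / lam * e)%:E)%E.
Proof.
have [K K0 hK] := weak_type_const R; exists K => // c lam e rho sc /andP[rho0 rho1] e0 ce lam0.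
have hc := square_summable_conv_disc sc.
have rho01 : 0 <= rho < 1 by rewrite (ltW rho0).
apply: (hK (dilate c rho)) => //.
- exact: geo_dilate.
- by apply: le_trans ce; apply: l2norm_dilate => //; rewrite (ltW rho0) ltW.
- by apply: measurable_exceed => //; exact: ltW.
move=> theta [-> [r /andP[r0 r1] hr]]; split => //; exists (r / rho).
  apply/andP; split; last by rewrite ltr_pdivrMr// mul1r.
  rewrite ler_pdivlMr//; move: r0 rho1 {r1 hr rho01}; lra.
suff -> : pser (dilate c rho) ((r / rho)%:C * cis theta) = pser c (r%:C * cis theta) by [].
rewrite /pser /dilate; congr csum; apply/funext => n.
rewrite -mulrA -exprMn mulrA -rmorphM; congr (_ * (_%:C * _) ^+ n).
by rewrite mulrC divfK ?gt_eqF.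
Qed.

(** The constant does not depend on rho, so continuity of the measure along an increasing union
    reaches rho = 1. *)
Lemma radial_maximal_weak : exists2 K : R, 0 < K & forall c lam e, ss c -> 0 < e ->
  l2norm c <= e -> 0 < lam -> (mu (exceed c lam 1) <= (K / lam * e)%:E)%E.
Proof.
have [K K0 hK] := exceed_lt_le; exists K => // c lam e sc e0 ce lam0.
have hc := square_summable_conv_disc sc.
pose rho n : R := 1 - (n.+2%:R)^-1.
have rho1 n : 0 < rho n < 1.
  rewrite /rho subr_gt0 invf_lt1// ltr1n/= ltrBlDr ltrDl.
  by rewrite invr_gt0.
pose F n := exceed c lam (rho n).
have mF n : measurable (F n) by apply: measurable_exceed => //; case/andP: (rho1 n) => _ /ltW.
have UF : \bigcup_n F n = exceed c lam 1.
  apply/seteqP; split => theta.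
    move=> [n _ [t [r /andP[r0 r1] hr]]]; split => //; exists r => //; rewrite r0/=.
    by apply: lt_trans r1 _; case/andP: (rho1 n).
  move=> [t [r /andP[r0 r1] hr]].
  have d0 : 0 < 1 - r by rewrite subr_gt0.
  have := archi_boundP (_ : 0 <= (1 - r)^-1); rewrite invr_ge0 (ltW d0) => /(_ isT).
  set n := Num.bound _ => hn; exists n => //; split => //; exists r => //; rewrite r0/= /rho.
  rewrite ltrBrDr -ltrBrDl invf_plt ?posrE//.
  by apply: lt_trans hn _; rewrite ltr_nat.
have nd : {homo F : n m / (n <= m)%N >-> (n <= m)%O}.
  move=> n m nm; apply/subsetPset => theta [t [r /andP[r0 r1] hr]]; split => //; exists r => //.
  rewrite r0/=; apply: lt_le_trans r1 _.
  by rewrite /rho lerD2l lerN2 lef_pV2 ?posrE// ler_nat.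
have mU : measurable (\bigcup_n F n) by exact: bigcupT_measurable.
have h : mu (F n) @[n --> \oo] --> mu (exceed c lam 1).
  by rewrite -UF; exact: (@nondecreasing_cvg_mu _ _ _ mu F mF mU nd).
apply: (lee_cvg_to h (cvg_cst _)); apply: nearW => n.
exact: hK.
Qed.

(** A polynomial part has a radial limit, and the tail stays below 1 / (m + 1) near the circle;
    together this is the Cauchy property. *)
Lemma radial_cvg_of_tails c theta : ss c -> 0 <= theta <= pi *+ 2 ->
  (forall m : nat, exists N, ~ exceed (fun n => c n - trunc c N n) (m.+1%:R^-1) 1 theta) ->
  exists l : C, pser c (r%:C * cis theta) @[r --> (1 : R)^'-] --> l.
Proof.
move=> sc t0 H; apply: complex_cauchy_cvg => e e0.
have := archi_boundP (_ : 0 <= (e / 2)^-1); rewrite invr_ge0 divr_ge0 ?(ltW e0)// => /(_ isT).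
set m := Num.bound _ => hm; have [N hN] := H m.
exists (\sum_(0 <= n < N) c n * cis theta ^+ n).
have hl : \sum_(0 <= n < N) dilate c r n * cis theta ^+ n @[r --> (1 : R)^'-] -->
    \sum_(0 <= n < N) c n * cis theta ^+ n.
  by apply: cvg_sum => n; exact: (cvgM (@dilate_cvg R c n) (cvg_cst (cis theta ^+ n))).
have e2 : 0 < e / 2 by rewrite divr_gt0.
have /cvg_normcP/cvgrPdist_lt/(_ _ e2) h2 := hl.
have hs : ss (fun n => c n - trunc c N n) by exact: ssB sc (@ss_trunc R c N).
have m1 : (m.+1%:R : R)^-1 < e / 2.
  rewrite invf_plt ?posrE// ; apply: lt_trans hm _.
  by rewrite ltr_nat.
near=> r.
have r1 : r < 1 by near: r; exact: nbhs_left_lt.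
have r2 : 1 / 2 <= r by near: r; apply: nbhs_left_ge; lra.
have zD : disc (r%:C * cis theta) by apply: disc_circle; rewrite r1 andbT; lra.
have small : normc (pser (fun n => c n - trunc c N n) (r%:C * cis theta)) <= m.+1%:R^-1.
  rewrite leNgt; apply/negP => hr; apply: hN; split => //; exists r; first by rewrite r2.
  exact: hr.
have : `|0 - normc (\sum_(0 <= n < N) dilate c r n * cis theta ^+ n - \sum_(0 <= n < N) c n * cis theta ^+ n)| < e / 2.
  by near: r; exact: h2.
rewrite sub0r normrN ger0_norm ?normc_ge0// => h3.
have ht : pser (trunc c N) (r%:C * cis theta) = \sum_(0 <= n < N) dilate c r n * cis theta ^+ n.
  apply: csum_unique; apply: cvg_near_cst; near=> M.
  have NM : (N <= M)%N by near: M; exact: nbhs_infty_ge.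
  have z : \sum_(N <= n < M) trunc c N n * (r%:C * cis theta) ^+ n = 0.
    by rewrite big_nat big1// => n /andP[Nn _]; rewrite /trunc ltnNge Nn mul0r.
  rewrite /series/= (big_cat_nat (n := N))//= z addr0; apply: eq_big_nat => n /andP[_ nN].
  by rewrite /trunc nN /dilate exprMn mulrA.
have split : pser c (r%:C * cis theta) =
    pser (fun n => c n - trunc c N n) (r%:C * cis theta) + pser (trunc c N) (r%:C * cis theta).
  rewrite -pserD//; last 2 first.
  - exact: square_summable_conv_disc.
  - exact: square_summable_conv_disc (@ss_trunc R c N).
  by congr pser; apply/funext => n; rewrite subrK.
rewrite split ht -addrA; apply: le_lt_trans (le_normcD _ _) _.
by rewrite [ltRHS]splitr; exact: ltrD (le_lt_trans small m1) h3.
Unshelve. all: by end_near. Qed.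

(** Divergence at theta forces, for some m, the maximal function of every tail above 1 / (m + 1).
    For fixed m the weak-type bound is proportional to the norm of the tail, which tends to 0. *)
Lemma fatou c : ss c -> mu.-negligible [set theta : R | 0 <= theta <= pi *+ 2 /\
  ~ exists l : C, pser c (r%:C * cis theta) @[r --> (1 : R)^'-] --> l].
Proof.
move=> sc; pose A m N := exceed (fun n => c n - trunc c N n) (m.+1%:R^-1 : R) 1.
have st N : ss (fun n => c n - trunc c N n) by exact: ssB sc (@ss_trunc R c N).
have mA m N : measurable (A m N).
  by apply: measurable_exceed => //; exact: square_summable_conv_disc.
have hS : [set theta : R | 0 <= theta <= pi *+ 2 /\ ~ exists l : C, pser c (r%:C * cis theta) @[r --> (1 : R)^'-] --> l]
    `<=` \bigcup_m \bigcap_N A m N.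
  move=> theta [t0 nl]; apply: contrapT => hA; apply: nl.
  apply: (radial_cvg_of_tails sc t0) => m; apply: contrapT => hN; apply: hA.
  by exists m => // N _; apply: contrapT => hh; apply: hN; exists N.
suff [B [mB B0 sB]] : mu.-negligible (\bigcup_m \bigcap_N A m N).
  by exists B; split => //; exact: subset_trans hS sB.
apply: negligible_bigcup => m; exists (\bigcap_N A m N); split => //.
  by apply: bigcapT_measurable => N; exact: mA.
apply/eqP; rewrite eq_le measure_ge0 andbT; apply/lee_addgt0Pr => e e0; rewrite add0e.
have lam0 : 0 < (m.+1%:R^-1 : R) by rewrite invr_gt0.
have [M M0 hM] := radial_maximal_weak.
pose K : R := M / m.+1%:R^-1; have K0 : 0 < K by exact: divr_gt0.
have eK : 0 < e / K by exact: divr_gt0.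
have /cvgrPdist_lt/(_ _ eK)[N _ /(_ N (leqnn N))] := trunc_cvg sc.
rewrite sub0r normrN ger0_norm ?l2norm_ge0// => hN.
apply: (@le_trans _ _ (mu (A m N))).
  apply: le_measure; rewrite ?inE; [|exact: mA|by move=> x; apply].
  by apply: bigcapT_measurable => k; exact: mA.
apply: le_trans (hM _ _ _ (st N) eK (ltW hN) lam0) _.
by rewrite lee_fin -/K mulrC divfK// gt_eqF.
Qed.

End fatou.

(** * Boundary values *)

Section boundary.
Variable R : realType.
Local Notation C := R[i].
Local Notation ss := square_summable.
Local Notation mu := (@lebesgue_measure R).
Implicit Types (theta r : R) (g q : nat -> C) (G : H2 R).

Lemma circle_mean_tform g q N r : conv_disc g -> 0 <= r < 1 ->
  (forall n, (N <= n)%N -> q n = 0) ->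
  (\int[mu]_(x in `[0%R, (0 + pi *+ 2)%R])
    (complex.Re ((cis x)^* * pser g (r%:C * cis x)) * normc (circle_series q x) ^+ 2)%:E =
   (pi *+ 2 * tform (dilate g r) q N)%:E)%E.
Proof.
move=> hg r01 hq; have gq := geo_fin hq; have gg : geo (dilate g r) := hg r r01.
rewrite /tform -(dot_shift (conv (dilate g r) q) hq) -(parseval 0 (geo_conv gg gq) (geo_shiftr gq)).
apply: eq_integral => x _; congr (_%:E).
rewrite circle_series_conv// circle_series_shift// circle_series_dilate.
set Q := circle_series q x; set P := pser _ _.
have -> : P * Q * (cis x * Q)^* = (normc Q ^+ 2)%:C * ((cis x)^* * P).
  by rewrite -mulr_conj conjM; ring.
by rewrite ReM_real mulrC.
Qed.

(** The cut at K allows dominated convergence, the cut at 0 keeps only the part of y that has to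
    vanish in the limit. *)
Definition clip (K y : R) : R := Num.min (Num.max y 0) K.

Lemma continuous_clip K : continuous (clip K).
Proof.
move=> y; apply/cvgrPdist_lt => e e0.
have h : (y' : R) @[y' --> y] --> y by exact: cvg_id.
move/cvgrPdist_lt : h => /(_ e e0); apply: filterS => x; apply: le_lt_trans.
rewrite /clip ![Num.min _ K]minC; apply: le_trans (min_lipschitz _ _ _) _.
by rewrite ![Num.max _ 0]maxC; exact: max_lipschitz.
Qed.

Lemma clip_ge0 K y : 0 <= K -> 0 <= clip K y.
Proof. by move=> K0; rewrite /clip le_min K0 andbT le_max lexx orbT. Qed.

Lemma clip_le K y : clip K y <= K.
Proof. by rewrite /clip ge_min lexx orbT. Qed.

Lemma clip0 K y : 0 <= K -> y <= 0 -> clip K y = 0.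
Proof. by move=> K0 y0; rewrite /clip max_r// min_l. Qed.

(** Beyond K one has y <= y^2 / K: the mass lost by clipping is controlled by the L^2 norm, which is
    the uniform integrability needed below. *)
Lemma le_clip_sqr K y : 0 < K -> y <= clip K y + y ^+ 2 / K.
Proof.
move=> K0; have [yK|Ky] := leP y K.
  apply: (@le_trans _ _ (clip K y)); last by rewrite lerDl divr_ge0 ?sqr_ge0 ?ltW.
  by rewrite /clip le_min yK le_max lexx.
apply: (@le_trans _ _ (y ^+ 2 / K)); last by rewrite lerDr clip_ge0// ltW.
by rewrite ler_pdivlMr// expr2 ler_wpM2l// ltW// (lt_trans K0).
Qed.

Lemma circle_series_normc_bound q : geo q -> exists2 M : R, 0 <= M &
  forall x, normc (circle_series q x) <= M.
Proof.
move=> gq; have [M M0 hM] := circle_series_bound gq; exists M => // x.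
have h : series (fun n => q n * cis x ^+ n) @ \oo --> circle_series q x by exact: circle_series_cvg.
apply: (ler_cvg_to (cvg_normc h) (cvg_cst M)).
by apply: nearW => N; exact: hM.
Qed.

(** With h the integrand of the circle mean at radius rho n, bound h by clip K h + h^2 / K. The
    clipped part tends boundedly to 0 almost everywhere, the limit of h being nonpositive; the rest
    has mean at most M^4 |g|^2 / K, and K is arbitrary. *)
Lemma boundary_toeplitz g : ss g ->
  mu.-negligible [set theta : R | 0 <= theta <= pi *+ 2 /\
    ~ exists2 l : C, pser g (r%:C * cis theta) @[r --> (1 : R)^'-] --> l &
        complex.Re ((cis theta)^* * l) <= 0] ->
  toeplitz_dissipative g.
Proof.
move=> sg hneg N q hq; rewrite -/(tform g q N).
have hg := square_summable_conv_disc sg; have gq := geo_fin hq.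
have [M M0 hM] := circle_series_normc_bound gq.
(* Dominated convergence works along sequences, so the left limit at 1 is sampled at radii in [0,
   1[. *)
pose rho n : R := 1 - 2^-1 * 2^-1 ^+ n.
have rho1 n : 0 <= rho n < 1.
  have : 0 < (2^-1 : R) ^+ n by rewrite exprn_gt0// invr_gt0.
  have : (2^-1 : R) ^+ n <= 1 by rewrite exprn_ile1// ?invr_ge0// invf_le1// ler1n.
  by rewrite /rho; move: (2^-1 ^+ n) => y; lra.
have rhoc : rho n @[n --> \oo] --> (1 : R).
  have h0 : 2^-1 * 2^-1 ^+ n @[n --> \oo] --> (0 : R).
    by apply: cvg_geo0; rewrite invr_ge0 ler0n invf_lt1// ltr1n.
  have h : rho n @[n --> \oo] --> (1 - 0 : R) by apply: cvgB; [exact: cvg_cst|exact: h0].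
  by apply: (cvg_conv h) => //; rewrite subr0.
have seqlim (f : R -> R) (l : R) : f r @[r --> (1 : R)^'-] --> l -> f (rho n) @[n --> \oo] --> l.
  move=> hf; apply: (proj1 (cvg_at_leftP f 1 l) hf); split; last exact: rhoc.
  by move=> n; case/andP: (rho1 n).
pose D := `[0%R, (0 + pi *+ 2 : R)%R]%classic; have mD : measurable D by exact: measurable_itv.
pose h n x := complex.Re ((cis x)^* * pser g ((rho n)%:C * cis x)) * normc (circle_series q x) ^+ 2.
have cP n x : pser g ((rho n)%:C * cis y) @[y --> x] --> pser g ((rho n)%:C * cis x).
  exact: continuous_pser_circle.
have ch n : continuous (h n).
  move=> x; have c1 : (cis y)^* @[y --> x] --> ((cis x)^* : C) by apply: cvg_conj; exact: continuous_cis.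
  have c2 : normc (circle_series q y) @[y --> x] --> normc (circle_series q x) by exact: continuous_normc_circle.
  exact: (cvgM (cvg_Re (cvgM c1 (cP n x))) (cvgM c2 c2)).
have p0 : 0 < pi *+ 2 :> R by rewrite mulrn_wgt0// pi_gt0.
have tl : tform (dilate g (rho n)) q N @[n --> \oo] --> tform g q N.
  by apply: (seqlim (fun r => tform (dilate g r) q N)); apply: cvg_tform => n; exact: dilate_cvg.
have key K : 0 < K -> pi *+ 2 * tform g q N <= pi *+ 2 * (M ^+ 4 / K * l2norm g ^+ 2).
  move=> K0; pose B := pi *+ 2 * (M ^+ 4 / K * l2norm g ^+ 2).
  pose F n x := (clip K (h n x))%:E.
  have cc n : continuous (fun x => clip K (h n x)).
    move=> x; have hx : h n y @[y --> x] --> h n x by exact: ch.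
    exact: (cvg_comp _ _ hx (@continuous_clip K (h n x))).
  have hF n : ((pi *+ 2 * tform (dilate g (rho n)) q N - B)%:E <= \int[mu]_(x in D) F n x)%E.
    rewrite EFinB leeBlDr// -(circle_mean_tform hg (rho1 n) hq).
    have gn : geo (dilate g (rho n)) by exact: hg.
    pose s x := complex.Re (circle_series (dilate g (rho n)) x * (circle_series (dilate g (rho n)) x)^*).
    have sE x : s x = normc (pser g ((rho n)%:C * cis x)) ^+ 2.
      by rewrite /s -sqr_normc_Re circle_series_dilate.
    have MK : 0 <= M ^+ 4 / K by rewrite divr_ge0 ?exprn_ge0// ltW.
    have cs : continuous s.
      move=> x; have c1 : circle_series (dilate g (rho n)) y @[y --> x] --> circle_series (dilate g (rho n)) x.
        exact: continuous_circle_series.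
      exact: (cvg_Re (cvgM c1 (cvg_conj c1))).
    apply: (@le_trans _ _ (\int[mu]_(x in D) (F n x + (M ^+ 4 / K)%:E * (s x)%:E))%E).
      apply: le_integral => //.
      - by apply: (@continuous_compact_integrable R (h n)); [exact: segment_compact|apply: continuous_subspaceT; exact: ch].
      - apply: (@continuous_compact_integrable R (fun x => clip K (h n x) + M ^+ 4 / K * s x)); first exact: segment_compact.
        apply: continuous_subspaceT => x.
        have c1 : clip K (h n y) @[y --> x] --> clip K (h n x) by exact: cc.
        have c2 : s y @[y --> x] --> s x by exact: cs.
        exact: (cvgD c1 (cvgM (cvg_cst (M ^+ 4 / K)) c2)).
      - move=> x _; rewrite /F -EFinM -EFinD lee_fin.
        apply: (le_trans (le_clip_sqr (h n x) K0)); rewrite lerD2l [leRHS]mulrAC.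
        apply: ler_wpM2r; first by rewrite invr_ge0 ltW.
        rewrite /h exprMn mulrC sE -exprM.
        have a1 : normc (circle_series q x) ^+ (2 * 2) <= M ^+ 4.
          by rewrite lerXn2r// nnegrE ?normc_ge0.
        have a2 : complex.Re ((cis x)^* * pser g ((rho n)%:C * cis x)) ^+ 2 <= normc (pser g ((rho n)%:C * cis x)) ^+ 2.
          rewrite -[leLHS]real_normK ?num_real// lerXn2r// ?nnegrE ?normc_ge0//.
          by apply: le_trans (abs_Re_le _) _; rewrite normcM normc_conj normc_cis mul1r.
        by apply: ler_pM a1 a2; [rewrite exprn_ge0// normc_ge0|exact: sqr_ge0].
    rewrite ge0_integralD//; last 4 first.
    - by move=> x _; rewrite lee_fin clip_ge0// ltW.
    - by apply/measurable_EFinP; exact: measurable_continuous.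
    - by move=> x _; rewrite -EFinM lee_fin mulr_ge0// sE sqr_ge0.
    - apply: emeasurable_funM; first exact: measurable_cst.
      by apply/measurable_EFinP; exact: measurable_continuous.
    apply: leeD2l; rewrite ge0_integralZl_EFin//; last 2 first.
    - by move=> x _; rewrite lee_fin sE sqr_ge0.
    - by apply/measurable_EFinP; exact: measurable_continuous.
    rewrite [X in (_ * X)%E](parseval 0 gn gn) -EFinM lee_fin (dot_sqr (geo_ss gn)) mulrCA /B.
    apply: ler_wpM2l; first exact: ltW.
    apply: ler_wpM2l => //; rewrite lerXn2r// ?nnegrE ?l2norm_ge0//.
    by apply: l2norm_dilate => //; case/andP: (rho1 n) => -> /ltW ->.
  have iK : mu.-integrable D (EFin \o cst K).
    by apply: continuous_compact_integrable; [exact: segment_compact|apply: continuous_subspaceT => x; exact: cvg_cst].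
  have aeF : \forall x \ae mu, D x -> F n x @[n --> \oo] --> (cst 0%E : R -> \bar R) x.
    case: hneg => Z [mZ Z0 ZS]; exists Z; split => // x /= hx; apply: ZS; split.
      by apply: contrapT => hD; apply: hx => xD; case: hD; move: xD; rewrite /D/= in_itv/= add0r.
    move=> [l hl l0]; apply: hx => _; apply/cvg_EFin; first exact: nearW.
    pose y := complex.Re ((cis x)^* * l) * normc (circle_series q x) ^+ 2.
    have hy : h n x @[n --> \oo] --> y.
      apply: cvgM; last exact: cvg_cst.
      apply: (seqlim (fun r => complex.Re ((cis x)^* * pser g (r%:C * cis x)))).
      exact: (cvg_Re (cvgM (cvg_cst _) hl)).
    have y0 : y <= 0 by rewrite /y mulr_le0_ge0 ?sqr_ge0.
    have hc : clip K (h n x) @[n --> \oo] --> clip K y.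
      exact: (cvg_comp _ _ hy (@continuous_clip K y)).
    by rewrite (clip0 (ltW K0) y0) in hc.
  have [|||_ _ l] := @dominated_convergence _ _ R mu D mD F (cst 0%E) (EFin \o cst K) _ _ aeF iK.
  - by move=> n; apply/measurable_EFinP; exact: measurable_continuous.
  - exact: measurable_cst.
  - apply: aeW => x n _; rewrite /F /= lee_fin ger0_norm ?clip_le//.
    by apply: clip_ge0; exact: ltW.
  rewrite integral0 in l.
  have l2 : (pi *+ 2 * tform (dilate g (rho n)) q N - B)%:E @[n --> \oo] --> (pi *+ 2 * tform g q N - B)%:E.
    apply/cvg_EFin; first exact: nearW.
    exact: (cvgB (cvgM (cvg_cst _) tl) (cvg_cst B)).
  have le0 : ((pi *+ 2 * tform g q N - B)%:E <= 0)%E.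
    by apply: (lee_cvg_to l2 l); apply: nearW; exact: hF.
  by move: le0; rewrite lee_fin subr_le0.
rewrite leNgt; apply/negP => t0.
have A0 : 0 <= M ^+ 4 * l2norm g ^+ 2 by rewrite mulr_ge0 ?exprn_ge0 ?l2norm_ge0.
(* With this K the error M^4 |g|^2 / K is smaller than the supposedly positive form. *)
have K0 : 0 < (M ^+ 4 * l2norm g ^+ 2 + 1) / tform g q N by rewrite divr_gt0// ltr_wpDl.
have := key _ K0; rewrite ler_pM2l// mulrAC ler_pdivlMr// mulrC divfK ?gt_eqF//.
by move: (M ^+ 4 * l2norm g ^+ 2) => A; lra.
Qed.

Lemma radial_limitE G theta (l : C) :
  pser (coef G) (r%:C * cis theta) @[r --> (1 : R)^'-] --> l -> radial_limit G (cis theta) = l.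
Proof.
move=> hl; apply: cvg_lim; first exact: norm_hausdorff.
apply: cvg_trans hl; apply: near_eq_cvg; near=> r.
have r0 : 0 < r by near: r; exact: nbhs_left_gt.
have r1 : r < 1 by near: r; exact: nbhs_left_lt.
by rewrite H2E//; apply: disc_circle; rewrite r1 ltW.
Unshelve. all: by end_near. Qed.

Lemma ess_sup_toeplitz G :
  (ess_sup (circle_measure R) (fun theta : R =>
     (complex.Re ((cis theta)^* * radial_limit G (cis theta)))%:E) <= 0)%E ->
  toeplitz_dissipative (coef G).
Proof.
move=> /ess_supP[Z [mZ Z0 ZS]]; apply: boundary_toeplitz (ss_coef G) _.
have [Z2 [mZ2 Z20 Z2S]] := fatou (ss_coef G).
(* [Z] is null for the restricted measure, so only its part in [0, 2 pi[ is Lebesgue null; the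
   endpoint 2 pi is added separately. [Z2] removes the angles at which [radial_limit] is only a
   default value. *)
pose Z1 := Z `&` `[0%R, (pi *+ 2 : R)%R[%classic.
have nU : mu.-negligible (Z1 `|` Z2 `|` [set pi *+ 2 : R]).
  apply: negligibleU; first apply: negligibleU.
  - by exists Z1; split => //; apply: measurableI => //; exact: measurable_itv.
  - by exists Z2; split; [exact: mZ2|exact: Z20|exact: subset_refl].
  - by exists [set pi *+ 2 : R]; split => //; exact: lebesgue_measure_set1.
case: nU => A [mA A0 AS]; exists A; split => //; apply: subset_trans AS.
move=> theta [/andP[t0 t2] hl].
have [e|tp] := eqVneq theta (pi *+ 2); first by right.
left; have [hx|hx] := pselect (exists l : C, pser (coef G) (r%:C * cis theta) @[r --> (1 : R)^'-] --> l).
  left; split; last by rewrite /= in_itv/= t0 lt_neqAle tp t2.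
  apply: ZS => /= h0; case: hx => l ll; apply: hl; exists l => //.
  by rewrite (radial_limitE ll) lee_fin in h0.
by right; apply: Z2S; split => //; rewrite t0.
Qed.

Lemma inward_ess_sup G (K : R) :
  (forall z, disc z -> complex.Re (z^* * pser (coef G) z) <= K * (1 - normc z ^+ 2)) ->
  (ess_sup (circle_measure R) (fun theta : R =>
     (complex.Re ((cis theta)^* * radial_limit G (cis theta)))%:E) <= 0)%E.
Proof.
move=> hV; apply/ess_supP; apply: aeW => theta; rewrite lee_fin.
(* Without a radial limit, [radial_limit] takes the default value 0 and the inequality is
   trivial. *)
have [hc|hc] := pselect (cvg (G (r%:C * cis theta) @[r --> (1 : R)^'-])); last first.
  by rewrite /radial_limit (dvgP hc) mulr0.
have h1 : G (r%:C * cis theta) @[r --> (1 : R)^'-] --> radial_limit G (cis theta) by exact: hc.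
have h2 : complex.Re ((cis theta)^* * G (r%:C * cis theta)) @[r --> (1 : R)^'-] --> complex.Re ((cis theta)^* * radial_limit G (cis theta)).
  exact: (cvg_Re (cvgM (cvg_cst (cis theta)^*) h1)).
have hB : K * (1 - r ^+ 2) / r @[r --> (1 : R)^'-] --> (0 : R).
  exact: inward_bound_cvg.
apply: (ler_cvg_to h2 hB); near=> r.
have r0 : 0 < r by near: r; exact: nbhs_left_gt.
have r1 : r < 1 by near: r; exact: nbhs_left_lt.
have zD : disc (r%:C * cis theta) by apply: disc_circle; rewrite r1 ltW.
rewrite H2E//; exact: inward_circle.
Unshelve. all: by end_near. Qed.

End boundary.

(** * The equivalence *)

Section equivalence.
Variables (R : realType) (G : H2 R).
Local Notation C := R[i].

Definition inward := forall z : C, disc z ->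
  complex.Re (z^* * pser (coef G) z) <= normc (coef G 0%N) * (1 - normc z ^+ 2).

Definition weighted := forall z : C, disc z ->
  2 * complex.Re (z^* * G z) + (1 - normc z ^+ 2) * complex.Re (derive1 G z) <= 0.

Lemma toeplitz_weighted : toeplitz_dissipative (coef G) -> weighted.
Proof.
move=> H z zD; rewrite derive1_H2// H2E//.
exact: (toeplitz_dissipative_deriv H (conv_disc_coef G) zD).
Qed.

Lemma weighted_inward : weighted -> inward.
Proof.
move=> H z zD; have h := radial_monotone_bound (conv_disc_coef G) zD.
apply: le_trans (h _) _ => [w wD|].
  by rewrite -H2E// -derive1_H2//; exact: H.
have /disc_normc z1 := zD; have z0 := normc_ge0 z.
rewrite mulrC; apply: ler_wpM2r; first by rewrite subr_ge0 expr_le1// ltW.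
apply: le_trans (Re_le _) _; rewrite normcM normc_conj ler_piMl ?normc_ge0//.
exact: ltW.
Qed.

End equivalence.

Local Open Scope complex_scope.

Theorem theorem3p9 (R : realType) (G : H2 R) :
  dense (opA_dom G) /\
  [<-> generates_composition (opA_dom G) (opA G);
       forall z : R[i], disc z ->
         2 * complex.Re (z^* * G z)
           + (1 - Normc.normc z ^+ 2) * complex.Re (derive1 G z) <= 0;
       generates_quasicontractive (opA_dom G) (opA G);
       (ess_sup (circle_measure R) (fun theta : R =>
          (complex.Re ((cis theta)^* * radial_limit G (cis theta)))%:E)
        <= 0)%E].
Proof.
split; first exact: dense_opA_dom.
have W := @toeplitz_weighted R G; have I := @weighted_inward R G.
have T (h : inward G) := inward_toeplitz (conv_disc_coef G) h.
(* Generation and the boundary inequality both use the pointwise bound [inward], which is derived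
   from (ii); so the legs out of (iii) and (iv) pass through (ii). *)
tfae.
- by move=> /composition_toeplitz /W.
- by move=> /I h; have [] := inward_generates (T h) h.
- by move=> /quasicontractive_toeplitz /W /I; exact: inward_ess_sup.
- by move=> /ess_sup_toeplitz /W /I h; have [] := inward_generates (T h) h.
Qed.
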